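(* Let $\alpha\le\kappa$ be regular and uncountable cardinals. Then $\kappa$ is $\alpha$-Ramsey if and only if $\kappa=\kappa^{<\kappa}$ and $\kappa$ has the $\alpha$-filter property.
   Context: The background theory is ZFC. A weak $\kappa$-model is a (not necessarily transitive) set $M$ of size $\kappa$ with $\kappa+1\subseteq M$ and $\langle M,\in\rangle\models\mathrm{ZFC}^-$ (ZFC without power set, with the collection scheme). It is a $\kappa$-model if also $M^{<\kappa}\subseteq M$. An elementary embedding $j\colon M\to N$ (where $N$ is a set with the true membership relation) is $\kappa$-powerset preserving if it has critical point $\kappa$ and $\mathcal P(\kappa)\cap M=\mathcal P(\kappa)\cap N$. For regular $\alpha\le\kappa$, $\kappa$ is $\alpha$-Ramsey if for arbitrarily large (i.e. unboundedly many) regular cardinals $\theta$, every $A\subseteq\kappa$ is an element of some weak $\kappa$-model $M\prec H(\theta)$ which is closed under ${<}\alpha$-sequences, and for which there exists a $\kappa$-powerset preserving elementary embedding $j\colon M\to N$. A filter on $\kappa$ is a set $F\subseteq\mathcal P(\kappa)$ such that the intersection of any finitely many elements of $F$ has size $\kappa$. $F$ measures $X\subseteq\mathcal P(\kappa)$ if for every $A\in X$, $A\in F$ or $\kappa\setminus A\in F$. For a set $M$, a filter $F$ on $\kappa$ is $M$-normal if it measures $\mathcal P(\kappa)\cap M$ and $\{\alpha<\kappa\mid\alpha\in\bigcap_{\beta<\alpha}X_\beta\}\in F$ whenever $\langle X_\beta\mid\beta<\kappa\rangle\in M$ is a sequence of elements of $F$. Game $G^\theta_\gamma(\kappa)$,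 for regular uncountable cardinals $\kappa=\kappa^{<\kappa}<\theta$ and an ordinal $\gamma\le\kappa^+$: a game of perfect information in which two players, the challenger and the judge, take turns to play $\subseteq$-increasing sequences $\langle M_\xi\mid\xi<\gamma\rangle$ of $\kappa$-models and $\langle F_\xi\mid\xi<\gamma\rangle$ of filters on $\kappa$. At stage $\xi<\gamma$ the challenger plays $M_\xi$ and then the judge plays $F_\xi$, subject to: $M_\xi\prec H(\theta)$; $\langle M_{\eta}\mid\eta<\xi\rangle$ and $\langle F_{\eta}\cap M_{\eta}\mid\eta<\xi\rangle$ are elements of $M_\xi$; $F_\xi$ is a filter on $\kappa$ that measures $\mathcal P(\kappa)\cap M_\xi$; $F_\xi\supseteq\bigcup_{\eta<\xi}F_\eta$. (As usual, a player who cannot make a legal move loses.) Let $M_\gamma=\bigcup_{\xi<\gamma}M_\xi$ and $F_\gamma=\bigcup_{\xi<\gamma}F_\xi$. The judge wins if $F_\gamma$ is an $M_\gamma$-normal filter; otherwise the challenger wins. For uncountable $\kappa=\kappa^{<\kappa}$, $\kappa$ has the $\gamma$-filter property if the challenger does not have a winning strategy in $G^\theta_\gamma(\kappa)$, where $\theta>\kappa$ is regular (this does not depend on the choice of $\theta$).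
   Formalization: In ''κ-powerset preserving'', N also satisfies: each x in N whose elements in N all lie in κ is a subset of κ (automatic for transitive N). Without this, a non-transitive N makes every weakly compact κ α-Ramsey and the claim fails. *)

(* Defs.v *)
From Stdlib Require Import List.

Set Implicit Arguments.
Unset Strict Implicit.

(** * The set-theoretic universe

    The ambient theory ZFC is rendered shallowly: a universe is a type with a
    membership relation satisfying the ZFC axioms, where the "formulas" of the
    replacement scheme are the Rocq predicates.  Hence proper classes are
    predicates [V -> Prop], class functions are Rocq functions [V -> V], and a
    function with a set as domain is the restriction of a Rocq function to that
    set; [lam a f] below is its graph, as an element of the universe. *)

Record ZFC_universe := {
  V :> Type;
  mem : V -> V -> Prop;
  upair : V -> V -> V;
  bigcup : V -> V;
  power : V -> V;
  repl : (V -> V -> Prop) -> V -> V;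
  empty : V;
  omega : V;
  extensionality : forall x y, (forall z, mem z x <-> mem z y) -> x = y;
  foundation : forall x, (exists y, mem y x) ->
    exists y, mem y x /\ forall z, mem z x -> ~ mem z y;
  emptyP : forall x, ~ mem x empty;
  upairP : forall a b x, mem x (upair a b) <-> x = a \/ x = b;
  bigcupP : forall a x, mem x (bigcup a) <-> exists y, mem y a /\ mem x y;
  powerP : forall a x, mem x (power a) <-> forall y, mem y x -> mem y a;
  replP : forall (R : V -> V -> Prop) a,
    (forall x y z, mem x a -> R x y -> R x z -> y = z) ->
    forall y, mem y (repl R a) <-> exists x, mem x a /\ R x y;
  omega_inductive : mem empty omega /\
    forall x, mem x omega -> mem (bigcup (upair x (upair x x))) omega;
  omega_least : forall w, mem empty w ->
    (forall x, mem x w -> mem (bigcup (upair x (upair x x))) w) ->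
    forall x, mem x omega -> mem x w;
  choice : forall a,
    (forall x, mem x a -> exists y, mem y x) ->
    (forall x y z, mem x a -> mem y a -> mem z x -> mem z y -> x = y) ->
    exists c, forall x, mem x a -> exists! y, mem y x /\ mem y c
}.

Arguments mem {z}.
Arguments upair {z}.
Arguments bigcup {z}.
Arguments power {z}.
Arguments repl {z}.
Arguments empty {z}.
Arguments omega {z}.

Declare Scope zset_scope.
Delimit Scope zset_scope with zset.
Open Scope zset_scope.

Notation "x ∈ y" := (mem x y) (at level 70, no associativity) : zset_scope.
Notation "x ∉ y" := (~ mem x y) (at level 70, no associativity) : zset_scope.

Definition sub {U : ZFC_universe} (x y : U) : Prop := forall z, z ∈ x -> z ∈ y.

Notation "x ⊆ y" := (sub x y) (at level 70, no associativity) : zset_scope.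

(** * Basic constructions *)

Section Basic.
Context {U : ZFC_universe}.
Implicit Types (a b x y : U) (f : U -> U).

Definition sep (P : U -> Prop) a : U := repl (fun x y => x = y /\ P x) a.
Definition image f a : U := repl (fun x y => y = f x) a.
Definition union a b : U := bigcup (upair a b).
Definition inter a b : U := sep (fun x => x ∈ b) a.
Definition diff a b : U := sep (fun x => x ∉ b) a.
Definition succ a : U := union a (upair a a).
Definition opair a b : U := upair (upair a a) (upair a b).
Definition prod a b : U := bigcup (image (fun x => image (opair x) b) a).

(** The sequence [⟨ f x | x ∈ a ⟩], as a set of ordered pairs. *)
Definition lam a f : U := image (fun x => opair x (f x)) a.

(** The set of functions from [a] to [b]. *)
Definition funs a b : U :=
  sep (fun s => exists f, (forall x, x ∈ a -> f x ∈ b) /\ s = lam a f)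
      (power (prod a b)).

(** [⋃_(x ∈ a) f x]. *)
Definition bigcup_seq a f : U := bigcup (image f a).

Definition equinumerous a b : Prop :=
  exists f,
    (forall x, x ∈ a -> f x ∈ b) /\
    (forall x y, x ∈ a -> y ∈ a -> f x = f y -> x = y) /\
    (forall y, y ∈ b -> exists x, x ∈ a /\ f x = y).

Definition transitive_set x : Prop := forall y, y ∈ x -> y ⊆ x.

(** Von Neumann ordinals; [∈] is their strict order and [⊆] the weak one. *)
Definition ordinal x : Prop :=
  transitive_set x /\ forall y, y ∈ x -> transitive_set y.

Definition cardinal x : Prop :=
  ordinal x /\ forall y, y ∈ x -> ~ equinumerous y x.

Definition regular x : Prop :=
  cardinal x /\ omega ⊆ x /\
  forall b f, b ∈ x -> (forall i, i ∈ b -> f i ∈ x) ->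
    exists d, d ∈ x /\ forall i, i ∈ b -> f i ∈ d.

Definition uncountable_cardinal x : Prop := cardinal x /\ omega ∈ x.

(** [x^(<d)], the set of all functions from an element of [d] to [x]. *)
Definition ltfuns x d : U := bigcup_seq d (fun b => funs b x).

(** [kappa = kappa^(<kappa)], for a cardinal [kappa]. *)
Definition eq_weak_power (kappa : U) : Prop :=
  equinumerous (ltfuns kappa kappa) kappa.

Definition transitive_closure x t : Prop :=
  transitive_set t /\ x ⊆ t /\
  forall u, transitive_set u -> x ⊆ u -> t ⊆ u.

(** The class-predicate of [H(theta)]. *)
Definition H (theta : U) : U -> Prop := fun x =>
  exists t, transitive_closure x t /\ exists b, b ∈ theta /\ equinumerous b t.

End Basic.

(** * First-order satisfaction in [∈]-structures *)

Inductive formula :=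
| fEq (i j : nat)
| fMem (i j : nat)
| fNot (p : formula)
| fAnd (p q : formula)
| fAll (p : formula).  (* de Bruijn: binds index 0 *)

Section Models.
Context {U : ZFC_universe}.

Definition scons (x : U) (e : nat -> U) (n : nat) : U :=
  match n with 0 => x | S n => e n end.

(** [⟨D, ∈⟩ ⊨ p [e]]. *)
Fixpoint sat (D : U -> Prop) (p : formula) (e : nat -> U) : Prop :=
  match p with
  | fEq i j => e i = e j
  | fMem i j => e i ∈ e j
  | fNot p => ~ sat D p e
  | fAnd p q => sat D p e /\ sat D q e
  | fAll p => forall x, D x -> sat D p (scons x e)
  end.

Definition elts (M : U) : U -> Prop := fun x => x ∈ M.

Definition in_env (M : U) (e : nat -> U) : Prop := forall n, e n ∈ M.

(** [M ≺ ⟨D, ∈⟩]. *)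
Definition elementary_sub (M : U) (D : U -> Prop) : Prop :=
  (forall x, x ∈ M -> D x) /\
  forall p e, in_env M e -> (sat (elts M) p e <-> sat D p e).

Definition elementary_embedding (M N : U) (j : U -> U) : Prop :=
  (forall x, x ∈ M -> j x ∈ N) /\
  forall p e, in_env M e ->
    (sat (elts M) p e <-> sat (elts N) p (fun n => j (e n))).

(** [⟨M, ∈⟩ ⊨ "p = (x, y)"] for Kuratowski pairs. *)
Definition opair_in (M p x y : U) : Prop :=
  forall z, z ∈ M ->
    (z ∈ p <-> (forall w, w ∈ M -> (w ∈ z <-> w = x)) \/
               (forall w, w ∈ M -> (w ∈ z <-> w = x \/ w = y))).

(** [⟨M, ∈⟩ ⊨ "r is a (strict) well-order of a"]. *)
Definition wellorders_in (M r a : U) : Prop :=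
  let R x y := exists p, p ∈ M /\ p ∈ r /\ opair_in M p x y in
  let A x := x ∈ M /\ x ∈ a in
  (forall x, A x -> ~ R x x) /\
  (forall x y z, A x -> A y -> A z -> R x y -> R y z -> R x z) /\
  (forall x y, A x -> A y -> R x y \/ x = y \/ R y x) /\
  (forall b, b ∈ M -> (forall x, x ∈ M -> x ∈ b -> x ∈ a) ->
     (exists x, x ∈ M /\ x ∈ b) ->
     exists m, m ∈ M /\ m ∈ b /\
       forall x, x ∈ M -> x ∈ b -> x = m \/ R m x).

(** [⟨M, ∈⟩ ⊨ ZFC^-]: each axiom is written out relativized to [M], the
    schemes ranging over first-order formulas with parameters in [M].  As usual
    in the absence of power set, choice is the well-ordering principle. *)
Record ZFCminus (M : U) : Prop := {
  zm_extensionality : forall x y, x ∈ M -> y ∈ M ->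
    (forall z, z ∈ M -> (z ∈ x <-> z ∈ y)) -> x = y;
  zm_foundation : forall x, x ∈ M -> (exists y, y ∈ M /\ y ∈ x) ->
    exists y, y ∈ M /\ y ∈ x /\ forall z, z ∈ M -> z ∈ x -> z ∉ y;
  zm_pairing : forall x y, x ∈ M -> y ∈ M ->
    exists z, z ∈ M /\ x ∈ z /\ y ∈ z;
  zm_union : forall x, x ∈ M ->
    exists u, u ∈ M /\
      forall y z, y ∈ M -> z ∈ M -> y ∈ x -> z ∈ y -> z ∈ u;
  zm_infinity :
    exists w, w ∈ M /\
      (exists o, o ∈ M /\ o ∈ w /\ forall z, z ∈ M -> z ∉ o) /\
      (forall x, x ∈ M -> x ∈ w ->
        exists y, y ∈ M /\ y ∈ w /\
          forall z, z ∈ M -> (z ∈ y <-> z ∈ x \/ z = x));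
  zm_separation : forall p e a, in_env M e -> a ∈ M ->
    exists b, b ∈ M /\
      forall x, x ∈ M -> (x ∈ b <-> x ∈ a /\ sat (elts M) p (scons x e));
  zm_collection : forall p e a, in_env M e -> a ∈ M ->
    (forall x, x ∈ M -> x ∈ a ->
      exists y, y ∈ M /\ sat (elts M) p (scons y (scons x e))) ->
    exists b, b ∈ M /\
      forall x, x ∈ M -> x ∈ a ->
        exists y, y ∈ M /\ y ∈ b /\ sat (elts M) p (scons y (scons x e));
  zm_wellorder : forall a, a ∈ M -> exists r, r ∈ M /\ wellorders_in M r a
}.

Definition weak_model (kappa M : U) : Prop :=
  equinumerous M kappa /\ succ kappa ⊆ M /\ ZFCminus M.

Definition closed_lt (d M : U) : Prop := ltfuns M d ⊆ M.

Definition kappa_model (kappa M : U) : Prop :=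
  weak_model kappa M /\ closed_lt kappa M.

Definition critical_point (kappa : U) (j : U -> U) : Prop :=
  (forall b, b ∈ kappa -> j b = b) /\ j kappa <> kappa.

(** [N] need not be transitive, so the last clause is needed for
    [P(kappa) ∩ N] to be what [N] takes for the power set of [kappa]; it is
    automatic when [N] is transitive.  Without it, one could add to each new
    subset of [kappa] in [N] an element from outside [N], which leaves
    [⟨N, ∈⟩] unchanged up to isomorphism but removes that subset from
    [P(kappa) ∩ N]. *)
Definition powerset_preserving (kappa M N : U) (j : U -> U) : Prop :=
  elementary_embedding M N j /\
  critical_point kappa j /\
  inter (power kappa) M = inter (power kappa) N /\
  (forall x, x ∈ N -> (forall y, y ∈ N -> y ∈ x -> y ∈ kappa) -> x ⊆ kappa).

Definition Ramsey (alpha kappa : U) : Prop :=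
  forall d, ordinal d ->
  exists theta, d ∈ theta /\ regular theta /\
  forall A, A ⊆ kappa ->
  exists M, A ∈ M /\ weak_model kappa M /\ elementary_sub M (H theta) /\
    closed_lt alpha M /\
    exists N j, powerset_preserving kappa M N j.

(** * Filters *)

(** No closure under supersets or intersections is required. *)
Definition filter (kappa F : U) : Prop :=
  F ⊆ power kappa /\
  forall l : list U, (forall A, In A l -> A ∈ F) ->
    equinumerous (sep (fun x => forall A, In A l -> x ∈ A) kappa) kappa.

Definition measures (kappa F X : U) : Prop :=
  forall A, A ∈ X -> A ∈ F \/ diff kappa A ∈ F.

Definition diagonal (kappa : U) (X : U -> U) : U :=
  sep (fun a => forall b, b ∈ a -> a ∈ X b) kappa.

Definition normal_filter (kappa M F : U) : Prop :=
  filter kappa F /\ measures kappa F (inter (power kappa) M) /\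
  forall X : U -> U, lam kappa X ∈ M ->
    (forall b, b ∈ kappa -> X b ∈ F) -> diagonal kappa X ∈ F.

(** * The game [G^theta_gamma(kappa)]

    [M] and [F] are the sequences of moves of the challenger and the judge; at
    stage [xi] only their values below [xi] matter. *)

Definition challenger_legal (theta kappa xi : U) (M F : U -> U) (X : U) : Prop :=
  kappa_model kappa X /\ elementary_sub X (H theta) /\
  (forall eta, eta ∈ xi -> M eta ⊆ X) /\
  lam xi M ∈ X /\ lam xi (fun eta => inter (F eta) (M eta)) ∈ X.

Definition judge_legal (kappa xi : U) (F : U -> U) (X Y : U) : Prop :=
  filter kappa Y /\ measures kappa Y (inter (power kappa) X) /\
  forall eta, eta ∈ xi -> F eta ⊆ Y.

Definition legal_run (theta kappa xi : U) (M F : U -> U) : Prop :=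
  forall eta, eta ∈ xi ->
    challenger_legal theta kappa eta M F (M eta) /\
    judge_legal kappa eta F (M eta) (F eta).

Definition judge_wins (kappa gamma : U) (M F : U -> U) : Prop :=
  normal_filter kappa (bigcup_seq gamma M) (bigcup_seq gamma F).

(** A strategy of the challenger gives his move at stage [xi] from the judge's
    moves at the stages before [xi]. *)
Definition strategy (gamma : U) (sigma : U -> (U -> U) -> U) : Prop :=
  forall xi F F', xi ∈ gamma -> (forall eta, eta ∈ xi -> F eta = F' eta) ->
    sigma xi F = sigma xi F'.

(** The first clause says that the challenger never gets stuck.  A run in which
    the judge gets stuck does not extend to a legal run of length [gamma] and is
    thus won by the challenger. *)
Definition winning_strategy (theta kappa gamma : U)
    (sigma : U -> (U -> U) -> U) : Prop :=
  strategy gamma sigma /\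
  forall F : U -> U, let M xi := sigma xi F in
    (forall xi, xi ∈ gamma -> legal_run theta kappa xi M F ->
       challenger_legal theta kappa xi M F (M xi)) /\
    (legal_run theta kappa gamma M F -> ~ judge_wins kappa gamma M F).

Definition filter_property (gamma kappa : U) : Prop :=
  forall theta, regular theta -> kappa ∈ theta ->
    ~ exists sigma, winning_strategy theta kappa gamma sigma.

End Models.

(* Main.v *)
From Stdlib Require Import List Lia Cantor ClassicalEpsilon FunctionalExtensionality.
From Corelib Require Import ssreflect.
Require Import Defs.

(** Both directions translate between an embedding [j : M -> N] and a normal
    ultrafilter on the subsets of [kappa] in [M], the translation being arranged in
    stages so that it becomes a play of the game.

    From the filter property to embeddings: fix a regular [theta] and [A ⊆ kappa].
    Since [kappa = kappa^(<kappa)], the challenger can always answer with an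
    elementary submodel of [H(theta)] of size [kappa] that is closed under sequences
    of length less than [kappa] and contains [A] and the history of the play
    ([kappa_model_exists], [response_legal]).  This strategy does not win, so some
    run is won by the judge.  Its limit model [M] is elementary in [H(theta)], has
    size [kappa], and is closed under sequences of length less than [alpha], and its
    limit filter is normal for [M].  The ultrapower of [M] is well-founded by
    countable completeness, which is where [alpha] is uncountable; Los's theorem
    ([los]) gives the embedding.  Normality makes [kappa] the critical point and puts
    the subsets of [kappa] in [M] into [N] ([regressive_const]); conversely a subset of
    [kappa] in [N] is in [M] because each model of the run contains the traces of the
    filter on the previous models ([limit_amenable], [embedding_powerset]).

    From embeddings to the filter property: given [j : M -> N], one has
    [kappa ∈ j kappa] ([kappa_N]), and the sets [X] with [kappa ∈ j X] form an
    ultrafilter [u] that is normal for [M].  If a set [X] in [M] has size [kappa], then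
    the trace of [u] on [X] is in [M]: its set of indices is a subset of [kappa] that
    exists in [N] ([derived_amenable]).  Suppose that the challenger has a winning
    strategy in the game for some [theta], and let [M] be elementary in [H(theta')]
    for a large [theta'].  The judge plays the traces of [u] on the challenger's models.
    If the strategy is in [M], then these models and traces are in [M] as well, by
    induction along the run, using at limit stages that [M] is closed under sequences
    of length less than [alpha] ([play_stage]); so the play is legal, and it is won by
    normality.  To find a winning strategy in [M], strategies are coded by sets with a
    property that is first-order over [H(theta')] ([beats_normal_filters]); it suffices
    to consider runs in which the judge plays the traces of one fixed set.

    The equation [kappa = kappa^(<kappa)] also follows from an embedding.  If [kappa]
    many subsets of some [b < kappa] were enumerated in [M], then the image of the
    enumeration would have at [kappa] a value that is a subset of [b], hence fixed by
    [j], hence enumerated before [kappa] ([no_injection]).  So [kappa] is a strong limit,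
    all functions between ordinals below [kappa] are in [M], and [M] has size [kappa].

    What elementarity in [H(theta)] yields is obtained from a calculus of definable
    predicates and terms, which reads formulas off the shape of statements about sets. *)

Set Implicit Arguments.
Unset Strict Implicit.

(** * Elementary set theory *)

Section Sets.
Context {U : ZFC_universe}.
Implicit Types (a b c d k t x y z : U) (f : U -> U).

Lemma sub_antisym x y : x ⊆ y -> y ⊆ x -> x = y.
Proof. by move=> h1 h2; apply: extensionality => z; split; [apply: h1|apply: h2]. Qed.

Lemma sub_refl x : x ⊆ x. Proof. by []. Qed.

Lemma sub_trans x y z : x ⊆ y -> y ⊆ z -> x ⊆ z.
Proof. by move=> h1 h2 w /h1/h2. Qed.

Lemma in_sep P a x : x ∈ sep P a <-> x ∈ a /\ P x.
Proof.
rewrite /sep replP; first by move=> u v w _ [<- _] [<- _].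
by split=> [[u [hu [<- hP]]]|[h1 h2]] //; exists x.
Qed.

Lemma sep_sub P a : sep P a ⊆ a.
Proof. by move=> x /in_sep []. Qed.

Lemma in_image f a y : y ∈ image f a <-> exists x, x ∈ a /\ y = f x.
Proof. by rewrite /image replP => // u v w _ -> ->. Qed.

Lemma image_in f a x : x ∈ a -> f x ∈ image f a.
Proof. by move=> h; apply/in_image; exists x. Qed.

Lemma in_union a b x : x ∈ union a b <-> x ∈ a \/ x ∈ b.
Proof.
rewrite /union bigcupP; split.
  by move=> [y [/upairP[->|->]]]; [left|right].
by move=> [h|h]; [exists a|exists b]; split=> //; apply/upairP; [left|right].
Qed.

Lemma in_inter a b x : x ∈ inter a b <-> x ∈ a /\ x ∈ b.
Proof. exact: in_sep. Qed.

Lemma in_diff a b x : x ∈ diff a b <-> x ∈ a /\ x ∉ b.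
Proof. exact: in_sep. Qed.

Lemma in_succ a x : x ∈ succ a <-> x ∈ a \/ x = a.
Proof. by rewrite /succ in_union upairP; intuition. Qed.

Lemma in_bigcup_seq a f x : x ∈ bigcup_seq a f <-> exists i, i ∈ a /\ x ∈ f i.
Proof.
rewrite /bigcup_seq bigcupP; split.
  by move=> [y [/in_image [i [hi ->]] hx]]; exists i.
by move=> [i [hi hx]]; exists (f i); split=> //; apply: image_in.
Qed.

Lemma upair1_inj a b : upair a a = upair b b -> a = b.
Proof. by move=> h; have /upairP[] : a ∈ upair b b by rewrite -h upairP; left. Qed.

Lemma opair_inj a b c d : opair a b = opair c d -> a = c /\ b = d.
Proof.
rewrite /opair => h.
have ha : a = c.
  have : upair a a ∈ upair (upair c c) (upair c d) by rewrite -h upairP; left.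
  move=> /upairP[/upair1_inj //|h1].
  have /upairP[//|hc] : c ∈ upair a a by rewrite h1 upairP; left.
  by have /upairP[] : c ∈ upair a a by rewrite h1 upairP; left.
split=> //; subst c.
have hb : b = a \/ b = d.
  have : upair a b ∈ upair (upair a a) (upair a d) by rewrite -h upairP; right.
  move=> /upairP[h1|h1].
    by left; have /upairP[] : b ∈ upair a a by rewrite -h1 upairP; right.
  by have /upairP : b ∈ upair a d by rewrite -h1 upairP; right.
have hd : d = a \/ d = b.
  have : upair a d ∈ upair (upair a a) (upair a b) by rewrite h upairP; right.
  move=> /upairP[h1|h1].
    by left; have /upairP[] : d ∈ upair a a by rewrite -h1 upairP; right.
  by have /upairP : d ∈ upair a b by rewrite -h1 upairP; right.
by move: hb hd => [hb|hb] [hd|hd]; congruence.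
Qed.

Lemma in_prod a b p : p ∈ prod a b <-> exists x y, x ∈ a /\ y ∈ b /\ p = opair x y.
Proof.
rewrite /prod -/(bigcup_seq a (fun x => image (opair x) b)) in_bigcup_seq; split.
  by move=> [x [hx /in_image[y [hy ->]]]]; exists x, y.
by move=> [x [y [hx [hy ->]]]]; exists x; split=> //; apply: image_in.
Qed.

Lemma in_lam a f p : p ∈ lam a f <-> exists x, x ∈ a /\ p = opair x (f x).
Proof. exact: in_image. Qed.

Lemma lam_ext a f g : (forall x, x ∈ a -> f x = g x) -> lam a f = lam a g.
Proof.
by move=> h; apply: extensionality => p; rewrite !in_lam; split;
  move=> [x [hx ->]]; exists x; rewrite h.
Qed.

Lemma opair_in_lam a f x y : opair x y ∈ lam a f <-> x ∈ a /\ y = f x.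
Proof.
rewrite in_lam; split; first by move=> [w [hw /opair_inj[-> ->]]].
by move=> [h ->]; exists x.
Qed.

Lemma in_funs a b s :
  s ∈ funs a b <-> exists f, (forall x, x ∈ a -> f x ∈ b) /\ s = lam a f.
Proof.
rewrite /funs in_sep; split; first by move=> [].
move=> [f [hf ->]]; split; last by exists f.
apply/powerP => p /in_lam[x [hx ->]]; apply/in_prod; exists x, (f x); split=> //.
by split=> //; apply: hf.
Qed.

Lemma in_ltfuns a d s : s ∈ ltfuns a d <->
  exists b f, b ∈ d /\ (forall x, x ∈ b -> f x ∈ a) /\ s = lam b f.
Proof.
rewrite /ltfuns in_bigcup_seq; split.
  by move=> [b [hb /in_funs[f [hf ->]]]]; exists b, f.
by move=> [b [f [hb [hf ->]]]]; exists b; split=> //; apply/in_funs; exists f.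
Qed.

(** The value of the relation [r] at [x].  It is total, so that every set acts as a
    function; in particular every element of a submodel represents an element of
    its ultrapower. *)
Definition ap (r x : U) : U :=
  bigcup (sep (fun y => opair x y ∈ r) (bigcup (bigcup r))).

Lemma ap_eq r x y : opair x y ∈ r -> (forall y', opair x y' ∈ r -> y' = y) ->
  ap r x = y.
Proof.
move=> h1 h2; apply: extensionality => z; rewrite /ap bigcupP; split.
  by move=> [w [/in_sep[_ /h2 ->]]].
move=> hz; exists y; split=> //; apply/in_sep; split=> //.
apply/bigcupP; exists (upair x y); split; last by apply/upairP; right.
by apply/bigcupP; exists (opair x y); split=> //; apply/upairP; right.
Qed.

Lemma ap_lam a f x : x ∈ a -> ap (lam a f) x = f x.
Proof. by move=> h; apply: ap_eq => [|y]; rewrite opair_in_lam => // -[]. Qed.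

Lemma mem_irrefl x : x ∉ x.
Proof.
move=> h; have [|y [/upairP hy]] := @foundation U (upair x x).
  by exists x; apply/upairP; left.
have -> : y = x by case: hy.
by move=> /(_ x) []//; apply/upairP; left.
Qed.

Lemma mem_asym x y : x ∈ y -> y ∉ x.
Proof.
move=> hxy hyx; have [|z [/upairP hz h]] := @foundation U (upair x y).
  by exists x; apply/upairP; left.
by case: hz => ?; subst z; [apply: (h y)|apply: (h x)] => //; apply/upairP; intuition.
Qed.

(** * Numerals and well-foundedness *)

Fixpoint num (n : nat) : U := match n with 0 => empty | S n => succ (num n) end.

Lemma num_omega n : num n ∈ omega.
Proof.
elim: n => [|n IH]; first by case: (omega_inductive U).
by case: (omega_inductive U) => _; apply.
Qed.

Lemma omegaP x : x ∈ omega <-> exists n, x = num n.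
Proof.
split; last by move=> [n ->]; apply: num_omega.
move=> hx.
have /(_ x hx) : forall y, y ∈ omega -> y ∈ sep (fun y => exists n, y = num n) omega.
  apply: omega_least; first by apply/in_sep; split; [apply: (num_omega 0)|exists 0].
  by move=> y /in_sep[h [n hn]]; apply/in_sep; subst y; split;
    [apply: (num_omega (S n))|exists (S n)].
by move=> /in_sep[].
Qed.

Lemma num_lt n m : n < m -> num n ∈ num m.
Proof.
elim: m => [|m IH] h; first by lia.
apply/in_succ; have [e|e] : n = m \/ n < m by lia.
  by subst; right.
by left; apply: IH.
Qed.

Lemma num_inj n m : num n = num m -> n = m.
Proof.
move=> h; have [//|[]hnm] : n = m \/ n < m \/ m < n by lia.
all: by move: (num_lt hnm); rewrite h => /mem_irrefl.
Qed.

(** Replacement needs a set of indices, here the numerals in [omega]. *)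
Definition seqset (s : nat -> U) : U :=
  repl (fun k y => exists n, k = num n /\ y = s n) omega.

Lemma in_seqset s y : y ∈ seqset s <-> exists n, y = s n.
Proof.
rewrite /seqset replP.
  by move=> k u v _ [n [-> ->]] [m [/num_inj -> ->]].
split; first by move=> [k [_ [n [_ ->]]]]; exists n.
by move=> [n ->]; exists (num n); split; [apply: num_omega|exists n].
Qed.

Definition trcl x : U := bigcup (seqset (fun n => Nat.iter n bigcup x)).

Lemma in_trcl x y : y ∈ trcl x <-> exists n, y ∈ Nat.iter n bigcup x.
Proof.
rewrite /trcl bigcupP; split.
  by move=> [z [/in_seqset[n ->] h]]; exists n.
by move=> [n h]; exists (Nat.iter n bigcup x); split=> //; apply/in_seqset; exists n.
Qed.

Lemma trclP x : transitive_closure x (trcl x).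
Proof.
split.
  move=> y /in_trcl[n hn] z hz; apply/in_trcl; exists (S n) => /=.
  by apply/bigcupP; exists y.
split; first by move=> y hy; apply/in_trcl; exists 0.
move=> u hu hx y /in_trcl[n]; elim: n y => [|n IH] y /=; first exact: hx.
by move=> /bigcupP[z [/IH hz hy]]; apply: (hu z).
Qed.

(** Foundation speaks of sets; a counterexample to a predicate is placed in a
    transitive set, where a least one exists. *)
Lemma mem_ind (P : U -> Prop) :
  (forall x, (forall y, y ∈ x -> P y) -> P x) -> forall x, P x.
Proof.
move=> hP x; apply: NNPP => hx.
have [ht [hs _]] := trclP (upair x x).
have [|y [/in_sep[hy hPy] hmin]] := @foundation U (sep (fun y => ~ P y) (trcl (upair x x))).
  by exists x; apply/in_sep; split=> //; apply/hs/upairP; left.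
apply: hPy; apply: hP => z hz; apply: NNPP => hPz; apply: (hmin z) => //.
by apply/in_sep; split=> //; apply: (ht y).
Qed.

Lemma mem_wf : well_founded (@mem U).
Proof. by apply: mem_ind => x h; constructor. Qed.

(** Recursion along a well-founded relation [R]; the recursive calls outside
    the domain of [R] return the default value [empty]. *)
Definition restr (P : U -> Prop) f : U -> U :=
  fun y =>
  match excluded_middle_informative (P y) with left _ => f y | right _ => empty end.

Lemma restrT (P : U -> Prop) f y : P y -> restr P f y = f y.
Proof. by rewrite /restr; case: excluded_middle_informative. Qed.

Definition wfrec (R : U -> U -> Prop) (wf : well_founded R)
    (G : U -> (U -> U) -> U) : U -> U :=
  Fix wf (fun _ => V U) (fun x rec => G x (fun y =>
    match excluded_middle_informative (R y x) with
    | left h => rec y h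
    | right _ => empty
    end)).

Lemma wfrec_eq R wf G x :
  @wfrec R wf G x = G x (restr (fun y => R y x) (wfrec wf G)).
Proof.
rewrite {1}/wfrec Fix_eq; last by [].
move=> u f g h; congr (G u _); apply: functional_extensionality => y.
by case: excluded_middle_informative.
Qed.

(** * Ordinals *)

Lemma ordinal_in x y : ordinal x -> y ∈ x -> ordinal y.
Proof.
move=> [h1 h2] hy; split; first exact: h2.
by move=> z hz; apply: h2; apply: (h1 y).
Qed.

Lemma ordinal_trans x y z : ordinal x -> y ∈ x -> z ∈ y -> z ∈ x.
Proof. by move=> [h _] hy; apply: h. Qed.

Lemma ordinal_sub x y : ordinal x -> y ∈ x -> y ⊆ x.
Proof. by move=> [h _]; apply: h. Qed.

Lemma ordinal_total x y : ordinal x -> ordinal y -> x ∈ y \/ x = y \/ y ∈ x.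
Proof.
elim/mem_ind: x y => x IHx; elim/mem_ind => y IHy hx hy.
case: (classic (x ∈ y)) => [|nxy]; first by left.
case: (classic (y ∈ x)) => [|nyx]; first by right; right.
right; left; apply: sub_antisym => z hz.
  have [//|[e|e]] := IHx z hz y (ordinal_in hx hz) hy.
    by subst; case: nyx.
  by case: nyx; apply: (ordinal_trans hx hz).
have [e|[e|//]] := IHy z hz hx (ordinal_in hy hz).
  by case: nxy; apply: (ordinal_trans hy hz).
by subst; case: nxy.
Qed.

Lemma ordinal_subP x y : ordinal x -> ordinal y -> x ⊆ y -> x = y \/ x ∈ y.
Proof.
move=> hx hy h; have [|[|/h/mem_irrefl]] := ordinal_total hx hy; intuition.
Qed.

Lemma ordinal_notin x y : ordinal x -> ordinal y -> x ∉ y -> y ⊆ x.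
Proof.
move=> hx hy h; have [//|[->//|]] := ordinal_total hx hy; exact: ordinal_sub.
Qed.

Lemma ordinal_sub_in x y z : ordinal x -> ordinal z -> x ⊆ y -> y ∈ z -> x ∈ z.
Proof.
move=> hx hz h hy.
have [->//|] := ordinal_subP hx (ordinal_in hz hy) h.
exact: ordinal_trans.
Qed.

Lemma ordinal_succ x : ordinal x -> ordinal (succ x).
Proof.
move=> [h1 h2]; split.
  move=> y /in_succ[hy|->] z hz; apply/in_succ; left=> //.
  by apply: (h1 y).
by move=> y /in_succ[/h2|->].
Qed.

Lemma ordinal_bigcup x : (forall y, y ∈ x -> ordinal y) -> ordinal (bigcup x).
Proof.
move=> h; split.
  move=> y /bigcupP[z [hz hy]] w hw; apply/bigcupP; exists z; split=> //.
  by apply: (ordinal_trans (h z hz) hy).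
by move=> y /bigcupP[z [hz hy]]; case: (h z hz) => _; apply.
Qed.

Lemma ordinal_bigcup_seq a f :
  (forall i, i ∈ a -> ordinal (f i)) -> ordinal (bigcup_seq a f).
Proof. by move=> h; apply: ordinal_bigcup => y /in_image[i [hi ->]]; apply: h. Qed.

Lemma ordinal_least (P : U -> Prop) x : ordinal x -> P x ->
  exists y, ordinal y /\ P y /\ forall z, z ∈ y -> ~ P z.
Proof.
elim/mem_ind: x => x IH hx hP.
case: (classic (exists y, y ∈ x /\ P y)) => [[y [hy hPy]]|n].
  by apply: (IH y) => //; apply: (ordinal_in hx).
by exists x; split=> //; split=> // z hz hPz; apply: n; exists z.
Qed.

End Sets.

(** * Cardinality *)

Section Cardinality.
Context {U : ZFC_universe}.
Implicit Types (a b c d k t x y z : U) (f : U -> U).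

Lemma choose_fun (P : U -> Prop) (Q : U -> U -> Prop) :
  (forall x, P x -> exists y, Q x y) -> exists f, forall x, P x -> Q x (f x).
Proof.
move=> h; exists (fun x => epsilon (inhabits empty) (Q x)) => x /h.
exact: epsilon_spec.
Qed.

Definition injects a b : Prop :=
  exists f, (forall x, x ∈ a -> f x ∈ b) /\
    forall x y, x ∈ a -> y ∈ a -> f x = f y -> x = y.

Lemma injects_sub a b : a ⊆ b -> injects a b.
Proof. by move=> h; exists (fun x => x). Qed.

Lemma injects_trans a b c : injects a b -> injects b c -> injects a c.
Proof.
move=> [f [hf fi]] [g [hg gi]]; exists (fun x => g (f x)); split.
  by move=> x hx; apply/hg/hf.
by move=> x y hx hy /gi h; apply: fi => //; apply: h; apply: hf.
Qed.

Lemma injects_of_cover a b :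
  (exists f, forall y, y ∈ b -> exists x, x ∈ a /\ f x = y) -> injects b a.
Proof.
move=> [f /choose_fun[g hg]]; exists g; split; first by move=> x /hg[].
by move=> x y /hg[_ h1] /hg[_ h2] h; rewrite -h1 h.
Qed.

Lemma cover_of_injects a b (d0 : U) : d0 ∈ b -> injects b a ->
  exists f, (forall x, f x ∈ b) /\ forall y, y ∈ b -> exists x, x ∈ a /\ f x = y.
Proof.
move=> hd [g [hg gi]].
have /choose_fun[f hf] : forall x, True -> exists z, z ∈ b /\
    forall y, y ∈ b -> g y = x -> z = y.
  move=> x _.
  case: (classic (exists y, y ∈ b /\ g y = x)) => [[y [hy e]]|n].
    by exists y; split=> // z hz hgz; apply: gi => //; congruence.
  by exists d0; split=> // y hy e; case: n; exists y.
exists f; split; first by move=> x; case: (hf x).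
by move=> y hy; exists (g y); split; [apply: hg|case: (hf (g y)) => // _; apply].
Qed.

Lemma equinumerous_refl a : equinumerous a a.
Proof. by exists (fun x => x); split=> //; split=> // y hy; exists y. Qed.

Lemma equinumerous_sym a b : equinumerous a b -> equinumerous b a.
Proof.
move=> [f [hf [fi fs]]]; have [g hg] := choose_fun fs; exists g; split.
  by move=> y /hg[].
split; first by move=> x y /hg[_ h1] /hg[_ h2] h; rewrite -h1 h.
move=> x hx; exists (f x); split; first exact: hf.
by have [h1 h2] := hg _ (hf x hx); apply: fi.
Qed.

Lemma equinumerous_injects a b : equinumerous a b -> injects a b.
Proof. by move=> [f [h1 [h2 _]]]; exists f. Qed.

Section CantorBernstein.
Variables (a b : U) (f g : U -> U).

(** The elements of [a] whose chain of preimages under [g] and [f] stops in [a]. *)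
Inductive a_stopper : U -> Prop :=
| stop0 x : x ∈ a -> (forall y, y ∈ b -> g y <> x) -> a_stopper x
| stopS x : a_stopper x -> a_stopper (g (f x)).
End CantorBernstein.

Lemma cantor_bernstein a b : injects a b -> injects b a -> equinumerous a b.
Proof.
move=> [f [hf fi]] [g [hg gi]]; pose C := a_stopper a b f g.
have hCa x : C x -> x ∈ a by elim=> // y _ h; apply/hg/hf.
have /choose_fun[h hh] : forall x, x ∈ a ->
    exists y, y ∈ b /\ (C x -> y = f x) /\ (~ C x -> g y = x).
  move=> x hx; case: (classic (C x)) => hC; first by exists (f x); split; [apply: hf|].
  have [y [hy e]] : exists y, y ∈ b /\ g y = x.
    apply: NNPP => n; apply: hC; apply: stop0 => // y hy e.
    by apply: n; exists y.
  by exists y.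
exists h; split; first by move=> x /hh[].
split.
{ move=> x y hx hy e; have [hbx [hx1 hx2]] := hh x hx; have [hby [hy1 hy2]] := hh y hy.
  case: (classic (C x)) => cx; case: (classic (C y)) => cy.
  - by apply: fi => //; rewrite -hx1 // -hy1.
  - by case: (cy); rewrite -(hy2 cy) -e (hx1 cx); apply: stopS.
  - by case: (cx); rewrite -(hx2 cx) e (hy1 cy); apply: stopS.
  - by rewrite -(hx2 cx) -(hy2 cy) e. }
move=> y hy; case: (classic (C (g y))) => hC.
  move e : (g y) hC => w hC; case: hC e => [x _ n e|x hx e]; first by case: (n y).
  have hxa := hCa _ hx; exists x; split=> //.
  have [_ [-> //]] := hh x hxa; symmetry; apply: gi => //; exact: hf.
exists (g y); split; first exact: hg.
have [hb [_ h2]] := hh _ (hg y hy); exact: gi (h2 hC).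
Qed.

(** ** Hartogs numbers and the well-ordering theorem *)

(** The order of the ordinal [b], copied along [g]; its reflexivity makes the
    field of the relation recoverable when [b] has at most one element. *)
Definition code (b : U) (g : U -> U) : U :=
  bigcup_seq b (fun y => image (fun x => opair (g x) (g y)) (succ y)).

Lemma in_code b g p : p ∈ code b g <->
  exists x y, y ∈ b /\ x ∈ succ y /\ p = opair (g x) (g y).
Proof.
rewrite in_bigcup_seq; split.
  by move=> [y [hy /in_image[x [hx ->]]]]; exists x, y.
by move=> [x [y [hy [hx ->]]]]; exists y; split=> //; apply/in_image; exists x.
Qed.

(** By induction along [b]: an ordinal is its own collapse, so equal codes leave no
    choice for the ordinal or for the injection. *)
Lemma code_sub b b' g g' : ordinal b -> ordinal b' ->
  (forall x y, x ∈ b -> y ∈ b -> g x = g y -> x = y) ->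
  (forall x y, x ∈ b' -> y ∈ b' -> g' x = g' y -> x = y) ->
  code b g = code b' g' -> forall x, x ∈ b -> x ∈ b' /\ g' x = g x.
Proof.
move=> ob ob' gi gi' e; apply: mem_ind => x IH hx.
have succ_in c y z : ordinal c -> y ∈ c -> z ∈ succ y -> z ∈ c.
  by move=> hc hy /in_succ[|->//]; apply: ordinal_trans hc hy.
have [v [hv hgv]] : exists v, v ∈ b' /\ g' v = g x.
  have : opair (g x) (g x) ∈ code b' g'.
    by rewrite -e in_code; exists x, x; split=> //; split=> //; apply/in_succ; right.
  by move=> /in_code[u [v [hv [_ /opair_inj[_ h]]]]]; exists v.
have sub : x ⊆ v /\ v ⊆ x; last first.
  by case: sub => h1 h2; have ? := sub_antisym h1 h2; subst v.
split=> [y hy|u hu].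
  have hyb : y ∈ b by apply: ordinal_trans ob hx hy.
  have [hyb' hgy] := IH y hy hyb.
  have : opair (g y) (g x) ∈ code b' g'.
    by rewrite -e in_code; exists y, x; split=> //; split=> //; apply/in_succ; left.
  move=> /in_code[u [w [hw [hu /opair_inj[h1 h2]]]]].
  have ? : w = v by apply: gi' => //; congruence.
  have ? : u = y by apply: gi' => //; [apply: succ_in hu|congruence].
  subst; case/in_succ: hu => // ?; subst.
  have ? : v = x by apply: gi => //; congruence.
  by subst; case: (mem_irrefl hy).
have hub' : u ∈ b' by apply: ordinal_trans ob' hv hu.
have : opair (g' u) (g' v) ∈ code b g.
  by rewrite e in_code; exists u, v; split=> //; split=> //; apply/in_succ; left.
move=> /in_code[y [w [hw [hy /opair_inj[h1 h2]]]]].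
have ? : w = x by apply: gi => //; congruence.
subst w; case/in_succ: hy => [hy|?].
  have [hyb' hgy] := IH y hy (ordinal_trans ob hx hy).
  by have <- : y = u by apply: gi' => //; congruence.
have ? : u = v by apply: gi' => //; congruence.
by subst; case: (mem_irrefl hu).
Qed.

(** The ordinals that inject into [Z] form a set, because each of them is
    determined by the copy of its order in [Z × Z]. *)
Lemma hartogs Z : exists h, ordinal h /\
  forall b, b ∈ h <-> ordinal b /\ injects b Z.
Proof.
pose R r b := ordinal b /\ exists g, (forall x, x ∈ b -> g x ∈ Z) /\
  (forall x y, x ∈ b -> y ∈ b -> g x = g y -> x = y) /\ r = code b g.
have [h hh] : exists h, forall b, b ∈ h <-> ordinal b /\ injects b Z.
  exists (repl R (power (prod Z Z))) => b; rewrite replP; last first.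
    split; first by move=> [r [_ [ob [g [h1 [h2 _]]]]]]; split=> //; exists g.
    move=> [ob [g [h1 h2]]]; exists (code b g); split; last by split=> //; exists g.
    apply/powerP => p /in_code[x [y [hy [hx ->]]]]; apply/in_prod.
    exists (g x), (g y); split; last by split=> //; apply: h1.
    by apply: h1; case/in_succ: hx => [hx|->//]; apply: ordinal_trans ob hy hx.
  move=> r u v _ [ou [g [_ [gi e]]]] [ov [g' [_ [gi' e']]]].
  have e2 : code u g = code v g' by congruence.
  apply: sub_antisym => x hx.
    by have [] := code_sub ou ov gi gi' e2 hx.
  by have [] := code_sub ov ou gi' gi (eq_sym e2) hx.
exists h; split=> //; split; last by move=> b /hh[[]].
move=> b /hh[ob ib] y hy; apply/hh; split; first exact: ordinal_in hy.
by apply: injects_trans ib; apply/injects_sub/ordinal_sub.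
Qed.

(** Choosing new elements of [x] along the Hartogs number of [x] must exhaust [x]. *)
Lemma well_ordering x : exists c, ordinal c /\ equinumerous c x.
Proof.
have [h [oh hh]] := hartogs x.
pose G b (rec : U -> U) : U := epsilon (inhabits empty) (fun y => y ∈ x /\ y ∉ image rec b).
pose g := wfrec (@mem_wf U) G.
have gE b : (exists y, y ∈ x /\ y ∉ image g b) -> g b ∈ x /\ g b ∉ image g b.
  have e : image (restr (fun y => y ∈ b) g) b = image g b.
    apply: extensionality => y; rewrite !in_image; split; move=> [w [hw ->]];
      by exists w; rewrite restrT.
  have gb : g b = G b (restr (fun y => y ∈ b) g) by rewrite {1}/g wfrec_eq.
  move=> hy; rewrite gb /G e.
  exact: (epsilon_spec (inhabits empty) (fun y => y ∈ x /\ y ∉ image g b)).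
have ginj b : ordinal b -> (forall c, c ∈ b -> g c ∈ x /\ g c ∉ image g c) ->
    forall u v, u ∈ b -> v ∈ b -> g u = g v -> u = v.
  move=> ob hb u v hu hv e.
  have [huv|[//|hvu]] := ordinal_total (ordinal_in ob hu) (ordinal_in ob hv).
    by have [_ []] := hb v hv; rewrite -e; apply: image_in.
  by have [_ []] := hb u hu; rewrite e; apply: image_in.
have [b [ob hb]] : exists b, ordinal b /\ x ⊆ image g b.
  apply: NNPP => n.
  have hn b : ordinal b -> g b ∈ x /\ g b ∉ image g b.
    move=> ob; apply: gE; apply: NNPP => n2; apply: n; exists b; split=> // y hy.
    by apply: NNPP => n3; apply: n2; exists y.
  apply: (@mem_irrefl U h); apply/hh; split=> //; exists g; split.
    by move=> y hy; case: (hn y (ordinal_in oh hy)).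
  by apply: ginj => // c hc; apply: hn; apply: ordinal_in hc.
have [c [oc [hc hmin]]] := ordinal_least (P := fun b => x ⊆ image g b) ob hb.
have hc2 y : y ∈ c -> g y ∈ x /\ g y ∉ image g y.
  move=> hy; apply: gE; apply: NNPP => n2; apply: (hmin y hy) => w hw.
  by apply: NNPP => n3; apply: n2; exists w.
exists c; split=> //; exists g; split; first by move=> y /hc2[].
split; first exact: ginj.
by move=> y /hc/in_image[w [hw ->]]; exists w.
Qed.

Lemma injects_dichotomy k x : ordinal k ->
  injects k x \/ exists c, c ∈ k /\ equinumerous c x.
Proof.
move=> ok; have [c [oc hc]] := well_ordering x.
case: (classic (c ∈ k)) => h; first by right; exists c.
left; apply: (injects_trans (b := c)); last exact: equinumerous_injects.
exact/injects_sub/ordinal_notin.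
Qed.

Lemma in_cardinal k b c :
  cardinal k -> b ∈ k -> ordinal c -> injects c b -> c ∈ k.
Proof.
move=> [ok hk] hb oc hcb; apply: NNPP => n.
apply: (hk b hb); apply: cantor_bernstein; first exact/injects_sub/ordinal_sub.
apply: injects_trans hcb; exact/injects_sub/ordinal_notin.
Qed.

(** ** Regular cardinals *)

Lemma regular_ord k : regular k -> ordinal k.
Proof. by case=> -[]. Qed.

Lemma regular_bound k b f : regular k -> b ∈ k ->
  (forall i, i ∈ b -> f i ∈ k) -> exists d, d ∈ k /\ forall i, i ∈ b -> f i ∈ d.
Proof. by move=> [_ [_ h]]; apply: h. Qed.

Lemma num_regular k n : regular k -> num n ∈ k.
Proof. by move=> [_ [h _]]; apply/h/num_omega. Qed.

Lemma regular_succ k x : regular k -> x ∈ k -> succ x ∈ k.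
Proof.
move=> rk hx; have [d [hd h]] := regular_bound (f := fun _ => x) rk (num_regular 1 rk) (fun _ _ => hx).
have hxd : x ∈ d by apply: (h (num 0)); apply/in_succ; right.
have ok := regular_ord rk; have od := ordinal_in ok hd.
apply: (ordinal_sub_in (y := d)) => //; first exact/ordinal_succ/(ordinal_in ok).
by move=> y /in_succ[|->//]; apply: ordinal_trans od hxd.
Qed.

Definition small (k x : U) : Prop := exists b, b ∈ k /\ injects x b.

Lemma small_equinumerous k x : regular k -> small k x ->
  exists b, b ∈ k /\ equinumerous b x.
Proof.
move=> [ck _] [b [hb ib]]; have [c [oc ec]] := well_ordering x.
exists c; split=> //; apply: (in_cardinal ck hb oc).
exact: injects_trans (equinumerous_injects ec) ib.
Qed.

Lemma small_injects k x y : injects x y -> small k y -> small k x.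
Proof. by move=> h [b [hb ib]]; exists b; split=> //; apply: injects_trans ib. Qed.

Lemma small_sub k x y : x ⊆ y -> small k y -> small k x.
Proof. by move=> /injects_sub; apply: small_injects. Qed.

Lemma small_image k x f : small k x -> small k (image f x).
Proof.
apply: small_injects; apply: injects_of_cover; exists f => y /in_image[w [hw ->]].
by exists w.
Qed.

Lemma small_in k x : x ∈ k -> small k x.
Proof. by move=> h; exists x; split=> //; apply: injects_sub. Qed.

(** Regularity, with any small index set in place of an ordinal below [k]. *)
Lemma small_bound k a f : regular k -> small k a ->
  (forall i, i ∈ a -> f i ∈ k) -> exists d, d ∈ k /\ forall i, i ∈ a -> f i ∈ d.
Proof.
move=> rk [b [hb ib]] hf.
case: (classic (exists i, i ∈ a)) => [[i0 hi0]|n]; last first.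
  exists (num 0); split; first exact: num_regular.
  by move=> i hi; case: n; exists i.
have [g [hg gs]] := cover_of_injects hi0 ib.
have [d [hd h]] := regular_bound rk hb (f := fun i => f (g i)) (fun i _ => hf _ (hg i)).
by exists d; split=> // i /gs[x [hx <-]]; apply: h.
Qed.

(** Otherwise the union would contain a copy of [k], whose intersection with each
    member of the family is bounded, hence which would be bounded by regularity;
    this avoids any computation of products of cardinals. *)
Lemma small_bigcup_seq k a f : regular k -> small k a ->
  (forall i, i ∈ a -> small k (f i)) -> small k (bigcup_seq a f).
Proof.
move=> rk sa sf.
case: (injects_dichotomy (bigcup_seq a f) (regular_ord rk)); last first.
  move=> [c [hc ec]]; exists c; split=> //.
  exact/equinumerous_injects/equinumerous_sym.
move=> [h [hh hi]]; exfalso.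
have /choose_fun[e he] : forall i, i ∈ a ->
    exists e, e ∈ k /\ forall x, x ∈ k -> h x ∈ f i -> x ∈ e.
  move=> i hia; pose p := sep (fun x => h x ∈ f i) k.
  have sp : small k p.
    apply: small_injects (sf i hia); exists h; split; first by move=> x /in_sep[].
    by move=> x y /in_sep[hx _] /in_sep[hy _]; apply: hi.
  have [|e [he1 he2]] := small_bound rk sp (f := fun x => x).
    by move=> x /in_sep[].
  by exists e; split=> // x hx hfx; apply: he2; apply/in_sep.
have [d [hd hde]] := small_bound rk sa (f := e) (fun i hi => proj1 (he i hi)).
apply: (@mem_irrefl U d).
have /in_bigcup_seq[i [hia hhi]] := hh d hd.
have [h1 h2] := he i hia.
apply: (ordinal_trans (x := d) (y := e i)); [exact: ordinal_in (regular_ord rk) hd|exact: hde|exact: h2].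
Qed.

Lemma small_upair k a b : regular k -> small k (upair a b).
Proof.
move=> rk; apply: (small_sub (y := image (fun i => match excluded_middle_informative (i = empty) with left _ => a | right _ => b end) (num 2))).
  move=> x /upairP[->|->]; apply/in_image.
    exists (num 0); split; first by apply: num_lt; lia.
    by case: excluded_middle_informative.
  exists (num 1); split; first by apply: num_lt; lia.
  case: excluded_middle_informative => // e.
  by have := num_inj (e : num 1 = num 0).
by apply/small_image/small_in/num_regular.
Qed.

Lemma small_union k a b : regular k -> small k a -> small k b -> small k (union a b).
Proof.
move=> rk sa sb; apply: (small_sub (y := bigcup_seq (upair a b) (fun x => x))).
  move=> x /in_union h; apply/in_bigcup_seq.
  by case: h => h; [exists a|exists b]; split=> //; apply/upairP; intuition.
apply: small_bigcup_seq => //; first exact: small_upair.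
by move=> i /upairP[]->.
Qed.

(** An environment is a function on [nat]; this lemma finds all its values at one
    stage of a chain of length [k]. *)
Lemma nat_bound k (s : nat -> U) : regular k -> omega ∈ k ->
  (forall n, s n ∈ k) -> exists d, d ∈ k /\ forall n, s n ∈ d.
Proof.
move=> rk hk hs; have [||d [hd h]] := small_bound (k := k) (a := seqset s) (f := fun x => x) rk.
- apply: (small_sub (y := image (fun x => epsilon (inhabits empty) (fun y => exists n, x = num n /\ y = s n)) omega)).
    move=> x /in_seqset[n ->]; apply/in_image; exists (num n); split; first exact: num_omega.
    have hn : exists y, exists m, num n = num m :> U /\ y = s m by exists (s n), n.
    by have [m [/num_inj <- e]] := epsilon_spec (inhabits empty) _ hn.
  exact/small_image/small_in.
- by move=> i /in_seqset[n ->].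
- by exists d; split=> // n; apply: h; apply/in_seqset; exists n.
Qed.

Lemma unbounded_equinumerous k y : regular k -> y ⊆ k ->
  (forall b, b ∈ k -> exists c, c ∈ y /\ b ∈ c) -> equinumerous y k.
Proof.
move=> rk hy hub; apply: cantor_bernstein; first exact: injects_sub.
case: (injects_dichotomy y (regular_ord rk)) => // -[c [hc ec]].
have sy : small k y.
  by exists c; split=> //; apply/equinumerous_injects/equinumerous_sym.
have [d [hd h]] := small_bound rk sy (f := fun x => x) hy.
have [e [he hde]] := hub d hd.
by case: (mem_asym hde); apply: h.
Qed.

(** The Hartogs number of a set [Z] closed under pairs is regular: if [Z] contains
    copies of an index set and of each member of a family, then pairs of elements
    of [Z] label the elements of the union of the family. *)
Lemma regular_exists d : ordinal d -> exists k, regular k /\ d ∈ k.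
Proof.
move=> od.
pose Zn n := Nat.iter n (fun z => union z (power z)) (union d omega).
pose Z := bigcup (seqset Zn).
have inZ x : x ∈ Z <-> exists n, x ∈ Zn n.
  rewrite /Z bigcupP; split; first by move=> [y [/in_seqset[n ->] h]]; exists n.
  by move=> [n h]; exists (Zn n); split=> //; apply/in_seqset; exists n.
have Zmono n m x : n <= m -> x ∈ Zn n -> x ∈ Zn m.
  by elim=> // m' _ IH /IH h; apply/in_union; left.
have Zpair x y : x ∈ Z -> y ∈ Z -> upair x y ∈ Z.
  move=> /inZ[n hn] /inZ[m hm]; apply/inZ; exists (S (n + m)); apply/in_union; right.
  by apply/powerP => w /upairP[->|->]; [apply: Zmono hn|apply: Zmono hm]; lia.
have Zopair x y : x ∈ Z -> y ∈ Z -> opair x y ∈ Z.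
  by move=> hx hy; apply: (Zpair); apply: Zpair.
have Z0 x : x ∈ union d omega -> x ∈ Z by move=> h; apply/inZ; exists 0.
have Znum n : num n ∈ Z by apply/Z0/in_union; right; apply: num_omega.
have [h [oh hh]] := hartogs Z; exists h.
have dh : d ∈ h.
  by apply/hh; split=> //; apply: injects_sub => x hx; apply/Z0/in_union; left.
split=> //; split; last split.
- split=> // y hy /equinumerous_sym/equinumerous_injects e.
  apply: (@mem_irrefl U h); apply/hh; split=> //.
  by apply: injects_trans e _; have [] := proj1 (hh y) hy.
- have oo : ordinal (@omega U).
    have on x : x ∈ omega -> ordinal x.
      move=> /omegaP[n ->]; elim: n => [|n IH]; last exact: ordinal_succ.
      by split=> y /emptyP.
    split; last by move=> y /on[].
    move=> y /omegaP[n ->]; elim: n => [|n IH] z; first by move=> /emptyP.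
    by move=> /in_succ[/IH//|->]; apply: num_omega.
  apply: ordinal_sub => //; apply/hh; split=> //.
  by apply: injects_sub => x hx; apply/Z0/in_union; right.
- move=> b f hb hf.
exists (bigcup_seq b (fun i => succ (f i))); split; last first.
  by move=> i hi; apply/in_bigcup_seq; exists i; split=> //; apply/in_succ; right.
apply/hh; split.
  by apply: ordinal_bigcup_seq => i hi; apply/ordinal_succ/(ordinal_in oh)/hf.
have [_ [g [hg gi]]] := proj1 (hh b) hb.
have /choose_fun[e he] : forall i, i ∈ b -> exists e : U, exists e' : U -> U,
    e = lam (f i) e' /\ (forall x, x ∈ f i -> e' x ∈ Z) /\
    forall x y, x ∈ f i -> y ∈ f i -> e' x = e' y -> x = y.
  by move=> i hi; have [_ [e' he']] := proj1 (hh _) (hf i hi); exists (lam (f i) e'), e'.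
have e1 i x : i ∈ b -> x ∈ f i -> ap (e i) x ∈ Z.
  by move=> hi hx; have [e' [-> [h1 _]]] := he i hi; rewrite ap_lam //; apply: h1.
have e2 i x y : i ∈ b -> x ∈ f i -> y ∈ f i -> ap (e i) x = ap (e i) y -> x = y.
  by move=> hi hx hy; have [e' [-> [_ h2]]] := he i hi; rewrite !ap_lam //; apply: h2.
have /choose_fun[w hw] : forall x, x ∈ bigcup_seq b (fun i => succ (f i)) ->
    exists i, i ∈ b /\ x ∈ succ (f i).
  by move=> x /in_bigcup_seq.
(* [x = f i] is sent to a pair with first entry 0, [x ∈ f i] to one with 1. *)
have /choose_fun[p hp] : forall x, x ∈ bigcup_seq b (fun i => succ (f i)) ->
    exists p, p ∈ Z /\ ((x = f (w x) /\ p = opair (g (w x)) (opair (num 0) (num 0))) \/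
      (x ∈ f (w x) /\ p = opair (g (w x)) (opair (num 1) (ap (e (w x)) x)))).
  move=> x /hw[hwb /in_succ[hx|hx]].
    exists (opair (g (w x)) (opair (num 1) (ap (e (w x)) x))); split; last by right.
    by apply: (Zopair); [apply: hg|apply: Zopair => //; apply: e1].
  exists (opair (g (w x)) (opair (num 0) (num 0))); split; last by left.
  by apply: (Zopair); [apply: hg|apply: Zopair].
exists p; split; first by move=> x /hp[].
move=> x y hx hy; have [hwx _] := hw x hx; have [hwy _] := hw y hy.
have n01 : num 0 <> num 1 :> U by move/num_inj.
have [_ [[h1 ->]|[h1 ->]]] := hp x hx; have [_ [[h2 ->]|[h2 ->]]] := hp y hy;
  move=> /opair_inj[/(gi _ _ hwx hwy) ew] /opair_inj[e3 e4]; try congruence.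
rewrite -ew in h2 e4; exact: (e2 (w x)) e4.
Qed.

(** ** Cardinal arithmetic below [k = k^(<k)] *)

Lemma lam_inj a b f g : lam a f = lam b g ->
  a = b /\ forall x, x ∈ a -> f x = g x.
Proof.
move=> e.
have h a' b' (f' g' : U -> U) x : lam a' f' = lam b' g' -> x ∈ a' -> x ∈ b' /\ f' x = g' x.
  move=> e' hx; have : opair x (f' x) ∈ lam b' g' by rewrite -e'; apply/opair_in_lam.
  by move=> /opair_in_lam.
split; last by move=> x /(h _ _ _ _ _ e)[].
apply: sub_antisym => x hx; first by case: (h _ _ _ _ _ e hx).
by case: (h _ _ _ _ _ (eq_sym e) hx).
Qed.

Lemma injects_ltfuns x y d : injects x y -> injects (ltfuns x d) (ltfuns y d).
Proof.
move=> [g [hg gi]].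
have /choose_fun[p hp] : forall s, s ∈ ltfuns x d -> exists p, exists b f,
    b ∈ d /\ (forall i, i ∈ b -> f i ∈ x) /\ s = lam b f /\ p = lam b (fun i => g (f i)).
  by move=> s /in_ltfuns[b [f [hb [hf ->]]]]; exists (lam b (fun i => g (f i))), b, f.
exists p; split.
  move=> s /hp[b [f [hb [hf [_ ->]]]]]; apply/in_ltfuns; exists b, (fun i => g (f i)).
  by split=> //; split=> // i hi; apply/hg/hf.
move=> s t /hp[b [f [hb [hf [-> ->]]]]] /hp[b' [f' [hb' [hf' [-> ->]]]]] /lam_inj[e he].
subst b'; apply: lam_ext => i hi; apply: gi; [exact: hf|exact: hf'|exact: he].
Qed.

Section WeakPower.
Variable k : U.
Hypotheses (rk : regular k) (ek : eq_weak_power k).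

Lemma le_ltfuns x : injects x k -> injects (ltfuns x k) k.
Proof.
move=> h; apply: injects_trans (injects_ltfuns k h) _.
exact: equinumerous_injects.
Qed.

(** Pairs of elements of [k] are functions from 2, so that there are only [k] of
    them; hence unions of [k] sets of size at most [k] have size at most [k]. *)
Lemma le_bigcup_seq a f : injects a k -> (forall i, i ∈ a -> injects (f i) k) ->
  injects (bigcup_seq a f) k.
Proof.
move=> [g [hg gi]] hf.
have /choose_fun[e he] : forall i, i ∈ a -> exists e : U, exists e' : U -> U,
    e = lam (f i) e' /\ (forall x, x ∈ f i -> e' x ∈ k) /\
    forall x y, x ∈ f i -> y ∈ f i -> e' x = e' y -> x = y.
  by move=> i /hf[e' he']; exists (lam (f i) e'), e'.
have /choose_fun[w hw] : forall x, x ∈ bigcup_seq a f -> exists i, i ∈ a /\ x ∈ f i.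
  by move=> x /in_bigcup_seq.
apply: (injects_trans (b := ltfuns k k)); last exact: equinumerous_injects.
pose p x := lam (num 2) (fun i => match excluded_middle_informative (i = num 0) with
  left _ => g (w x) | right _ => ap (e (w x)) x end).
exists p; split.
  move=> x /hw[hwa hx]; apply/in_ltfuns; exists (num 2), (fun i => match excluded_middle_informative (i = num 0) with
  left _ => g (w x) | right _ => ap (e (w x)) x end); split; first exact: num_regular.
  split=> // i _; case: excluded_middle_informative => _; first exact: hg.
  by have [e' [-> [h1 _]]] := he _ hwa; rewrite ap_lam //; apply: h1.
move=> x y hx hy /lam_inj[_ h]; have [hwx hfx] := hw x hx; have [hwy hfy] := hw y hy.
have := h (num 0) (num_lt _); case: excluded_middle_informative => // _ /(_ ltac:(lia)).
move/(gi _ _ hwx hwy) => ew.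
have := h (num 1) (num_lt _); case: excluded_middle_informative => [/num_inj//|_] /(_ ltac:(lia)).
rewrite -ew in hfy *.
by have [e' [-> [_ h2]]] := he _ hwx; rewrite !ap_lam //; apply: h2.
Qed.

Lemma le_image a f : injects a k -> injects (image f a) k.
Proof.
apply: injects_trans; apply: injects_of_cover; exists f => y /in_image[w [hw ->]].
by exists w.
Qed.

Lemma le_upair a b : injects (upair a b) k.
Proof.
have [c [hc ic]] := small_upair a b rk.
by apply: injects_trans ic _; apply/injects_sub/(ordinal_sub (regular_ord rk)).
Qed.

Lemma le_union a b : injects a k -> injects b k -> injects (union a b) k.
Proof.
move=> ha hb; apply: (injects_trans (b := bigcup_seq (upair a b) (fun x => x))).
  apply: injects_sub => x /in_union h; apply/in_bigcup_seq.
  by case: h => h; [exists a|exists b]; split=> //; apply/upairP; intuition.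
apply: le_bigcup_seq; first exact: le_upair.
by move=> i /upairP[]->.
Qed.

End WeakPower.

(** * The classes [H(theta)] *)

Section Hereditary.
Variable theta : U.
Hypothesis rt : regular theta.

(** The recursive description of [H(theta)], from which its closure properties
    are read off. *)
Lemma H_iff x : H theta x <-> small theta x /\ forall y, y ∈ x -> H theta y.
Proof.
split.
  move=> [t [[tt [xt tmin]] [b [hb eb]]]].
  have st : small theta t.
    by exists b; split=> //; apply/equinumerous_injects/equinumerous_sym.
  split; first exact: small_sub st.
  move=> y hy; have hyt : y ⊆ t by apply/tt/xt.
  have [h1 [h2 h3]] := trclP y; exists (trcl y); split=> //.
  by apply: small_equinumerous => //; apply: small_sub st; apply: h3.
move=> [sx hx]; have [h1 [h2 h3]] := trclP x; exists (trcl x); split=> //.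
apply: small_equinumerous => //.
apply: (small_sub (y := bigcup_seq x (fun y => union (trcl y) (upair y y)))).
  apply: h3.
    move=> z /in_bigcup_seq[y [hy /in_union[hz|/upairP hz]]] w hw;
      apply/in_bigcup_seq; exists y; split=> //; apply/in_union; left.
      by have [ht _] := trclP y; apply: (ht z).
    have {}hz : z = y by case: hz.
    by subst z; have [_ [hs _]] := trclP y; apply: hs.
  move=> y hy; apply/in_bigcup_seq; exists y; split=> //.
  by apply/in_union; right; apply/upairP; left.
apply: small_bigcup_seq => // y hy; apply: small_union => //; last exact: small_upair.
have [t [[tt [yt _]] [b [hb eb]]]] := hx y hy.
apply: (small_sub (y := t)); first by have [_ [_ h]] := trclP y; apply: h.
by exists b; split=> //; apply/equinumerous_injects/equinumerous_sym.
Qed.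

Lemma H_small x : H theta x -> small theta x. Proof. by move/H_iff => []. Qed.

Lemma H_trans x y : H theta x -> y ∈ x -> H theta y.
Proof. by move/H_iff => [_ h]; apply: h. Qed.

Lemma H_sub x y : H theta x -> y ⊆ x -> H theta y.
Proof.
move=> hx hy; apply/H_iff; split; first exact: small_sub hy (H_small hx).
by move=> z /hy; apply: H_trans.
Qed.

Lemma H_upair x y : H theta x -> H theta y -> H theta (upair x y).
Proof.
move=> hx hy; apply/H_iff; split; first exact: small_upair.
by move=> z /upairP[]->.
Qed.

Lemma H_image x f : H theta x -> (forall y, y ∈ x -> H theta (f y)) ->
  H theta (image f x).
Proof.
move=> hx hf; apply/H_iff; split; first exact/small_image/H_small.
by move=> z /in_image[y [hy ->]]; apply: hf.
Qed.

Lemma H_bigcup x : H theta x -> H theta (bigcup x).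
Proof.
move=> hx; apply/H_iff; split.
  apply: (small_sub (y := bigcup_seq x (fun y => y))).
    by move=> z /bigcupP[y [hy hz]]; apply/in_bigcup_seq; exists y.
  apply: small_bigcup_seq => //; first exact: H_small.
  by move=> y hy; apply/H_small/H_trans/hy.
by move=> z /bigcupP[y [hy hz]]; apply: (H_trans (x := y)) => //; apply: H_trans hy.
Qed.

Lemma H_opair x y : H theta x -> H theta y -> H theta (opair x y).
Proof. by move=> hx hy; apply: H_upair; apply: H_upair. Qed.

Lemma H_lam x f : H theta x -> (forall y, y ∈ x -> H theta (f y)) ->
  H theta (lam x f).
Proof. by move=> hx hf; apply: H_image => // y hy; apply: H_opair; [apply: H_trans hy|apply: hf]. Qed.

Lemma H_ordinal x : x ∈ theta -> H theta x.
Proof.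
move: x; apply: mem_ind => x IH hx; apply/H_iff; split; first exact: small_in.
by move=> y hy; apply: IH => //; apply: ordinal_trans (regular_ord rt) hx hy.
Qed.

End Hereditary.

Lemma H_mono t t' x : regular t -> regular t' -> t ∈ t' -> H t x -> H t' x.
Proof.
move=> _ rt' htt [w [hw [b [hb eb]]]]; exists w; split=> //; exists b; split=> //.
exact: ordinal_trans (regular_ord rt') htt hb.
Qed.

Lemma H_exists x : exists d, ordinal d /\ forall t, d ∈ t -> H t x.
Proof.
have [c [oc ec]] := well_ordering (trcl x); exists c; split=> // t ht.
by exists (trcl x); split; [apply: trclP|exists c].
Qed.

End Cardinality.

(** * Definability over [H(theta)] *)

Fixpoint rename (r : nat -> nat) (p : formula) : formula :=
  match p with
  | fEq i j => fEq (r i) (r j)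
  | fMem i j => fMem (r i) (r j)
  | fNot p => fNot (rename r p)
  | fAnd p q => fAnd (rename r p) (rename r q)
  | fAll p => fAll (rename (fun n => match n with 0 => 0 | S n => S (r n) end) p)
  end.

Lemma sat_rename (U : ZFC_universe) (D : U -> Prop) p r e :
  sat D (rename r p) e <-> sat D p (fun n => e (r n)).
Proof.
elim: p r e => [i j|i j|p IH|p IHp q IHq|p IH] r e //=.
- by rewrite IH.
- by rewrite IHp IHq.
- have E x : (fun n => scons x e match n with 0 => 0 | S n => S (r n) end) =
    scons x (fun n => e (r n)) by apply: functional_extensionality => -[].
by split=> h x /h; rewrite IH E.
Qed.

Section Definability.
Context {U : ZFC_universe}.
Variable theta : U.
Hypothesis rt : regular theta.

Let env (e : nat -> U) : Prop := forall n, H theta (e n).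

Lemma env_scons x e : H theta x -> env e -> env (scons x e).
Proof. by move=> hx he [|n] /=. Qed.

Lemma env_tail e : env e -> env (fun n => e (S n)).
Proof. by move=> he n; apply: he. Qed.

(** Being the extension of a formula in [H(theta)].  The lemmas below read a
    formula off the shape of a predicate; a quantifier binds index 0, so its body
    is applied to [e 0] and to the shifted environment. *)
Definition definable (P : (nat -> U) -> Prop) : Prop :=
  exists p, forall e, env e -> (sat (H theta) p e <-> P e).

Lemma def_ext P Q : (forall e, env e -> (P e <-> Q e)) -> definable P -> definable Q.
Proof. by move=> h [p hp]; exists p => e he; rewrite -h //; apply: hp. Qed.

Lemma def_var_eq i j : definable (fun e => e i = e j).
Proof. by exists (fEq i j). Qed.

Lemma def_var_mem i j : definable (fun e => e i ∈ e j).
Proof. by exists (fMem i j). Qed.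

Lemma def_not P : definable P -> definable (fun e => ~ P e).
Proof. by move=> [p hp]; exists (fNot p) => e he /=; rewrite hp. Qed.

Lemma def_and P Q : definable P -> definable Q -> definable (fun e => P e /\ Q e).
Proof. by move=> [p hp] [q hq]; exists (fAnd p q) => e he /=; rewrite hp // hq. Qed.

Lemma def_or P Q : definable P -> definable Q -> definable (fun e => P e \/ Q e).
Proof.
move=> hp hq; apply: def_ext (def_not (def_and (def_not hp) (def_not hq))) => e _.
by case: (classic (P e)); case: (classic (Q e)); tauto.
Qed.

Lemma def_imp P Q : definable P -> definable Q -> definable (fun e => P e -> Q e).
Proof.
move=> hp hq; apply: def_ext (def_or (def_not hp) hq) => e _.
by case: (classic (P e)); tauto.
Qed.

Lemma def_iff P Q : definable P -> definable Q -> definable (fun e => P e <-> Q e).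
Proof. by move=> hp hq; apply: def_and; apply: def_imp. Qed.

Lemma def_allH (B : U -> (nat -> U) -> Prop) :
  definable (fun e => B (e 0) (fun n => e (S n))) ->
  definable (fun e => forall x, H theta x -> B x e).
Proof.
move=> [p hp]; exists (fAll p) => e he /=; split=> h x hx.
  exact/(hp (scons x e) (env_scons hx he))/h.
by apply/hp; [apply: env_scons|apply: h].
Qed.

Lemma def_exH (B : U -> (nat -> U) -> Prop) :
  definable (fun e => B (e 0) (fun n => e (S n))) ->
  definable (fun e => exists x, H theta x /\ B x e).
Proof.
move=> /def_not/(def_allH (B := fun x e => ~ B x e))/def_not.
apply: def_ext => e _; split; last by move=> [x [hx hB]] h; apply: h hB.
move=> h; apply: NNPP => n; apply: h => x hx hB; apply: n; by exists x.
Qed.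

Lemma def_rename r P : definable P -> definable (fun e => P (fun n => e (r n))).
Proof.
move=> [p hp]; exists (rename r p) => e he; rewrite sat_rename; apply: hp => n.
exact: he.
Qed.

(** The values must lie in [H(theta)] for a term to be eliminable by a quantifier
    over [H(theta)]. *)
Definition dterm (t : (nat -> U) -> U) : Prop :=
  (forall e, env e -> H theta (t e)) /\
  definable (fun e => e 0 = t (fun n => e (S n))).

Lemma dterm_var i : dterm (fun e => e i).
Proof. by split; [move=> e; apply|apply: def_var_eq]. Qed.

Lemma def_subst (P : U -> (nat -> U) -> Prop) t : dterm t ->
  definable (fun e => P (e 0) (fun n => e (S n))) -> definable (fun e => P (t e) e).
Proof.
move=> [ht dt] hP; apply: def_ext (def_exH (B := fun x e => x = t e /\ P x e) (def_and dt hP)).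
move=> e he; split; first by move=> [x [_ [->]]].
by move=> h; exists (t e); split=> //; apply: ht.
Qed.

Lemma dterm_weak t : dterm t -> dterm (fun e => t (fun n => e (S n))).
Proof.
move=> [ht dt]; split; first by move=> e he; apply/ht/env_tail.
exact: (def_rename (fun n => match n with 0 => 0 | S n => S (S n) end) dt).
Qed.

Lemma def_eq s t : dterm s -> dterm t -> definable (fun e => s e = t e).
Proof.
move=> hs ht; apply: (def_subst (P := fun x e => x = t e) hs).
by case: ht.
Qed.

Lemma def_mem s t : dterm s -> dterm t -> definable (fun e => s e ∈ t e).
Proof.
move=> hs ht; apply: (def_subst (P := fun x e => x ∈ t e) hs).
apply: (def_subst (P := fun x e => e 0 ∈ x) (dterm_weak ht)); exact: def_var_mem.
Qed.

Lemma def_ball t (B : U -> (nat -> U) -> Prop) : dterm t ->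
  definable (fun e => B (e 0) (fun n => e (S n))) ->
  definable (fun e => forall x, x ∈ t e -> B x e).
Proof.
move=> ht hB.
have h := def_imp (def_mem (dterm_var 0) (dterm_weak ht)) hB.
apply: def_ext (def_allH (B := fun x e => x ∈ t e -> B x e) h) => e he.
split=> h2 x; last by move=> _; apply: h2.
by move=> hx; apply: h2 => //; apply: H_trans hx => //; case: ht => ht _; apply: ht.
Qed.

Lemma def_bex t (B : U -> (nat -> U) -> Prop) : dterm t ->
  definable (fun e => B (e 0) (fun n => e (S n))) ->
  definable (fun e => exists x, x ∈ t e /\ B x e).
Proof.
move=> ht hB.
have h := def_and (def_mem (dterm_var 0) (dterm_weak ht)) hB.
apply: def_ext (def_exH (B := fun x e => x ∈ t e /\ B x e) h) => e he.
split; first by move=> [x [_ h2]]; exists x.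
move=> [x [hx h2]]; exists x; split=> //; apply: H_trans hx => //.
by case: ht => ht _; apply: ht.
Qed.

Lemma def_sub s t : dterm s -> dterm t -> definable (fun e => s e ⊆ t e).
Proof.
move=> hs ht; apply: (def_ball (B := fun x e => x ∈ t e)) => //.
by apply: def_mem; [apply: dterm_var|apply: dterm_weak].
Qed.

(** By extensionality in the transitive class [H(theta)], it is enough to define
    the elements of a set. *)
Lemma dterm_set t : (forall e, env e -> H theta (t e)) ->
  definable (fun e => e 0 ∈ t (fun n => e (S n))) -> dterm t.
Proof.
move=> ht hd; split=> //.
have hw := def_rename (fun n => match n with 0 => 0 | S n => S (S n) end) hd.
have h := def_allH (B := fun x e => x ∈ e 0 <-> x ∈ t (fun n => e (S n)))
  (def_iff (def_var_mem 0 1) hw).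
apply: def_ext h => e he; split; last by move=> -> .
move=> h; apply: extensionality => x; split=> hx.
  by apply/h => //; apply: H_trans hx => //.
by apply/h => //; apply: H_trans hx => //; apply/ht/env_tail.
Qed.

Lemma dterm_empty : dterm (fun _ => empty).
Proof.
apply: dterm_set; first by move=> e _; apply: (H_ordinal rt (x := num 0)); apply: num_regular.
apply: def_ext (def_not (def_var_eq 0 0)) => e _.
by split=> // /emptyP.
Qed.

Lemma dterm_upair s t : dterm s -> dterm t -> dterm (fun e => upair (s e) (t e)).
Proof.
move=> hs ht; apply: dterm_set.
  by case: hs => hs _; case: ht => ht _ e he; apply: H_upair => //; auto.
have h := def_or (def_eq (dterm_var 0) (dterm_weak hs)) (def_eq (dterm_var 0) (dterm_weak ht)).
by apply: def_ext h => e _; rewrite upairP.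
Qed.

Lemma dterm_bigcup s : dterm s -> dterm (fun e => bigcup (s e)).
Proof.
move=> hs; apply: dterm_set.
  by case: hs => hs _ e he; apply: H_bigcup => //; auto.
have h := def_bex (B := fun y e => e 0 ∈ y) (dterm_weak hs) (def_var_mem 1 0).
by apply: def_ext h => e _; rewrite bigcupP.
Qed.

Lemma dterm_sep s (P : U -> (nat -> U) -> Prop) : dterm s ->
  definable (fun e => P (e 0) (fun n => e (S n))) ->
  dterm (fun e => sep (fun x => P x e) (s e)).
Proof.
move=> hs hP; apply: dterm_set.
  by case: hs => hs _ e he; apply: H_sub (sep_sub (P := _) (a := _)) => //; apply: hs.
have h := def_and (def_mem (dterm_var 0) (dterm_weak hs)) hP.
by apply: def_ext h => e _; rewrite in_sep.
Qed.

Lemma dterm_image s (f : U -> (nat -> U) -> U) : dterm s ->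
  dterm (fun e => f (e 0) (fun n => e (S n))) ->
  dterm (fun e => image (fun x => f x e) (s e)).
Proof.
move=> hs hf; apply: dterm_set.
  case: hs => hs _; case: hf => hf _ e he; apply: H_image => //; first exact: hs.
  move=> y hy; apply: (hf (scons y e)); apply: env_scons => //.
  by apply: H_trans hy => //; apply: hs.
have hf' : dterm (fun e => f (e 0) (fun n => e (S (S n)))).
  case: hf => hf df; split.
    move=> e he; apply: (hf (scons (e 0) (fun n => e (S (S n))))).
    by apply: env_scons => // n.
  exact: (def_rename (fun n => match n with 0 => 0 | 1 => 1 | S (S n) => S (S (S n)) end) df).
have h := def_bex (B := fun x e => e 0 = f x (fun n => e (S n))) (dterm_weak hs)
  (def_eq (dterm_var 1) hf').
by apply: def_ext h => e _; rewrite in_image.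
Qed.

(** The parameters are terms because truth in an ultrapower is expressed by formulas
    about the values of functions at a varying index. *)
Lemma def_sat p (E : (nat -> U) -> nat -> U) : (forall n, dterm (fun e => E e n)) ->
  definable (fun e => sat (H theta) p (E e)).
Proof.
elim: p E => [i j|i j|p IH|p IHp q IHq|p IH] E hE /=.
- exact: def_eq.
- exact: def_mem.
- exact/def_not/IH.
- exact: def_and (IHp E hE) (IHq E hE).
- apply: (def_allH (B := fun x e => sat (H theta) p (scons x (E e)))).
  apply: (IH (fun e => scons (e 0) (E (fun n => e (S n))))) => -[|n] /=.
    exact: dterm_var.
  exact: (dterm_weak (hE n)).
Qed.

Lemma def_comp P (E : (nat -> U) -> nat -> U) : definable P ->
  (forall n, dterm (fun e => E e n)) -> definable (fun e => P (E e)).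
Proof.
move=> [p hp] hE; apply: def_ext (def_sat p hE) => e he; apply: hp => n.
by case: (hE n) => h _; apply: h.
Qed.

End Definability.

(** Bounded quantifiers must be written one at a time, with their bound next to the
    variable, for their shape to be recognized. *)
Ltac definability := cbv beta;
  match goal with
  | h : regular ?k |- regular ?k => exact h
  | h : dterm _ ?t |- dterm _ ?t => exact h
  | |- dterm _ (fun e => e _) => apply dterm_var
  | |- dterm _ (fun _ => empty) => apply dterm_empty; definability
  | |- dterm _ (fun e => upair _ _) => apply dterm_upair; definability
  | |- dterm _ (fun e => bigcup _) => apply dterm_bigcup; definability
  | |- dterm _ (fun e => sep _ _) => apply dterm_sep; definability
  | |- dterm _ (fun e => image _ _) => apply dterm_image; definability
  | |- dterm _ (fun e => ap _ _) => unfold ap; definability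
  | |- dterm _ (fun e => opair _ _) => unfold opair; definability
  | |- dterm _ (fun e => union _ _) => unfold union; definability
  | |- dterm _ (fun e => inter _ _) => unfold inter; definability
  | |- dterm _ (fun e => diff _ _) => unfold diff; definability
  | |- dterm _ (fun e => succ _) => unfold succ; definability
  | |- dterm _ (fun e => lam _ _) => unfold lam; definability
  | |- dterm _ (fun e => diagonal _ _) => unfold diagonal; definability
  | |- dterm _ _ => apply dterm_weak; definability
  | |- definable _ (fun e => _ = _) => apply def_eq; definability
  | |- definable _ (fun e => _ ∈ _) => apply def_mem; definability
  | |- definable _ (fun e => _ ⊆ _) => apply def_sub; definability
  | |- definable _ (fun e => ~ _) => apply def_not; definability
  | |- definable _ (fun e => _ /\ _) => apply def_and; definability
  | |- definable _ (fun e => _ \/ _) => apply def_or; definability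
  | |- definable _ (fun e => _ <-> _) => apply def_iff; definability
  | |- definable _ (fun e => forall x, H _ x -> _) => apply def_allH; definability
  | |- definable _ (fun e => exists x, H _ x /\ _) => apply def_exH; definability
  | |- definable _ (fun e => forall x, x ∈ _ -> _) => apply def_ball; definability
  | |- definable _ (fun e => exists x, x ∈ _ /\ _) => apply def_bex; definability
  | |- definable _ (fun e => _ -> _) => apply def_imp; definability
  end.

(** * Elementary submodels of [H(theta)] *)

Section Submodels.
Context {U : ZFC_universe}.
Variable theta : U.
Hypothesis rt : regular theta.
Implicit Types (a b x y z M : U).

Lemma tarski_vaught M : (forall x, x ∈ M -> H theta x) ->
  (forall p e, in_env M e -> (exists x, H theta x /\ sat (H theta) p (scons x e)) ->
    exists x, x ∈ M /\ sat (H theta) p (scons x e)) ->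
  elementary_sub M (H theta).
Proof.
move=> hM htv; split=> // p; elim: p => [i j|i j|p IH|p IHp q IHq|p IH] e he //=.
- by rewrite IH.
- by rewrite IHp // IHq.
- have hs x : x ∈ M -> in_env M (scons x e) by move=> hx [|n] /=.
  split=> h x hx; last by apply/IH; [apply: hs|apply/h/hM].
  apply: NNPP => n; have [|y [hy hny]] := htv (fNot p) e he; first by exists x.
  by apply: hny => /=; apply/IH; [apply: hs|apply: h].
Qed.

(** The default value belongs to every nonempty elementary submodel. *)
Definition lenv (l : list U) : nat -> U := fun n => nth n l empty.

Fixpoint all_in M (l : list U) : Prop :=
  match l with nil => True | cons x l => x ∈ M /\ all_in M l end.

Section Elementary.
Variable M : U.
Hypotheses (HM : elementary_sub M (H theta)) (inh : exists x, x ∈ M).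

Lemma elem_H x : x ∈ M -> H theta x.
Proof. by case: HM => h _; apply: h. Qed.

Lemma elem_env e : in_env M e -> forall n, H theta (e n).
Proof. by move=> he n; apply: elem_H. Qed.

(** The source of all closure properties of [M]: what exists in [H(theta)] and has a
    definable property with parameters in [M] can be found in [M]. *)
Lemma elem_ex_env P e : definable theta P -> in_env M e ->
  (exists x, H theta x /\ P (scons x e)) -> exists x, x ∈ M /\ P (scons x e).
Proof.
move=> [p hp] he [x [hx hP]]; apply: NNPP => n.
have hs y : H theta y -> forall n, H theta (scons y e n).
  by move=> hy; apply: env_scons => //; apply: elem_env.
case: HM => _ /(_ (fAll (fNot p)) e he) /= [h _].
have hA y : y ∈ M -> ~ sat (elts M) p (scons y e).
  move=> hy hsat; apply: n; exists y; split=> //; apply/hp; first exact: (hs _ (elem_H hy)).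
  by apply: (proj1 (proj2 HM p _ _)) hsat => -[|n] /=.
apply: (h hA x hx); apply/hp => //; exact: hs.
Qed.

Lemma elem_term_env t e : dterm theta t -> in_env M e -> t e ∈ M.
Proof.
move=> [ht dt] he; have [|x [hx /= <-]] := elem_ex_env dt he; last by [].
by exists (t e); split=> //; apply/ht/elem_env.
Qed.

Lemma elem_empty : empty ∈ M.
Proof.
case: inh => x hx; apply: (elem_term_env (t := fun _ => empty) (e := fun _ => x)) => //.
exact: dterm_empty.
Qed.

Lemma lenv_in l : all_in M l -> in_env M (lenv l).
Proof.
elim: l => [|x l IH] /=; first by move=> _ [|n]; apply: elem_empty.
by move=> [hx hl] [|n] //=; apply: IH.
Qed.

Lemma elem_ex P l : definable theta P -> all_in M l ->
  (exists x, H theta x /\ P (scons x (lenv l))) ->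
  exists x, x ∈ M /\ P (scons x (lenv l)).
Proof. by move=> hP /lenv_in; apply: elem_ex_env. Qed.

Lemma elem_term t l : dterm theta t -> all_in M l -> t (lenv l) ∈ M.
Proof. by move=> ht /lenv_in; apply: elem_term_env. Qed.

Lemma elem_all_env P e : definable theta P -> in_env M e ->
  (forall x, x ∈ M -> P (scons x e)) -> forall x, H theta x -> P (scons x e).
Proof.
move=> dP he h x hx; apply: NNPP => n.
have [|y [hy hny]] := elem_ex_env (def_not dP) he; first by exists x.
by apply: hny; apply: h.
Qed.

Lemma elem_ext x y : x ∈ M -> y ∈ M ->
  (forall z, z ∈ M -> (z ∈ x <-> z ∈ y)) -> x = y.
Proof.
move=> hx hy h.
have h2 := elem_all_env (P := fun e => e 0 ∈ e 1 <-> e 0 ∈ e 2) (e := lenv (x :: y :: nil)).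
have {}h2 z : H theta z -> (z ∈ x <-> z ∈ y).
  by apply: h2 => //; [definability|apply: lenv_in].
by apply: extensionality => z; split=> hz; apply/h2 => //; apply: H_trans hz => //; apply: elem_H.
Qed.

Lemma elem_upair x y : x ∈ M -> y ∈ M -> upair x y ∈ M.
Proof.
move=> hx hy; apply: (elem_term (t := fun e => upair (e 0) (e 1)) (l := x :: y :: nil)) => //.
definability.
Qed.

Lemma elem_opair x y : x ∈ M -> y ∈ M -> opair x y ∈ M.
Proof. by move=> hx hy; apply: elem_upair; apply: elem_upair. Qed.

Lemma elem_bigcup x : x ∈ M -> bigcup x ∈ M.
Proof.
move=> hx; apply: (elem_term (t := fun e => bigcup (e 0)) (l := x :: nil)) => //.
definability.
Qed.

Lemma elem_union x y : x ∈ M -> y ∈ M -> union x y ∈ M.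
Proof. by move=> hx hy; apply/elem_bigcup/elem_upair. Qed.

Lemma elem_succ x : x ∈ M -> succ x ∈ M.
Proof. by move=> hx; apply/elem_union/elem_upair. Qed.

Lemma elem_inter x y : x ∈ M -> y ∈ M -> inter x y ∈ M.
Proof.
move=> hx hy; apply: (elem_term (t := fun e => inter (e 0) (e 1)) (l := x :: y :: nil)) => //.
definability.
Qed.

Lemma elem_diff x y : x ∈ M -> y ∈ M -> diff x y ∈ M.
Proof.
move=> hx hy; apply: (elem_term (t := fun e => diff (e 0) (e 1)) (l := x :: y :: nil)) => //.
definability.
Qed.

Lemma elem_ap x y : x ∈ M -> y ∈ M -> ap x y ∈ M.
Proof.
move=> hx hy; apply: (elem_term (t := fun e => ap (e 0) (e 1)) (l := x :: y :: nil)) => //.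
definability.
Qed.

Lemma elem_diagonal k x : k ∈ M -> x ∈ M -> diagonal k (ap x) ∈ M.
Proof.
move=> hk hx; apply: (elem_term (t := fun e => diagonal (e 0) (ap (e 1))) (l := k :: x :: nil)) => //.
definability.
Qed.

(** ** The axioms of ZFC without power set *)

Lemma opair_inP p x y : p ∈ M -> x ∈ M -> y ∈ M ->
  opair_in M p x y <-> p = opair x y.
Proof.
move=> hp hx hy.
have h1 z u v : z ∈ M -> u ∈ M -> v ∈ M ->
    (forall w, w ∈ M -> (w ∈ z <-> w = u \/ w = v)) <-> z = upair u v.
  move=> hz hu hv; split; last by move=> -> w _; apply: upairP.
  move=> h; apply: elem_ext => //; first exact: elem_upair.
  by move=> w hw; rewrite h // upairP.
have h2 z u : z ∈ M -> u ∈ M ->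
    (forall w, w ∈ M -> (w ∈ z <-> w = u)) <-> z = upair u u.
  move=> hz hu; rewrite -h1 //; split=> h w hw; rewrite h //; tauto.
split=> [h|-> z hz]; last by rewrite h1 // h2 // /opair upairP.
apply: elem_ext => //; first exact: elem_opair.
by move=> z hz; rewrite h // h1 // h2 // /opair upairP.
Qed.

(** A true well-order of [a] exists in [H(theta)]; one in [M] still has least
    elements for the subsets of [a] in [M], as these are definable from the order. *)
Lemma elem_wellorder a : a ∈ M -> exists r, r ∈ M /\ wellorders_in M r a.
Proof.
move=> ha.
pose P (r a : U) := (forall x, x ∈ a -> opair x x ∉ r) /\
  (forall x, x ∈ a -> forall y, y ∈ a -> forall z, z ∈ a ->
    opair x y ∈ r -> opair y z ∈ r -> opair x z ∈ r) /\
  (forall x, x ∈ a -> forall y, y ∈ a -> opair x y ∈ r \/ x = y \/ opair y x ∈ r) /\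
  (forall b, H theta b -> b ⊆ a -> (exists x, x ∈ b /\ x = x) ->
    exists m, m ∈ b /\ forall x, x ∈ b -> x = m \/ opair m x ∈ r).
have [|||r [hr hP]] := elem_ex (P := fun e => P (e 0) (e 1)) (l := a :: nil); rewrite /P.
- definability.
- by [].
- have [c [oc /equinumerous_sym[g [hg [gi gs]]]]] := well_ordering a.
  pose r := sep (fun p => exists x y, p = opair x y /\ g x ∈ g y) (prod a a).
  have rE x y : x ∈ a -> y ∈ a -> opair x y ∈ r <-> g x ∈ g y.
    move=> hx hy; rewrite in_sep in_prod; split.
      by move=> [_ [u [v [/opair_inj[-> ->]]]]].
    by move=> h; split; [exists x, y|exists x, y].
  exists r; split.
    have Ha := elem_H ha.
    apply: (H_sub rt (x := prod a a)); last exact: sep_sub.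
    apply: H_bigcup => //; apply: H_image => // x hx; apply: H_image => // y hy.
    by apply: (H_opair rt); apply: (H_trans rt Ha).
  rewrite /P /=; split; first by move=> x hx; rewrite rE // => /mem_irrefl.
  split.
    move=> x hx y hy z hz; rewrite !rE // => h1 h2.
    exact: (ordinal_trans (ordinal_in oc (hg _ hz)) h2).
  split.
    move=> x hx y hy; rewrite !rE //.
    have [h|[h|h]] := ordinal_total (ordinal_in oc (hg x hx)) (ordinal_in oc (hg y hy));
      [by left|by right; left; apply: gi|by right; right].
  move=> b _ hb [x [hx _]].
  have [||i [oi [[m [hm e]] hmin]]] := @ordinal_least U (fun i => exists m, m ∈ b /\ g m = i) (g x).
  + exact: ordinal_in oc (hg _ (hb _ hx)).
  + by exists x.
  + exists m; split=> // y hy; rewrite rE; [exact: hb|exact: hb|].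
  have om := ordinal_in oc (hg _ (hb _ hm)); have oy := ordinal_in oc (hg _ (hb _ hy)).
  have [h|[h|h]] := ordinal_total om oy; first by right.
    by left; apply: gi => //; apply: hb.
  by case: (hmin (g y)); [rewrite -e|exists y].
- move: hP => /= [h1 [h2 [h3 h4]]].
exists r; split=> //.
have RE x y : x ∈ M -> y ∈ M ->
    (exists p, p ∈ M /\ p ∈ r /\ opair_in M p x y) <-> opair x y ∈ r.
  move=> hx hy; split; first by move=> [p [hp [hpr /(opair_inP hp hx hy) <-]]].
  move=> h; exists (opair x y); split; first exact: elem_opair.
  by split=> //; apply/opair_inP => //; apply: elem_opair.
rewrite /wellorders_in; split; first by move=> x [hx hxa]; rewrite RE //; apply: h1.
split; first by move=> x y z [hx hxa] [hy hya] [hz hza]; rewrite !RE //; apply: h2.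
split; first by move=> x y [hx hxa] [hy hya]; rewrite !RE //; apply: h3.
move=> b hb hba [x [hx hxb]].
have hba' : b ⊆ a.
  move=> y hy.
  have := elem_all_env (P := fun e => e 0 ∈ e 1 -> e 0 ∈ e 2) (e := lenv (b :: a :: nil)).
  apply=> //; [definability|exact: lenv_in|].
  by apply: H_trans hy => //; apply: elem_H.
have [|||m [hm [/= hmb hmin]]] := elem_ex (P := fun e => e 0 ∈ e 1 /\
   forall x, x ∈ e 1 -> x = e 0 \/ opair (e 0) x ∈ e 2) (l := b :: r :: nil).
+ definability.
+ by [].
+ have [|||m [hm hmin]] := h4 b => //; [exact: elem_H|by exists x|].
  by exists m; split=> //; apply: H_trans hm => //; apply: elem_H.
+ exists m; split=> //; split=> // y hy hyb; rewrite RE //; exact: hmin.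
Qed.

Lemma elem_ZFCminus : omega ∈ M -> ZFCminus M.
Proof.
move=> hom; have sE p e x : in_env M e -> x ∈ M ->
    sat (elts M) p (scons x e) <-> sat (H theta) p (scons x e).
  by move=> he hx; apply: (proj2 HM) => -[|n] /=.
have sE2 p e x y : in_env M e -> x ∈ M -> y ∈ M ->
    sat (elts M) p (scons y (scons x e)) <-> sat (H theta) p (scons y (scons x e)).
  by move=> he hx hy; apply: (proj2 HM) => -[|[|n]] /=.
split.
- exact: elem_ext.
- move=> x hx [y [_ hy]]; have [|z [hz hmin]] := @foundation U x; first by exists y.
  have [|||w [hw [hwx hw2]]] := elem_ex (P := fun e => e 0 ∈ e 1 /\ forall z, z ∈ e 1 -> z ∉ e 0) (l := x :: nil).
  + definability.
  + by [].
  + by exists z; split; [apply: H_trans hz => //; apply: elem_H|].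
  + by exists w; split=> //; split=> // v _; apply: hw2.
- move=> x y hx hy; exists (upair x y); split; first exact: elem_upair.
  by split; apply/upairP; [left|right].
- move=> x hx; exists (bigcup x); split; first exact: elem_bigcup.
  by move=> y z _ _ hy hz; apply/bigcupP; exists y.
- exists omega; split=> //; split.
    exists empty; split; first exact: elem_empty.
    by split; [apply: (num_omega 0)|move=> z _ /emptyP].
  move=> x hx /omegaP[n ?]; subst x; exists (num (S n)); split; first exact: elem_succ.
  split; first exact: num_omega.
  by move=> z _; apply: in_succ.
- move=> p e a he ha.
  exists (sep (fun x => sat (H theta) p (scons x e)) a); split; last first.
    by move=> x hx; rewrite in_sep sE.
  apply: (elem_term_env (t := fun e => sep (fun x => sat (H theta) p (scons x (fun n => e (S n)))) (e 0)) (e := scons a e)).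
    apply: dterm_sep => //; first exact: dterm_var.
    refine (def_sat p (E := fun e => scons (e 0) (fun n => e (S (S n)))) _) => // -[|n] /=;
      exact: dterm_var.
  by move=> [|n] /=.
- move=> p e a he ha hcol.
  have hse : in_env M (scons a e) by move=> [|n] /=.
  have hH : forall x, H theta x -> x ∈ a ->
      exists y, H theta y /\ sat (H theta) p (scons y (scons x e)).
    apply: (elem_all_env (P := fun e => e 0 ∈ e 1 -> exists y, H theta y /\
      sat (H theta) p (scons y (scons (e 0) (fun n => e (S (S n)))))) (e := scons a e)) => //.
      apply: def_imp; first by definability.
      apply: def_exH.
      refine (def_sat p (E := fun e => scons (e 0) (scons (e 1) (fun n => e (S (S (S n)))))) _) => // -[|[|n]] /=;
      exact: dterm_var.
    move=> x hx /= hxa; have [y [hy hsat]] := hcol x hx hxa.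
    by exists y; split; [apply: elem_H|apply/sE2].
  have Ha := elem_H ha.
  have /choose_fun[f hf] : forall x, x ∈ a -> exists y, H theta y /\ sat (H theta) p (scons y (scons x e)).
    by move=> x hx; apply: hH => //; apply: H_trans hx.
  have [|||b [hb hP]] := elem_ex_env (P := fun e => forall x, x ∈ e 1 -> exists y, y ∈ e 0 /\
      sat (H theta) p (scons y (scons x (fun n => e (S (S n)))))) (e := scons a e).
  + apply: def_ball; [exact: rt|exact: dterm_var|].
    apply: def_bex; [exact: rt|exact: dterm_var|].
    refine (def_sat p (E := fun e => scons (e 0) (scons (e 1) (fun n => e (S (S (S (S n))))))) _) => // -[|[|n]] /=;
      exact: dterm_var.
  + exact: hse.
  + exists (image f a); split; first by apply: H_image => // x /hf[].
    by move=> x hx; exists (f x); split; [apply: image_in|case: (hf x hx)].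
  + exists b; split=> // x hx hxa.
    have [|||y [hy [hyb hsat]]] := elem_ex_env (P := fun e => e 0 ∈ e 1 /\
      sat (H theta) p (scons (e 0) (fun n => e (S (S n))))) (e := scons b (scons x e)).
    * apply: def_and; first by definability.
      refine (def_sat p (E := fun e => scons (e 0) (fun n => e (S (S n)))) _) => // -[|n] /=;
      exact: dterm_var.
    * by move=> [|[|n]] /=.
    * have [y [hy hsat]] := hP x hxa.
      by exists y; split=> //; apply: H_trans hy => //; apply: elem_H.
    * by exists y; split=> //; split=> //; apply/sE2.
- exact: elem_wellorder.
Qed.

End Elementary.
End Submodels.

(** * Löwenheim-Skolem: existence of kappa-models *)

Fixpoint formula_code (p : formula) : nat :=
  match p with
  | fEq i j => to_nat (0, to_nat (i, j))
  | fMem i j => to_nat (1, to_nat (i, j))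
  | fNot p => to_nat (2, formula_code p)
  | fAnd p q => to_nat (3, to_nat (formula_code p, formula_code q))
  | fAll p => to_nat (4, formula_code p)
  end.

#[local] Arguments to_nat : simpl never.

Lemma formula_code_inj p q : formula_code p = formula_code q -> p = q.
Proof.
elim: p q => [i j|i j|p IH|p IHp p' IHp'|p IH] [i' j'|i' j'|q|q q'|q] /= h;
  have {}h := to_nat_inj _ _ h; try discriminate; case: h.
- by move=> h; have [-> ->] := to_nat_inj _ _ h.
- by move=> h; have [-> ->] := to_nat_inj _ _ h.
- by move=> /IH ->.
- by move=> h; have [/IHp -> /IHp' ->] := to_nat_inj _ _ h.
- by move=> /IH ->.
Qed.

Section Hull.
Context {U : ZFC_universe}.
Variables theta kappa P : U.
Hypotheses (rt : regular theta) (rk : regular kappa) (uk : omega ∈ kappa).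
Hypotheses (kt : kappa ∈ theta) (wk : eq_weak_power kappa).
Hypotheses (HP : forall x, x ∈ P -> H theta x) (leP : injects P kappa).

(** The environment of the formula numbered [k] is a sequence [s] of length [omega];
    closure under short sequences provides it, as [kappa] is uncountable. *)
Definition skolem (k s : U) : U :=
  epsilon (inhabits empty) (fun x => H theta x /\ exists p,
    k = num (formula_code p) /\ sat (H theta) p (scons x (fun n => ap s (num n)))).

Definition hull_step (X : U) : U :=
  union X (union (ltfuns X kappa)
    (sep (H theta) (bigcup_seq omega (fun k => image (skolem k) (ltfuns X kappa))))).

Lemma le_of_in x : x ∈ kappa -> injects x kappa.
Proof. by move=> h; apply/injects_sub/(ordinal_sub (regular_ord rk)). Qed.

(** This is where [kappa = kappa^(<kappa)] is used. *)
Lemma hull_step_le X : injects X kappa -> injects (hull_step X) kappa.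
Proof.
move=> hX; have hf : injects (ltfuns X kappa) kappa by apply: le_ltfuns.
apply: le_union => //; apply: le_union => //.
apply: injects_trans (injects_sub (sep_sub (P := _) (a := _))) _.
apply: le_bigcup_seq => //; first exact: le_of_in.
by move=> k _; apply: le_image.
Qed.

Lemma hull_step_H X : (forall x, x ∈ X -> H theta x) ->
  forall x, x ∈ hull_step X -> H theta x.
Proof.
move=> hX x /in_union[|/in_union[/in_ltfuns[b [f [hb [hf ->]]]]|/in_sep[]]//]; first exact: hX.
apply: H_lam => //; last by move=> y /hf/hX.
by apply: H_ordinal => //; apply: ordinal_trans kt hb; apply: regular_ord.
Qed.

Definition hull_base : U := union P (succ kappa).

Definition hull : U -> U := wfrec (@mem_wf U)
  (fun i X => hull_step (union hull_base (bigcup_seq i X))).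

Lemma hull_eq i : hull i = hull_step (union hull_base (bigcup_seq i hull)).
Proof.
rewrite {1}/hull wfrec_eq -/hull; congr (hull_step (union _ _)).
apply: extensionality => x; rewrite !in_bigcup_seq; split; move=> [j [hj]];
  by [rewrite restrT // => h; exists j|exists j; rewrite restrT].
Qed.

Lemma hull_base_H x : x ∈ hull_base -> H theta x.
Proof.
move=> /in_union[/HP//|/in_succ[h|->]]; apply: H_ordinal => //.
by apply: ordinal_trans kt h; apply: regular_ord.
Qed.

Lemma hull_H i x : x ∈ hull i -> H theta x.
Proof.
move: i x; apply: mem_ind => i IH x; rewrite hull_eq; apply: hull_step_H => y.
move=> /in_union[/hull_base_H//|/in_bigcup_seq[j [hj]]]; exact: IH.
Qed.

Lemma hull_le i : i ∈ kappa -> injects (hull i) kappa.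
Proof.
move: i; apply: mem_ind => i IH hi; rewrite hull_eq; apply: hull_step_le.
apply: le_union => //.
  apply: le_union => //; apply: le_union => //; first exact: injects_sub.
  exact: le_upair.
apply: le_bigcup_seq => //; first exact: le_of_in.
by move=> j hj; apply: IH => //; apply: ordinal_trans hj => //; apply: regular_ord.
Qed.

Let M : U := bigcup_seq kappa hull.

Lemma hull_stage d x : d ∈ kappa -> x ∈ hull d -> x ∈ M.
Proof. by move=> hd hx; apply/in_bigcup_seq; exists d. Qed.

Lemma hull_below d x : x ∈ bigcup_seq d hull -> x ∈ union hull_base (bigcup_seq d hull).
Proof. by move=> h; apply/in_union; right. Qed.

Lemma hull_base_sub : hull_base ⊆ M.
Proof.
move=> x hx; apply: (hull_stage (d := num 0)); first exact: num_regular.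
by rewrite hull_eq; apply/in_union; left; apply/in_union; left.
Qed.

Lemma hull_closed : closed_lt kappa M.
Proof.
move=> s /in_ltfuns[b [f [hb [hf ->]]]].
have /choose_fun[h hh] : forall x, x ∈ b -> exists i, i ∈ kappa /\ f x ∈ hull i.
  by move=> x /hf/in_bigcup_seq.
have [d [hd hd2]] := regular_bound rk hb (f := h) (fun i hi => proj1 (hh i hi)).
apply: (hull_stage hd); rewrite hull_eq; apply/in_union; right; apply/in_union; left.
apply/in_ltfuns; exists b, f; split=> //; split=> // x hx; apply/hull_below/in_bigcup_seq.
by exists (h x); split; [apply: hd2|case: (hh x hx)].
Qed.

Lemma hull_elementary : elementary_sub M (H theta).
Proof.
apply: tarski_vaught => [x /in_bigcup_seq[i [_]]|p e he hex]; first exact: hull_H.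
have /choose_fun[h hh] : forall k : U, k ∈ omega ->
    exists y : U, exists n, k = num n /\ y = e n.
  by move=> k /omegaP[n ->]; exists (e n), n.
have hE n : h (num n) = e n by have [m [/num_inj <- ->]] := hh _ (num_omega n).
have /choose_fun[g hg] : forall x, x ∈ M -> exists i, i ∈ kappa /\ x ∈ hull i.
  by move=> x /in_bigcup_seq.
have [d [hd hd2]] := nat_bound rk uk (s := fun n => g (e n)) (fun n => proj1 (hg _ (he n))).
pose s := lam omega h.
have hs : (fun n => ap s (num n)) = e.
  by apply: functional_extensionality => n; rewrite ap_lam ?hE //; apply: num_omega.
have hw : exists x, H theta x /\ exists q,
    num (formula_code p) = num (formula_code q) :> U /\
    sat (H theta) q (scons x (fun n => ap s (num n))).
  by have [x [hx hsat]] := hex; exists x; split=> //; exists p; rewrite hs.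
have := epsilon_spec (inhabits empty) _ hw; rewrite -/(skolem (num (formula_code p)) s).
move=> [hH [q [/num_inj/formula_code_inj <- hsat]]].
rewrite hs in hsat; exists (skolem (num (formula_code p)) s); split=> //.
apply: (hull_stage hd); rewrite hull_eq; apply/in_union; right; apply/in_union; right.
apply/in_sep; split=> //; apply/in_bigcup_seq; exists (num (formula_code p)).
split; first exact: num_omega.
apply: image_in; apply/in_ltfuns; exists omega, h; split=> //; split=> // x /omegaP[n ->].
rewrite hE; apply/hull_below/in_bigcup_seq; exists (g (e n)); split=> //.
by case: (hg _ (he n)).
Qed.

(** The union of a chain of length [kappa] that alternately adds Skolem witnesses and
    sequences of length less than [kappa]. *)
Lemma kappa_model_exists :
  exists M, kappa_model kappa M /\ elementary_sub M (H theta) /\ P ⊆ M.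
Proof.
exists M; split; last split; [|exact: hull_elementary|].
  have hs : succ kappa ⊆ M.
    by move=> x hx; apply: hull_base_sub; apply/in_union; right.
  have hk : kappa ⊆ M by move=> x hx; apply/hs/in_succ; left.
  split; last exact: hull_closed.
  split; last split=> //.
    apply: cantor_bernstein; last exact: injects_sub.
    apply: le_bigcup_seq => //; first exact: injects_sub.
    by move=> i; apply: hull_le.
  apply: (elem_ZFCminus rt hull_elementary); first by exists omega; apply: hk.
  exact: hk.
by move=> x hx; apply: hull_base_sub; apply/in_union; left.
Qed.

End Hull.

(** * The ultrapower of a submodel by a normal filter *)

Section Ultrapower.
Context {U : ZFC_universe}.
Variables theta kappa M F : U.
Hypotheses (rt : regular theta) (rk : regular kappa) (uk : omega ∈ kappa).
Hypothesis (kt : kappa ∈ theta).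
Hypotheses (HM : elementary_sub M (H theta)) (kM : succ kappa ⊆ M).
Hypothesis (omega_closed :
  forall f : U -> U, (forall k, k ∈ omega -> f k ∈ M) -> lam omega f ∈ M).
Hypothesis (normal : normal_filter kappa M F).
Hypothesis (amenable : forall B, B ∈ M -> (forall c, c ∈ kappa -> ap B c ⊆ kappa) ->
  sep (fun c => ap B c ∈ F) kappa ∈ M).
Implicit Types (a b c f g x y z A B : U) (P Q R : U -> Prop) (e : nat -> U).

Let ok : ordinal kappa := regular_ord rk.

Lemma kappa_in_M : kappa ∈ M. Proof. by apply/kM/in_succ; right. Qed.
Lemma below_in_M i : i ∈ kappa -> i ∈ M. Proof. by move=> h; apply/kM/in_succ; left. Qed.
Lemma M_inh : exists x, x ∈ M. Proof. exists kappa; exact: kappa_in_M. Qed.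

Local Notation elemt T L := (elem_term rt HM M_inh (t := T) (l := L)).

(** ** The filter *)

Lemma F_list (l : list U) b : (forall A, In A l -> A ∈ F) -> b ∈ kappa ->
  exists i, i ∈ kappa /\ (forall A, In A l -> i ∈ A) /\ i ∉ b.
Proof.
move=> hl hb; have [[_ /(_ l hl) e] _] := normal.
apply: NNPP => n; case: (rk) => -[_ hk] _; apply: (hk b hb).
apply: cantor_bernstein; first exact/injects_sub/ordinal_sub.
apply: injects_trans (equinumerous_injects (equinumerous_sym e)) _.
apply: injects_sub => x /in_sep[hx h]; apply: NNPP => n2; apply: n; by exists x.
Qed.

Lemma F_measure A : A ∈ M -> A ⊆ kappa -> A ∉ F -> diff kappa A ∈ F.
Proof.
move=> hA hs n; have [_ [hm _]] := normal.
by case: (hm A) => //; apply/in_inter; split=> //; apply/powerP.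
Qed.

(** The elements of [F] in [M] are handled as properties holding at almost all
    indices.  [F] is not assumed to be closed under intersections or supersets: the
    conclusion holds because otherwise the complement of [R] would be in [F], and
    the intersection of the three sets would be empty. *)
Lemma F_and3 P Q R : sep P kappa ∈ F -> sep Q kappa ∈ F -> sep R kappa ∈ M ->
  (forall i, i ∈ kappa -> P i -> Q i -> R i) -> sep R kappa ∈ F.
Proof.
move=> hP hQ hR h; apply: NNPP => n.
have hd := F_measure hR (sep_sub (P := _) (a := _)) n.
have [||i [hi [hA _]]] := F_list (l := sep P kappa :: sep Q kappa :: diff kappa (sep R kappa) :: nil) (b := num 0).
- by move=> A /= [<-|[<-|[<-|[]]]].
- exact: num_regular.
- have /in_sep[_ h1] : i ∈ sep P kappa by apply: hA; left.
  have /in_sep[_ h2] : i ∈ sep Q kappa by apply: hA; right; left.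
  have /in_diff[_ h3] : i ∈ diff kappa (sep R kappa) by apply: hA; right; right; left.
  by apply: h3; apply/in_sep; split=> //; apply: h.
Qed.

Lemma F_imp P R : sep P kappa ∈ F -> sep R kappa ∈ M ->
  (forall i, i ∈ kappa -> P i -> R i) -> sep R kappa ∈ F.
Proof. by move=> hP hR h; apply: (F_and3 hP hP hR) => i hi hp _; apply: h. Qed.

Lemma F_ex P Q : sep P kappa ∈ F -> sep Q kappa ∈ F -> exists i, i ∈ kappa /\ P i /\ Q i.
Proof.
move=> hP hQ.
have [||i [hi [hA _]]] := F_list (l := sep P kappa :: sep Q kappa :: nil) (b := num 0).
- by move=> A /= [<-|[<-|[]]].
- exact: num_regular.
- have /in_sep[_ h1] : i ∈ sep P kappa by apply: hA; left.
  have /in_sep[_ h2] : i ∈ sep Q kappa by apply: hA; right; left.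
  by exists i.
Qed.

Lemma diff_sep P : diff kappa (sep P kappa) = sep (fun i => ~ P i) kappa.
Proof. by apply: extensionality => x; rewrite in_diff !in_sep; tauto. Qed.

Lemma F_not P : sep P kappa ∈ M -> sep (fun i => ~ P i) kappa ∈ F <-> sep P kappa ∉ F.
Proof.
move=> hM; split; first by move=> h1 h2; have [i [_ []]] := F_ex h1 h2.
by move/(F_measure hM (sep_sub (P := _) (a := _))); rewrite diff_sep.
Qed.

Lemma F_all P : (forall i, i ∈ kappa -> P i) -> sep P kappa ∈ F.
Proof.
move=> h; have -> : sep P kappa = kappa.
  by apply: sub_antisym; [apply: sep_sub|move=> x hx; apply/in_sep; split=> //; apply: h].
apply: NNPP => n; have hd := F_measure kappa_in_M (sub_refl (x := _)) n.
have [||i [hi [hA _]]] := F_list (l := diff kappa kappa :: nil) (b := num 0).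
- by move=> A /= [<-|[]].
- exact: num_regular.
- by have /in_diff[] : i ∈ diff kappa kappa by apply: hA; left.
Qed.

Lemma F_tail b : b ∈ kappa -> sep (fun i => b ∈ i) kappa ∈ F.
Proof.
move=> hb; apply: NNPP => /F_not h.
have {}h : sep (fun i => b ∉ i) kappa ∈ F.
  apply: h; apply: (elemt (fun e => sep (fun i => e 1 ∈ i) (e 0)) (kappa :: b :: nil)).
    definability.
  by do !split=> //; [apply: kappa_in_M|apply: below_in_M].
have [||i [hi [hA hib]]] := F_list (l := sep (fun i => b ∉ i) kappa :: nil) (b := succ b).
- by move=> A /= [<-|[]].
- exact: regular_succ.
- have /in_sep[_ h2] : i ∈ sep (fun i => b ∉ i) kappa by apply: hA; left.
  apply: hib; apply/in_succ.
  have [|[|]] := ordinal_total (ordinal_in ok hi) (ordinal_in ok hb); intuition.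
Qed.

Lemma F_normal (X : U -> U) : lam kappa X ∈ M -> (forall b, b ∈ kappa -> X b ∈ F) ->
  diagonal kappa X ∈ F.
Proof. by have [_ [_ h]] := normal; apply: h. Qed.

(** Otherwise the diagonal intersection of the sets where [g] does not take the
    value [c] would be disjoint from the set where [g] is regressive. *)
Lemma F_regressive g : g ∈ M -> sep (fun i => ap g i ∈ i) kappa ∈ F ->
  exists c, c ∈ kappa /\ sep (fun i => ap g i = c) kappa ∈ F.
Proof.
move=> hg hr; apply: NNPP => n.
have hX c : c ∈ kappa -> sep (fun i => ap g i <> c) kappa ∈ F.
  move=> hc; apply/F_not; last by move=> h; apply: n; exists c.
  apply: (elemt (fun e => sep (fun i => ap (e 2) i = e 1) (e 0)) (kappa :: c :: g :: nil)).
    definability.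
  by do !split=> //; [apply: kappa_in_M|apply: below_in_M].
have hd := F_normal (X := fun c => sep (fun i => ap g i <> c) kappa).
have {}hd : diagonal kappa (fun c => sep (fun i => ap g i <> c) kappa) ∈ F.
  apply: hd => //.
  apply: (elemt (fun e => lam (e 0) (fun c => sep (fun i => ~ (ap (e 1) i = c)) (e 0))) (kappa :: g :: nil)).
    definability.
  by do !split=> //; apply: kappa_in_M.
have [i [hi [h1 h2]]] := F_ex hr hd.
by have /in_sep[_] := h2 _ h1.
Qed.

(** A diagonal intersection of a sequence that is trivial from [omega] on; its
    elements outside [omega] are in all the sets. *)
Lemma F_countable (A : nat -> U) : (forall n, A n ∈ M) -> (forall n, A n ∈ F) ->
  exists i, i ∈ kappa /\ forall n, i ∈ A n.
Proof.
move=> hM hF.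
have /choose_fun[h hh] : forall k : U, k ∈ omega -> exists y : U, exists n, k = num n /\ y = A n.
  by move=> k /omegaP[n ->]; exists (A n), n.
have hE n : h (num n) = A n by have [m [/num_inj <- ->]] := hh _ (num_omega n).
have hs : lam omega h ∈ M by apply: omega_closed => k /omegaP[n ->]; rewrite hE.
pose X b := sep (fun i => b ∈ omega -> i ∈ ap (lam omega h) b) kappa.
have hX n : X (num n) = A n.
  have hA : A n ⊆ kappa by apply/powerP; case: normal => -[h1 _] _; apply: h1.
  apply: extensionality => i; rewrite in_sep ap_lam ?hE; first exact: num_omega.
  split; first by move=> [_]; apply; apply: num_omega.
  by move=> hi; split=> //; apply: hA.
have hd : diagonal kappa X ∈ F.
  apply: F_normal.
    apply: (elemt (fun e => lam (e 0) (fun b => sep (fun i => b ∈ e 1 -> i ∈ ap (e 2) b) (e 0)))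
      (kappa :: omega :: lam omega h :: nil)).
      definability.
    by do !split=> //; [apply: kappa_in_M|apply: below_in_M].
  move=> b hb; case: (classic (b ∈ omega)) => [/omegaP[n ->]|n]; first by rewrite hX.
  by apply: F_all => i hi.
have [||i [hi [hA hio]]] := F_list (l := diagonal kappa X :: nil) (b := omega).
- by move=> B /= [<-|[]].
- by [].
- exists i; split=> // n.
  have /in_sep[_ hdi] : i ∈ diagonal kappa X by apply: hA; left.
  rewrite -hX; apply: hdi; apply: (ordinal_notin (ordinal_in ok hi) (ordinal_in ok uk) hio).
  exact: num_omega.
Qed.

(** ** Collapsing the ultrapower *)

Definition memF g f : Prop :=
  g ∈ M /\ f ∈ M /\ sep (fun i => ap g i ∈ ap f i) kappa ∈ F.

Lemma mem_set_M g f : g ∈ M -> f ∈ M -> sep (fun i => ap g i ∈ ap f i) kappa ∈ M.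
Proof.
move=> hg hf; apply: (elemt (fun e => sep (fun i => ap (e 1) i ∈ ap (e 2) i) (e 0)) (kappa :: g :: f :: nil)).
  definability.
by do !split=> //; apply: kappa_in_M.
Qed.

Lemma eq_set_M g f : g ∈ M -> f ∈ M -> sep (fun i => ap g i = ap f i) kappa ∈ M.
Proof.
move=> hg hf; apply: (elemt (fun e => sep (fun i => ap (e 1) i = ap (e 2) i) (e 0)) (kappa :: g :: f :: nil)).
  definability.
by do !split=> //; apply: kappa_in_M.
Qed.

(** A descending sequence would, by countable completeness, be descending at some
    index. *)
Lemma memF_wf : well_founded memF.
Proof.
move=> f; apply: NNPP => nf.
have /choose_fun[st hst] : forall x, ~ Acc memF x -> exists y, memF y x /\ ~ Acc memF y.
  move=> x hx; apply: NNPP => n; apply: hx; constructor => y hy.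
  by apply: NNPP => ny; apply: n; exists y.
pose s n := Nat.iter n st f.
have hs n : ~ Acc memF (s n) by elim: n => //= n IH; case: (hst _ IH).
have hs2 n : memF (s (S n)) (s n) by case: (hst _ (hs n)).
have [||i [_ hi]] := F_countable (A := fun n => sep (fun i => ap (s (S n)) i ∈ ap (s n) i) kappa).
- by move=> n; have [h1 [h2 _]] := hs2 n; apply: mem_set_M.
- by move=> n; have [_ [_]] := hs2 n.
- have hno : forall x : U, forall n, x <> ap (s n) i.
  apply: mem_ind => x IH n e; subst x.
  by have /in_sep[_ h] := hi n; apply: (IH _ h (S n)).
exact: (hno _ 0).
Qed.

(** The transitive collapse, defined on the elements of [M] without passing to
    classes modulo [F]: functions that agree almost everywhere have the same
    elements, hence the same collapse. *)
Definition collapse : U -> U :=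
  wfrec memF_wf (fun f rec => image rec (sep (fun g => memF g f) M)).

Lemma in_collapse f y : y ∈ collapse f <-> exists g, memF g f /\ y = collapse g.
Proof.
rewrite {1}/collapse wfrec_eq -/collapse in_image; split.
  by move=> [g [/in_sep[hg hm]]]; rewrite restrT // => ->; exists g.
move=> [g [hm ->]]; exists g; rewrite restrT //; split=> //; apply/in_sep; split=> //.
by case: hm.
Qed.

(** The choice is made in [H(theta)], where the resulting function has a definable
    property; hence there is such a function in [M]. *)
Lemma M_choice Phi e : definable theta Phi -> in_env M e ->
  exists g, g ∈ M /\ forall i, i ∈ kappa ->
    (exists x, H theta x /\ Phi (scons x (scons i e))) -> Phi (scons (ap g i) (scons i e)).
Proof.
move=> hQ he.
have [|||g [hg hP]] := elem_ex_env HM (P := fun e => forall i, i ∈ e 1 ->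
    (exists x, H theta x /\ Phi (scons x (scons i (fun n => e (S (S n)))))) ->
    Phi (scons (ap (e 0) i) (scons i (fun n => e (S (S n)))))) (e := scons kappa e).
- apply: def_ball; [exact: rt|definability|].
  apply: def_imp.
    apply: def_exH.
    refine (def_comp (E := fun e => scons (e 0) (scons (e 1) (fun n => e (S (S (S (S n))))))) hQ _) => // -[|[|n]] /=;
    exact: dterm_var.
  refine (def_comp (E := fun e => scons (ap (e 1) (e 0)) (scons (e 0) (fun n => e (S (S (S n)))))) hQ _) => // -[|[|n]] /=.
    definability.
  all: exact: dterm_var.
- by move=> [|n] //=; apply: kappa_in_M.
- have /choose_fun[h hh] : forall i, i ∈ kappa -> exists x, H theta x /\
     ((exists x, H theta x /\ Phi (scons x (scons i e))) -> Phi (scons x (scons i e))).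
    move=> i hi; case: (classic (exists x, H theta x /\ Phi (scons x (scons i e)))) => [[x [hx hq]]|n].
      by exists x.
    by exists kappa; split=> //; apply: H_ordinal.
  exists (lam kappa h); split.
    by apply: H_lam => //; [apply: H_ordinal|move=> y /hh[]].
  by move=> i /= hi hx; rewrite ap_lam //; case: (hh i hi) => _; apply.
- by exists g.
Qed.

Lemma memF_eq g g' f : memF g f -> g' ∈ M -> sep (fun i => ap g i = ap g' i) kappa ∈ F ->
  memF g' f.
Proof.
move=> [hg [hf hF]] hg' hE; split=> //; split=> //.
by apply: (F_and3 hF hE (mem_set_M hg' hf)) => i _ h1 <-.
Qed.

Lemma eqF_sym f g : f ∈ M -> g ∈ M -> sep (fun i => ap f i = ap g i) kappa ∈ F ->
  sep (fun i => ap g i = ap f i) kappa ∈ F.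
Proof. by move=> hf hg h; apply: (F_imp h (eq_set_M hg hf)) => i _ ->. Qed.

(** Where two functions differ, one value has an element outside the other, and a
    function in [M] can choose it. *)
Lemma neqF_separated f g : f ∈ M -> g ∈ M -> sep (fun i => ap f i <> ap g i) kappa ∈ F ->
  exists h, (memF h f /\ ~ memF h g) \/ (memF h g /\ ~ memF h f).
Proof.
move=> hf hg hne.
have key : forall f g, f ∈ M -> g ∈ M ->
    sep (fun i => exists x, x ∈ ap f i /\ x ∉ ap g i) kappa ∈ F ->
    exists h, memF h f /\ ~ memF h g.
{ move=> {hne} {}f {}g {}hf {}hg hF.
  have [||h [hh hP]] := M_choice (Phi := fun e => e 0 ∈ ap (e 2) (e 1) /\ ~ e 0 ∈ ap (e 3) (e 1)) (e := lenv (f :: g :: nil)).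
  - definability.
  - exact: (lenv_in rt HM M_inh).
  - have h2 i : i ∈ kappa -> (exists x, x ∈ ap f i /\ x ∉ ap g i) -> ap h i ∈ ap f i /\ ap h i ∉ ap g i.
    move=> hi [x [h1 h2]]; apply: (hP i hi) => /=; exists x; split=> //.
    apply: (H_trans rt) h1; apply: (elem_H HM); apply: (elem_ap rt HM M_inh) => //.
    exact: below_in_M.
  exists h; split.
    split=> //; split=> //; apply: (F_imp hF (mem_set_M hh hf)) => i hi /h2 []//.
  move=> [_ [_ hc]]; have [i [hi [h3 h4]]] := F_ex hF hc.
  by case: (h2 i hi h3). }
case: (classic (sep (fun i => exists x, x ∈ ap f i /\ x ∉ ap g i) kappa ∈ F)) => h1.
  by have [h hh] := key _ _ hf hg h1; exists h; left.
have h2 : sep (fun i => ~ exists x, x ∈ ap f i /\ x ∉ ap g i) kappa ∈ F.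
  apply/F_not => //.
  apply: (elemt (fun e => sep (fun i => exists x, x ∈ ap (e 1) i /\ ~ x ∈ ap (e 2) i) (e 0)) (kappa :: f :: g :: nil)).
    definability.
  by do !split=> //; apply: kappa_in_M.
have [|h hh] := key g f hg hf; last by exists h; right.
apply: (F_and3 hne h2).
  apply: (elemt (fun e => sep (fun i => exists x, x ∈ ap (e 2) i /\ ~ x ∈ ap (e 1) i) (e 0)) (kappa :: f :: g :: nil)).
    definability.
  by do !split=> //; apply: kappa_in_M.
move=> i hi hn hs; apply: NNPP => hs2; apply: hn; apply: extensionality => x.
by split=> hx; apply: NNPP => nx; [apply: hs|apply: hs2]; exists x.
Qed.

(** By induction on [f]: a function separating [f] from [g] would be represented,
    up to almost everywhere equality, in both or in neither. *)
Lemma collapse_eq f g : f ∈ M -> g ∈ M ->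
  collapse f = collapse g <-> sep (fun i => ap f i = ap g i) kappa ∈ F.
Proof.
move=> hf hg; split; last first.
  move=> hE; apply: extensionality => y; rewrite !in_collapse.
  by split; move=> [h [[hh [hh2 hm]] ->]]; exists h; split=> //; split=> //; split=> //;
    [apply: (F_and3 hm hE (mem_set_M hh hg))|apply: (F_and3 hm hE (mem_set_M hh hf))] => i _ h1 h2; congruence.
elim/(well_founded_ind memF_wf): f g hf hg => f IH g hf hg hc.
apply: NNPP => n.
have [|h [[h1 h2]|[h1 h2]]] := neqF_separated hf hg.
- by apply/F_not => //; apply: eq_set_M.
- have hhM : h ∈ M by case: h1.
  have /in_collapse[h' [hh' e]] : collapse h ∈ collapse g by rewrite -hc in_collapse; exists h.
  have hh'M : h' ∈ M by case: hh'.
  by apply: h2; apply: (memF_eq hh') => //; apply: eqF_sym => //; apply: IH.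
- have hhM : h ∈ M by case: h1.
  have /in_collapse[h' [hh' e]] : collapse h ∈ collapse f by rewrite hc in_collapse; exists h.
  have hh'M : h' ∈ M by case: hh'.
  by apply: h2; apply: (memF_eq hh') => //; apply: IH.
Qed.

Lemma collapse_mem f g : f ∈ M -> g ∈ M -> collapse f ∈ collapse g <-> memF f g.
Proof.
move=> hf hg; rewrite in_collapse; split; last by exists f.
move=> [h [hm e]]; have hh : h ∈ M by case: hm.
by apply: (memF_eq hm) => //; apply/collapse_eq.
Qed.

Definition ultrapower : U := image collapse M.
Let N : U := ultrapower.

Lemma in_ultrapower y : y ∈ N <-> exists f, f ∈ M /\ y = collapse f.
Proof. exact: in_image. Qed.

(** Truth at an index is taken in [H(theta)], where it is definable by [p] itself;
    it agrees with truth in [M] since the values are in [M]. *)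
Definition truth_set p e : U := sep (fun i => sat (H theta) p (fun n => ap (e n) i)) kappa.

Lemma truth_set_M p e : in_env M e -> truth_set p e ∈ M.
Proof.
move=> he.
apply: (elem_term_env HM (t := fun e => sep (fun i => sat (H theta) p (fun n => ap (e (S n)) i)) (e 0)) (e := scons kappa e)).
  apply: dterm_sep; [exact: rt|exact: dterm_var|].
  refine (def_sat (E := fun e n => ap (e (S (S n))) (e 0)) p _) => n; definability.
by move=> [|n] //=; apply: kappa_in_M.
Qed.

Theorem los p e : in_env M e ->
  sat (elts N) p (fun n => collapse (e n)) <-> truth_set p e ∈ F.
Proof.
rewrite /truth_set.
elim: p e => [i j|i j|p IH|p IHp q IHq|p IH] e he.
- by rewrite /= collapse_eq.
- by rewrite /= collapse_mem //; split=> [[_ []]|h].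
- by rewrite /= IH // F_not //; apply: truth_set_M.
- rewrite /= IHp // IHq //; split.
    by move=> [h1 h2]; apply: (F_and3 h1 h2 (truth_set_M (fAnd p q) he)).
  by move=> h; split; apply: (F_imp h (truth_set_M _ he)) => i _ [].
- have scE g : (fun n => collapse (scons g e n)) = scons (collapse g) (fun n => collapse (e n)).
  by apply: functional_extensionality => -[].
have scE2 g i : (fun n => ap (scons g e n) i) = scons (ap g i) (fun n => ap (e n) i).
  by apply: functional_extensionality => -[].
have hsc g : g ∈ M -> in_env M (scons g e) by move=> hg [|n] /=.
split=> h; last first.
  move=> y /in_ultrapower[g [hg ->]]; rewrite -scE IH; first exact: hsc.
  apply: (F_imp h (truth_set_M _ (hsc _ hg))) => i hi /= hall; rewrite scE2; apply: hall.
  by apply: (elem_H HM); apply: (elem_ap rt HM M_inh) => //; apply: below_in_M.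
apply: NNPP => n; have := F_measure (truth_set_M (fAll p) he) (sep_sub (P := _) (a := _)) n.
rewrite diff_sep => hn.
have [||g [hg hP]] := M_choice (Phi := fun e => ~ sat (H theta) p (scons (e 0) (fun n => ap (e (S (S n))) (e 1)))) (e := e).
+ apply: def_not.
  refine (def_sat (E := fun e => scons (e 0) (fun n => ap (e (S (S n))) (e 1))) p _) => -[|m] /=; definability.
+ by [].
+ have : sat (elts N) p (fun n => collapse (scons g e n)).
  by rewrite scE; apply: h; apply/in_ultrapower; exists g.
rewrite IH; first exact: hsc.
move=> h2; have [i [hi [h3 h4]]] := F_ex hn h2.
rewrite scE2 in h4; apply: (hP i hi) h4 => /=.
by apply: NNPP => n2; apply: h3 => /= x hx; apply: NNPP => n3; apply: n2; exists x.
Qed.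

(** ** The ultrapower embedding *)

Definition cst x : U := lam kappa (fun _ => x).

Lemma cst_M x : x ∈ M -> cst x ∈ M.
Proof.
move=> hx; apply: (elemt (fun e => lam (e 0) (fun _ => e 1)) (kappa :: x :: nil)).
  definability.
by do !split=> //; apply: kappa_in_M.
Qed.

Lemma ap_cst x i : i ∈ kappa -> ap (cst x) i = x.
Proof. exact: ap_lam. Qed.

Definition embedding x : U := collapse (cst x).

Lemma embedding_elementary : elementary_embedding M N embedding.
Proof.
split; first by move=> x hx; apply/in_ultrapower; exists (cst x); split=> //; apply: cst_M.
move=> p e he; rewrite los; first by move=> n; apply: cst_M.
rewrite (proj2 HM) //; split.
  move=> h; apply: F_all => i hi.
  by have -> : (fun n => ap (cst (e n)) i) = e by apply: functional_extensionality => n; rewrite ap_cst.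
move=> h; have [i [hi [h1 _]]] := F_ex h h.
by have <- : (fun n => ap (cst (e n)) i) = e by apply: functional_extensionality => n; rewrite ap_cst.
Qed.

Lemma ultrapower_transitive x : x ∈ N -> x ⊆ N.
Proof.
move=> /in_ultrapower[f [hf ->]] y /in_collapse[g [[hg _] ->]].
by apply/in_ultrapower; exists g.
Qed.

(** An element of the ultrapower below the class of an [f] with [f i ⊆ i] is given
    by a regressive function, hence by a constant one. *)
Lemma regressive_const f g : memF g f -> sep (fun i => ap f i ⊆ i) kappa ∈ F ->
  exists c, c ∈ kappa /\ collapse g = embedding c /\ memF (cst c) f.
Proof.
move=> hm hr; have [hg [hf hF]] := hm.
have [||c [hc hcF]] := F_regressive (g := g) => //.
  apply: (F_and3 hF hr); last by move=> i _ h1; apply.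
  apply: (elemt (fun e => sep (fun i => ap (e 1) i ∈ i) (e 0)) (kappa :: g :: nil)).
    definability.
  by do !split=> //; apply: kappa_in_M.
have hcM := cst_M (below_in_M hc).
have hE : sep (fun i => ap g i = ap (cst c) i) kappa ∈ F.
  by apply: (F_imp hcF (eq_set_M hg hcM)) => i hi ->; rewrite ap_cst.
exists c; split=> //; split; first exact/collapse_eq.
exact: memF_eq hE.
Qed.

Lemma embedding_below b : b ∈ kappa -> embedding b = b.
Proof.
move: b; apply: mem_ind => b IH hb.
have hbM := cst_M (below_in_M hb).
have IH2 c : c ∈ b -> embedding c = c by move=> h; apply: IH => //; apply: ordinal_trans h.
apply: extensionality => y; rewrite in_collapse; split.
  move=> [g [hm ->]]; have [|c [hc [-> hm2]]] := regressive_const hm.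
    apply: (F_imp (F_tail hb)).
      apply: (elemt (fun e => sep (fun i => ap (e 1) i ⊆ i) (e 0)) (kappa :: cst b :: nil)).
        definability.
      by do !split=> //; apply: kappa_in_M.
    by move=> i hi h; rewrite ap_cst //; apply: ordinal_sub h; apply: ordinal_in hi.
  have [_ [_ hF]] := hm2; have [i [hi [h _]]] := F_ex hF hF.
  by rewrite !ap_cst // in h; rewrite IH2.
move=> hy; exists (cst y); split; last by rewrite -/(embedding y) IH2.
split; first by apply/cst_M/below_in_M/ordinal_trans/hy.
by split=> //; apply: F_all => i hi; rewrite !ap_cst.
Qed.

(** It represents an element of [j kappa] above all ordinals below [kappa]. *)
Definition idf : U := lam kappa (fun i => i).

Lemma idf_M : idf ∈ M.
Proof.
apply: (elemt (fun e => lam (e 0) (fun i => i)) (kappa :: nil)); first by definability.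
by do !split=> //; apply: kappa_in_M.
Qed.

Lemma embedding_critical : critical_point kappa embedding.
Proof.
split; first exact: embedding_below.
move=> e.
have : collapse idf ∈ embedding kappa.
  apply/collapse_mem; [exact: idf_M|exact/cst_M/kappa_in_M|].
  split; first exact: idf_M.
  split; first exact/cst_M/kappa_in_M.
  by apply: F_all => i hi; rewrite ap_cst // ap_lam.
rewrite e => hc.
have /collapse_eq h : collapse idf = collapse (cst (collapse idf)) by rewrite -{1}(embedding_below hc).
have {}h := h idf_M (cst_M (below_in_M hc)).
have [i [hi [h1 h2]]] := F_ex h (F_tail hc).
by rewrite ap_cst // ap_lam // in h1; subst i; case: (mem_irrefl h2).
Qed.

(** A subset [x] of [kappa] in [M] is represented by the function sending [i] to
    [x ∩ i]; conversely, membership of [c] in a represented subset of [kappa] is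
    decided by [F], so that amenability applies. *)
Lemma embedding_powerset : inter (power kappa) M = inter (power kappa) N.
Proof.
apply: extensionality => x; rewrite !in_inter !powerP; split; move=> [hx hxM]; split=> //.
  pose f := lam kappa (fun i => inter x i).
  have hf : f ∈ M.
    apply: (elemt (fun e => lam (e 0) (fun i => inter (e 1) i)) (kappa :: x :: nil)).
      definability.
    by do !split=> //; apply: kappa_in_M.
  apply/in_ultrapower; exists f; split=> //; apply: extensionality => y.
  rewrite in_collapse; split.
    move=> hy; have hyk := hx y hy; exists (cst y); split; last by rewrite -/(embedding y) embedding_below.
    have hyM := cst_M (below_in_M hyk); split=> //; split=> //.
    apply: (F_imp (F_tail hyk) (mem_set_M hyM hf)) => i hi h.
    by rewrite ap_cst // ap_lam // in_inter.
  move=> [g [hm ->]]; have [|c [hc [-> hm2]]] := regressive_const hm.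
    by apply: F_all => i hi; rewrite ap_lam // => z /in_inter[].
  have [_ [_ hF]] := hm2; have [i [hi [h _]]] := F_ex hF hF.
  rewrite ap_cst // ap_lam // in h; rewrite embedding_below //.
  by move: h => /in_inter[].
move: hxM => /in_ultrapower[f [hf e]].
pose B := lam kappa (fun c => sep (fun i => c ∈ ap f i) kappa).
have hB : B ∈ M.
  apply: (elemt (fun e => lam (e 0) (fun c => sep (fun i => c ∈ ap (e 1) i) (e 0))) (kappa :: f :: nil)).
    definability.
  by do !split=> //; apply: kappa_in_M.
have hBs c : c ∈ kappa -> ap B c ⊆ kappa by move=> hc; rewrite ap_lam //; apply: sep_sub.
suff -> : x = sep (fun c => ap B c ∈ F) kappa by apply: amenable.
have hc2 c : c ∈ kappa -> c ∈ x <-> ap B c ∈ F.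
  move=> hc; have hcM := cst_M (below_in_M hc).
  rewrite ap_lam // e -{1}(embedding_below hc) /embedding collapse_mem //.
  split=> [[_ [_ h]]|h].
    apply: (F_imp h) => [|i hi]; last by rewrite ap_cst.
    apply: (elemt (fun e => sep (fun i => e 2 ∈ ap (e 1) i) (e 0)) (kappa :: f :: c :: nil)).
      definability.
    by do !split=> //; [apply: kappa_in_M|apply: below_in_M].
  split=> //; split=> //; apply: (F_imp h (mem_set_M hcM hf)) => i hi.
  by rewrite ap_cst.
apply: extensionality => c; rewrite in_sep; split; last by move=> [h /hc2]; apply.
by move=> h; split; [apply: hx|apply/hc2 => //; apply: hx].
Qed.

Theorem ultrapower_powerset_preserving : exists N j, powerset_preserving kappa M N j.
Proof.
exists N, embedding; split; first exact: embedding_elementary.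
split; first exact: embedding_critical.
split; first exact: embedding_powerset.
by move=> x hx h y hy; apply: h => //; apply: (ultrapower_transitive hx).
Qed.

End Ultrapower.

(** * From the filter property to Ramsey embeddings *)

Section WinningRun.
Context {U : ZFC_universe}.
Variables theta kappa alpha : U.
Hypotheses (rt : regular theta) (rk : regular kappa) (ra : regular alpha).
Hypotheses (ua : omega ∈ alpha) (ak : alpha ⊆ kappa) (kt : kappa ∈ theta).
Hypothesis wk : eq_weak_power kappa.
Variables M F : U -> U.
Hypotheses (run : legal_run theta kappa alpha M F) (wins : judge_wins kappa alpha M F).

Let Ma := bigcup_seq alpha M.
Let Fa := bigcup_seq alpha F.

Lemma run_mono x y : x ∈ y -> y ∈ alpha -> M x ⊆ M y.
Proof. by move=> hx hy; have [[_ [_ [h _]]] _] := run hy; apply: h. Qed.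

Lemma run_elem x : x ∈ alpha -> elementary_sub (M x) (H theta).
Proof. by move=> hx; have [[_ [h _]] _] := run hx. Qed.

Lemma run_kappa x : x ∈ alpha -> succ kappa ⊆ M x.
Proof. by move=> hx; have [[[[_ [h _]] _] _] _] := run hx. Qed.

Lemma run_inh x : x ∈ alpha -> exists y, y ∈ M x.
Proof. by move=> hx; exists kappa; apply/(run_kappa hx)/in_succ; right. Qed.

Lemma in_limit x : x ∈ Ma <-> exists i, i ∈ alpha /\ x ∈ M i.
Proof. exact: in_bigcup_seq. Qed.

(** By regularity of [alpha].  Hence the limit of models closed under sequences of
    length less than [kappa] is closed under those of length less than [alpha]. *)
Lemma limit_bound b f : b ∈ alpha -> (forall i, i ∈ b -> f i ∈ Ma) ->
  exists d, d ∈ alpha /\ forall i, i ∈ b -> f i ∈ M d.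
Proof.
move=> hb hf.
have /choose_fun[h hh] : forall i, i ∈ b -> exists d, d ∈ alpha /\ f i ∈ M d.
  by move=> i /hf/in_limit.
have [d [hd hd2]] := regular_bound ra hb (f := h) (fun i hi => proj1 (hh i hi)).
exists d; split=> // i hi; apply: (run_mono (hd2 i hi) hd).
by case: (hh i hi).
Qed.

Lemma limit_bound_nat e : in_env Ma e -> exists d, d ∈ alpha /\ in_env (M d) e.
Proof.
move=> he; have /choose_fun[h hh] : forall x, x ∈ Ma -> exists d, d ∈ alpha /\ x ∈ M d.
  by move=> x /in_limit.
have [d [hd hd2]] := nat_bound ra ua (s := fun n => h (e n)) (fun n => proj1 (hh _ (he n))).
exists d; split=> // n; apply: (run_mono (hd2 n) hd).
by case: (hh _ (he n)).
Qed.

(** All the parameters of a formula are found at one stage, as [alpha] is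
    uncountable. *)
Lemma limit_elem : elementary_sub Ma (H theta).
Proof.
apply: tarski_vaught => [x /in_limit[i [hi]]|p e he hex]; first exact/elem_H/run_elem.
have [d [hd he2]] := limit_bound_nat he.
have [|x [hx hsat]] := elem_ex_env (run_elem hd) (P := sat (H theta) p) _ he2 hex.
  by exists p.
by exists x; split=> //; apply/in_limit; exists d.
Qed.

Lemma limit_closed : closed_lt alpha Ma.
Proof.
move=> s /in_ltfuns[b [f [hb [hf ->]]]].
have [d [hd hd2]] := limit_bound hb hf.
apply/in_limit; exists d; split=> //.
have [[[_ hc] _] _] := run hd; apply: hc; apply/in_ltfuns; exists b, f.
by split; [apply: ak|].
Qed.

Lemma limit_kappa : succ kappa ⊆ Ma.
Proof.
move=> x hx; apply/in_limit; exists (num 0); split; first exact: num_regular.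
by apply: run_kappa => //; apply: num_regular.
Qed.

Lemma limit_weak_model : weak_model kappa Ma.
Proof.
have hk : kappa ⊆ Ma by move=> x hx; apply/limit_kappa/in_succ; left.
split; last split; [|exact: limit_kappa|].
  apply: cantor_bernstein; last exact: injects_sub.
  apply: le_bigcup_seq => //; first exact: injects_sub.
  by move=> i hi; have [[[[h _] _] _] _] := run hi; apply: equinumerous_injects.
apply: (elem_ZFCminus rt limit_elem); first by exists omega; apply/hk/ak.
exact/hk/ak.
Qed.

(** Since the challenger's next model contains [F x ∩ M x], the limit filter is
    amenable to the limit model. *)
Lemma limit_amenable B : B ∈ Ma -> (forall c, c ∈ kappa -> ap B c ⊆ kappa) ->
  sep (fun c => ap B c ∈ Fa) kappa ∈ Ma.
Proof.
move=> /in_limit[x [hx hB]] hBs.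
have hx2 : succ x ∈ alpha by apply: regular_succ.
have hM := run_elem hx2; have hi := run_inh hx2.
have hxk : x ∈ M (succ x) by apply/(run_kappa hx2)/in_succ; left; apply: ak.
have hkk : kappa ∈ M (succ x) by apply/(run_kappa hx2)/in_succ; right.
have hG : inter (F x) (M x) ∈ M (succ x).
  have [[_ [_ [_ [_ hl]]]] _] := run hx2.
  have := elem_ap rt hM hi hl hxk; rewrite ap_lam //; apply/in_succ; by right.
have hB2 : B ∈ M (succ x) by apply: (run_mono (x := x)) => //; apply/in_succ; right.
apply/in_limit; exists (succ x); split=> //.
suff -> : sep (fun c => ap B c ∈ Fa) kappa = sep (fun c => ap B c ∈ inter (F x) (M x)) kappa.
  apply: (elem_term rt hM hi (t := fun e => sep (fun c => ap (e 1) c ∈ e 2) (e 0))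
    (l := kappa :: B :: inter (F x) (M x) :: nil)); last by [].
  definability.
apply: extensionality => c; split=> /in_sep[hc h]; apply/in_sep; split=> //; last first.
  by apply/in_bigcup_seq; exists x; case/in_inter: h.
have hcM : ap B c ∈ M x.
  apply: (elem_ap rt (run_elem hx) (run_inh hx)) => //.
  by apply/(run_kappa hx)/in_succ; left.
apply/in_inter; split=> //; have [_ [_ [hm _]]] := run hx.
have [//|hd] : ap B c ∈ F x \/ diff kappa (ap B c) ∈ F x.
  by apply: hm; apply/in_inter; split=> //; apply/powerP/hBs.
have [[_ hfil] _] := wins.
have [|f [_ [_ /(_ (num 0) (num_regular 0 rk))[i [/in_sep[hi2 hin] _]]]]] :=
  hfil (ap B c :: diff kappa (ap B c) :: nil).
  move=> A /= [<-//|[<-|[]]]; apply/in_bigcup_seq; by exists x.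
have h1 : i ∈ ap B c by apply: hin; left.
have /in_diff[] : i ∈ diff kappa (ap B c) by apply: hin; right; left.
by [].
Qed.

Lemma limit_embedding : exists N j, powerset_preserving kappa Ma N j.
Proof.
apply: (ultrapower_powerset_preserving rt rk (ak ua) kt limit_elem limit_kappa _ wins limit_amenable).
move=> f hf; apply: limit_closed; apply/in_ltfuns.
by exists omega, f.
Qed.

End WinningRun.

Section ChallengerStrategy.
Context {U : ZFC_universe}.
Variables theta kappa alpha A : U.
Hypotheses (rt : regular theta) (rk : regular kappa) (ra : regular alpha).
Hypotheses (uk : omega ∈ kappa) (ak : alpha ⊆ kappa) (kt : kappa ∈ theta).
Hypotheses (wk : eq_weak_power kappa) (Ak : A ⊆ kappa).

(** A legal move containing [A], given the union of the previous models and the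
    sequences of previous moves; that these are sets makes the move depend on the
    values of the previous moves only. *)
Definition next_model (u m f : U) : U := epsilon (inhabits empty) (fun X =>
  (kappa_model kappa X /\ elementary_sub X (H theta)) /\
  A ∈ X /\ u ⊆ X /\ m ∈ X /\ f ∈ X).

Definition response (x : U) (F : U -> U) : U :=
  wfrec (@mem_wf U) (fun x M => next_model (bigcup_seq x M) (lam x M)
    (lam x (fun y => inter (F y) (M y)))) x.

Lemma bigcup_seq_ext a (f g : U -> U) :
  (forall x, x ∈ a -> f x = g x) -> bigcup_seq a f = bigcup_seq a g.
Proof.
by move=> h; apply: extensionality => z; rewrite !in_bigcup_seq; split;
  move=> [x [hx hz]]; exists x; [rewrite -h|rewrite h].
Qed.

Lemma response_eq x F : response x F =
  next_model (bigcup_seq x (fun y => response y F)) (lam x (fun y => response y F))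
    (lam x (fun y => inter (F y) (response y F))).
Proof.
rewrite {1}/response wfrec_eq.
congr next_model; [apply: bigcup_seq_ext|apply: lam_ext|apply: lam_ext] => y hy;
  by rewrite restrT.
Qed.

Lemma response_strategy : strategy alpha response.
Proof.
move=> x F F'; move: x; apply: mem_ind => x IH hx hF.
have h y : y ∈ x -> response y F = response y F'.
  move=> hy; apply: IH => //; first exact: ordinal_trans (regular_ord ra) hx hy.
  move=> z hz; apply: hF; apply: ordinal_trans hz => //.
  exact: ordinal_in (regular_ord ra) hx.
rewrite !response_eq; congr next_model; [apply: bigcup_seq_ext|apply: lam_ext|apply: lam_ext] => y hy.
- exact: h.
- exact: h.
- by rewrite h // hF.
Qed.

Lemma response_legal x F : x ∈ alpha ->
  legal_run theta kappa x (fun y => response y F) F ->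
  challenger_legal theta kappa x (fun y => response y F) F (response x F) /\ A ∈ response x F.
Proof.
move=> hx run.
have hxt : H theta x.
  apply: H_ordinal => //; apply: (ordinal_trans (regular_ord rt) kt); exact: ak.
have hel y : y ∈ x -> forall z, z ∈ response y F -> H theta z.
  by move=> hy; have [[_ [h _]] _] := run y hy; apply: elem_H.
have hleM y : y ∈ x -> injects (response y F) kappa.
  by move=> hy; have [[[[h _] _] _] _] := run y hy; apply: equinumerous_injects.
have hHM y : y ∈ x -> H theta (response y F).
  move=> hy; apply/H_iff => //; split; last exact: hel.
  by exists kappa; split=> //; apply: hleM.
set u := bigcup_seq x (fun y => response y F).
set m := lam x (fun y => response y F).
set f := lam x (fun y => inter (F y) (response y F)).
have [||X [h1 [h2 h3]]] := kappa_model_exists (P := union (union (upair A m) (upair f f)) u) rt rk uk kt wk.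
- move=> z /in_union[/in_union[/upairP[]->|/upairP[]->]|/in_bigcup_seq[y [hy]]].
  + by apply: (H_sub rt (x := kappa)) => //; apply: H_ordinal.
  + by apply: H_lam.
  + by apply: H_lam => // y hy; apply: (H_sub rt (hHM y hy)) => w /in_inter[].
  + by apply: H_lam => // y hy; apply: (H_sub rt (hHM y hy)) => w /in_inter[].
  + exact: hel.
- apply: le_union => //.
    by apply: le_union => //; apply: le_upair.
  apply: le_bigcup_seq => //.
  apply/injects_sub/(ordinal_sub (regular_ord rk)); exact: ak.
- have hex : exists X, (kappa_model kappa X /\ elementary_sub X (H theta)) /\
      A ∈ X /\ u ⊆ X /\ m ∈ X /\ f ∈ X.
    exists X; split=> //; split.
      by apply/h3/in_union; left; apply/in_union; left; apply/upairP; left.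
    split; first by move=> z hz; apply/h3/in_union; right.
    split; apply/h3/in_union; left; apply/in_union; [left|right]; apply/upairP.
      by right.
    by left.
  have [[k1 k2] [k3 [k4 [k5 k6]]]] := epsilon_spec (inhabits empty) _ hex.
  rewrite response_eq; split=> //; split=> //; split=> //; split=> //.
  by move=> y hy z hz; apply: k4; apply/in_bigcup_seq; exists y.
Qed.

End ChallengerStrategy.

(** The strategy that starts with [A] never gets stuck; as it does not win, some run
    against it is won by the judge. *)
Theorem Ramsey_of_filter_property (U : ZFC_universe) (alpha kappa : U) :
  regular alpha -> omega ∈ alpha -> regular kappa -> alpha ⊆ kappa ->
  eq_weak_power kappa -> filter_property alpha kappa -> Ramsey alpha kappa.
Proof.
move=> ra ua rk ak wk fp d od.
have ou : ordinal (union d kappa).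
  by apply: ordinal_bigcup => y /upairP[->//|->]; apply: regular_ord.
have [theta [rt ht]] := regular_exists ou.
have ot := regular_ord rt.
have hd : d ∈ theta by apply: (ordinal_sub_in od ot _ ht) => x hx; apply/in_union; left.
have kt : kappa ∈ theta.
  by apply: (ordinal_sub_in (regular_ord rk) ot _ ht) => x hx; apply/in_union; right.
have uk := ak _ ua.
exists theta; split=> //; split=> // A hA.
have [F [run wins]] : exists F, legal_run theta kappa alpha (fun x => response theta kappa A x F) F /\
    judge_wins kappa alpha (fun x => response theta kappa A x F) F.
  apply: NNPP => n; apply: (fp theta rt kt); exists (response theta kappa A).
  split; first exact: response_strategy.
  move=> F M; split; first by move=> x hx run; case: (response_legal rt rk uk ak kt wk hA hx run).
  by move=> h1 h2; apply: n; exists F.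
exists (bigcup_seq alpha (fun x => response theta kappa A x F)).
split.
  have h0 : num 0 ∈ alpha by apply: num_regular.
  apply/in_bigcup_seq; exists (num 0); split=> //.
  by have [|_] := response_legal rt rk uk ak kt wk hA (F := F) h0; first by move=> x /emptyP.
split; first exact: limit_weak_model run.
split; first exact: limit_elem run.
split; first exact: limit_closed run.
exact: limit_embedding run wins.
Qed.

(** * Powerset preserving embeddings *)

Section Uniform.
Context {U : ZFC_universe}.

(** The same formula expresses [Q] in every class [D].  Unlike [definable], this
    applies to the target of an elementary embedding, which need be neither
    transitive nor closed under pairs. *)
Definition uniform (Q : (U -> Prop) -> (nat -> U) -> Prop) : Prop :=
  exists p, forall D e, sat D p e <-> Q D e.

Lemma uni_eq i j : uniform (fun _ e => e i = e j).
Proof. by exists (fEq i j). Qed.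

Lemma uni_mem i j : uniform (fun _ e => e i ∈ e j).
Proof. by exists (fMem i j). Qed.

Lemma uni_not P : uniform P -> uniform (fun D e => ~ P D e).
Proof. by move=> [p hp]; exists (fNot p) => D e /=; rewrite hp. Qed.

Lemma uni_and P Q : uniform P -> uniform Q -> uniform (fun D e => P D e /\ Q D e).
Proof. by move=> [p hp] [q hq]; exists (fAnd p q) => D e /=; rewrite hp hq. Qed.

Lemma uni_imp P Q : uniform P -> uniform Q -> uniform (fun D e => P D e -> Q D e).
Proof.
move=> [p hp] [q hq]; exists (fNot (fAnd p (fNot q))) => D e /=; rewrite hp hq.
by case: (classic (Q D e)); tauto.
Qed.

Lemma uni_or P Q : uniform P -> uniform Q -> uniform (fun D e => P D e \/ Q D e).
Proof.
move=> [p hp] [q hq]; exists (fNot (fAnd (fNot p) (fNot q))) => D e /=; rewrite hp hq.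
by case: (classic (Q D e)); case: (classic (P D e)); tauto.
Qed.

Lemma uni_iff P Q : uniform P -> uniform Q -> uniform (fun D e => P D e <-> Q D e).
Proof. by move=> hp hq; apply: uni_and; apply: uni_imp. Qed.

Lemma uni_all (B : (U -> Prop) -> U -> (nat -> U) -> Prop) :
  uniform (fun D e => B D (e 0) (fun n => e (S n))) ->
  uniform (fun D e => forall x, D x -> B D x e).
Proof.
move=> [p hp]; exists (fAll p) => D e /=.
by split=> h x /h; [move/hp|move=> hB; apply/hp].
Qed.

Lemma uni_ex (B : (U -> Prop) -> U -> (nat -> U) -> Prop) :
  uniform (fun D e => B D (e 0) (fun n => e (S n))) ->
  uniform (fun D e => exists x, D x /\ B D x e).
Proof.
move=> [p hp]; exists (fNot (fAll (fNot p))) => D e /=; split.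
  move=> h; apply: NNPP => n; apply: h => x hx hs; apply: n; exists x; split=> //.
  by move/hp: hs.
by move=> [x [hx hB]] h; apply: (h x hx); apply/hp.
Qed.

Definition is_upair (D : U -> Prop) (z a b : U) : Prop :=
  forall w, D w -> (w ∈ z <-> w = a \/ w = b).

Definition related (D : U -> Prop) (g x y : U) : Prop :=
  exists p, D p /\ (p ∈ g /\ exists u, D u /\ exists v, D v /\
    (is_upair D u x x /\ is_upair D v x y /\ is_upair D p u v)).

End Uniform.

Ltac uniformity := cbv beta; unfold related, is_upair;
  match goal with
  | |- uniform (fun D e => _ = _) => apply uni_eq
  | |- uniform (fun D e => _ ∈ _) => apply uni_mem
  | |- uniform (fun D e => ~ _) => apply uni_not; uniformity
  | |- uniform (fun D e => _ /\ _) => apply uni_and; uniformity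
  | |- uniform (fun D e => _ \/ _) => apply uni_or; uniformity
  | |- uniform (fun D e => _ <-> _) => apply uni_iff; uniformity
  | |- uniform (fun D e => forall x, D x -> _) => apply uni_all; uniformity
  | |- uniform (fun D e => exists x, D x /\ _) => apply uni_ex; uniformity
  | |- uniform (fun D e => _ -> _) => apply uni_imp; uniformity
  end.

Section Embedding.
Context {U : ZFC_universe}.
Variables theta kappa M N : U.
Variable j : U -> U.
Hypotheses (rt : regular theta) (rk : regular kappa).
Hypotheses (HM : elementary_sub M (H theta)) (kM : succ kappa ⊆ M).
Hypothesis pp : powerset_preserving kappa M N j.
Implicit Types (a b c f g h x y z A B X : U).

Let ok : ordinal kappa := regular_ord rk.

Lemma domain_kappa : kappa ∈ M. Proof. by apply/kM/in_succ; right. Qed.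
Lemma domain_below i : i ∈ kappa -> i ∈ M. Proof. by move=> h; apply/kM/in_succ; left. Qed.
Lemma domain_inhabited : exists x, x ∈ M. Proof. exists kappa; exact: domain_kappa. Qed.

Lemma transfer Q l : uniform Q -> all_in M l ->
  Q (elts M) (lenv l) <-> Q (elts N) (fun n => j (lenv l n)).
Proof.
move=> [p hp] hl; rewrite -!hp; have [[_ h] _] := pp; apply: h.
exact: (lenv_in rt HM domain_inhabited hl).
Qed.

Lemma j_in x : x ∈ M -> j x ∈ N.
Proof. by have [[h _] _] := pp; apply: h. Qed.

Lemma j_fix b : b ∈ kappa -> j b = b.
Proof. by have [_ [[h _] _]] := pp; apply: h. Qed.

Lemma j_mem x y : x ∈ M -> y ∈ M -> x ∈ y <-> j x ∈ j y.
Proof.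
move=> hx hy; apply: (transfer (Q := fun _ e => e 0 ∈ e 1) (l := x :: y :: nil)) => //.
uniformity.
Qed.

Lemma kappa_sub_N b : b ∈ kappa -> b ∈ N.
Proof. by move=> hb; rewrite -(j_fix hb); apply/j_in/domain_below. Qed.

Lemma N_sub x : x ∈ N -> (forall y, y ∈ N -> y ∈ x -> y ∈ kappa) -> x ⊆ kappa.
Proof. by have [_ [_ [_ h]]] := pp; apply: h. Qed.

Lemma N_to_M x : x ∈ N -> x ⊆ kappa -> x ∈ M.
Proof.
have [_ [_ [e _]]] := pp => hx hs.
suff /in_inter[] : x ∈ inter (power kappa) M by [].
by rewrite e; apply/in_inter; split=> //; apply/powerP.
Qed.

Lemma N_ext x y : x ∈ N -> y ∈ N -> (forall z, z ∈ N -> (z ∈ x <-> z ∈ y)) -> x = y.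
Proof.
move=> hx hy h; move: x hx y hy h; refine (proj1 (transfer (Q := fun D _ => forall x, D x -> forall y, D y ->
  (forall z, D z -> (z ∈ x <-> z ∈ y)) -> x = y) (l := nil) _ _) _) => //.
  uniformity.
by move=> x hx y hy; apply: (elem_ext rt HM domain_inhabited).
Qed.

(** The least element of [j kappa] outside [kappa] has the same elements in [N] as
    [kappa]; hence it is [kappa], by the clause on power sets. *)
Lemma kappa_N : kappa ∈ N /\ kappa ∈ j kappa.
Proof.
have [_ [[_ hcrit] _]] := pp.
have jkN : j kappa ∈ N by apply/j_in/domain_kappa.
have below y : y ∈ kappa -> y ∈ j kappa.
  by move=> hy; rewrite -(j_fix hy); apply: (proj1 (j_mem (domain_below hy) domain_kappa)).
pose S := sep (fun y => y ∈ N /\ y ∉ kappa) (j kappa).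
have [|k [/in_sep[hk1 [hk2 hk3]] hmin]] := @foundation U S.
  apply: NNPP => n; apply: hcrit; apply: sub_antisym => // y.
  apply: (N_sub jkN) => z hz hzk; apply: NNPP => nz; apply: n.
  by exists z; apply/in_sep.
have trans : forall x, x ∈ N -> x ∈ j kappa -> forall y, y ∈ N -> y ∈ x -> y ∈ j kappa.
{ refine (proj1 (transfer (Q := fun D e => forall x, D x -> x ∈ e 0 -> forall y, D y ->
    y ∈ x -> y ∈ e 0) (l := kappa :: nil) _ _) _).
  - uniformity.
  - by split=> //; apply: domain_kappa.
  - by move=> x _ /= hx y _; apply: ordinal_trans. }
have tot : forall x, x ∈ N -> x ∈ j kappa -> forall y, y ∈ N -> y ∈ j kappa ->
    x ∈ y \/ x = y \/ y ∈ x.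
{ refine (proj1 (transfer (Q := fun D e => forall x, D x -> x ∈ e 0 -> forall y, D y ->
    y ∈ e 0 -> x ∈ y \/ x = y \/ y ∈ x) (l := kappa :: nil) _ _) _).
  - uniformity.
  - by split=> //; apply: domain_kappa.
  - by move=> x _ /= hx y _ hy; apply: ordinal_total; apply: ordinal_in; eauto. }
have sub1 : k ⊆ kappa.
  apply: (N_sub hk2) => y hy hyk; apply: NNPP => ny; apply: (hmin y) => //.
  by apply/in_sep; split=> //; apply: (trans k).
have e : k = kappa; last by split; rewrite -{1}e.
apply: sub_antisym => // y hy.
have [//|[e|hky]] := tot y (kappa_sub_N hy) (below y hy) k hk2 hk1.
  by subst y.
by case: hk3; apply: ordinal_trans ok hy hky.
Qed.

Lemma kappa_in_N : kappa ∈ N. Proof. by case: kappa_N. Qed.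
Lemma kappa_in_j_kappa : kappa ∈ j kappa. Proof. by case: kappa_N. Qed.

Lemma relatedM g x y : g ∈ M -> x ∈ M -> y ∈ M ->
  related (elts M) g x y <-> opair x y ∈ g.
Proof.
move=> hg hx hy.
have h1 z u v : z ∈ M -> u ∈ M -> v ∈ M -> is_upair (elts M) z u v <-> z = upair u v.
  move=> hz hu hv; split; last by move=> -> w _; apply: upairP.
  move=> h; apply: (elem_ext rt HM domain_inhabited) => //; first exact: (elem_upair rt HM domain_inhabited).
  by move=> w hw; rewrite h // upairP.
have hxx := elem_upair rt HM domain_inhabited hx hx; have hxy := elem_upair rt HM domain_inhabited hx hy.
have hp := elem_opair rt HM domain_inhabited hx hy.
split.
  move=> [p [hpM [hpg [u [hu [v [hv [/(h1 _ _ _ hu hx hx) e1 [/(h1 _ _ _ hv hx hy) e2]]]]]]]]].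
  by move=> /(h1 _ _ _ hpM hu hv) e3; rewrite /opair -e1 -e2 -e3.
move=> h; exists (opair x y); split=> //; split=> //.
by exists (upair x x); split=> //; exists (upair x y); split=> //; split; last split; apply/h1.
Qed.

Lemma related_j g x y : g ∈ M -> x ∈ M -> y ∈ M ->
  opair x y ∈ g -> related (elts N) (j g) (j x) (j y).
Proof.
move=> hg hx hy h.
refine (proj1 (transfer (Q := fun D e => related D (e 0) (e 1) (e 2)) (l := g :: x :: y :: nil) _ _) _) => //.
  uniformity.
exact/relatedM.
Qed.

(** Replacing [g] by its graph on [kappa] makes it a functional relation. *)
Definition graph g : U := lam kappa (ap g).

Lemma graph_M g : g ∈ M -> graph g ∈ M.
Proof.
move=> hg; apply: (elem_term rt HM domain_inhabited (t := fun e => lam (e 0) (ap (e 1))) (l := kappa :: g :: nil)).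
  definability.
by do !split=> //; apply: domain_kappa.
Qed.

Lemma related_graph g x y : g ∈ M -> x ∈ M -> y ∈ M ->
  related (elts M) (graph g) x y <-> x ∈ kappa /\ y = ap g x.
Proof. by move=> hg hx hy; rewrite relatedM ?opair_in_lam //; apply: graph_M. Qed.

Lemma ap_M g x : g ∈ M -> x ∈ M -> ap g x ∈ M.
Proof. exact: (elem_ap rt HM domain_inhabited). Qed.

(** Both the value at [x = j x] and its uniqueness transfer from [M]. *)
Lemma related_N g x y : g ∈ M -> x ∈ kappa -> y ∈ N ->
  related (elts N) (j (graph g)) x y <-> y = j (ap g x).
Proof.
move=> hg hx hy; have hxM := domain_below hx; have hap := ap_M hg hxM; have hgM := graph_M hg.
have hr : related (elts N) (j (graph g)) x (j (ap g x)).
  by rewrite -{1}(j_fix hx); apply: related_j => //; apply/opair_in_lam.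
split; last by move=> ->.
move=> h.
have fn : forall x, x ∈ N -> forall y, y ∈ N -> forall z, z ∈ N ->
    related (elts N) (j (graph g)) x y -> related (elts N) (j (graph g)) x z -> y = z.
{ refine (proj1 (transfer (Q := fun D e => forall x, D x -> forall y, D y -> forall z, D z ->
    related D (e 0) x y -> related D (e 0) x z -> y = z) (l := graph g :: nil) _ _) _).
  - uniformity.
  - by [].
  - by move=> u hu v hv w hw /= /related_graph[]// _ -> /related_graph[]// _ ->. }
by apply: (fn x (kappa_sub_N hx) y hy _ _ h hr); apply: j_in.
Qed.

(** ** [kappa] is a strong limit *)

Lemma j_bounded b x : b ∈ kappa -> x ∈ M -> x ∈ N -> x ⊆ b -> j x = x.
Proof.
move=> hb hx hxN hxb; have hbk := ordinal_sub ok hb.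
apply: N_ext => //; first exact: j_in.
move=> z hz; split=> hzx; last first.
  have hzk := hbk _ (hxb _ hzx).
  by rewrite -(j_fix hzk); apply: (proj1 (j_mem (domain_below hzk) hx)).
have hzb : z ∈ b.
{ rewrite -(j_fix hb).
  move: z hz hzx; refine (proj1 (transfer (Q := fun D e => forall z, D z -> z ∈ e 0 -> z ∈ e 1) (l := x :: b :: nil) _ _) _).
  - uniformity.
  - by do !split=> //; apply: domain_below.
  - by move=> z _ /= /hxb. }
have hzk := hbk _ hzb; apply: (proj2 (j_mem (domain_below hzk) hx)); by rewrite j_fix.
Qed.

(** If [g] injects [kappa] into the power set of [b], then [j g] has at [kappa] a
    value which is a subset of [b], hence fixed by [j] and a value of [g]. *)
Lemma no_injection b g : b ∈ kappa -> g ∈ M -> (forall i, i ∈ kappa -> ap g i ⊆ b) ->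
  (forall i i', i ∈ kappa -> i' ∈ kappa -> ap g i = ap g i' -> i = i') -> False.
Proof.
move=> hb hg hgb gi; have hgM := graph_M hg; have hbM := domain_below hb; have hbk := ordinal_sub ok hb.
have val : forall i, i ∈ N -> i ∈ j kappa -> exists x, x ∈ N /\
    (related (elts N) (j (graph g)) i x /\ forall y, y ∈ N -> y ∈ x -> y ∈ j b).
{ refine (proj1 (transfer (Q := fun D e => forall i, D i -> i ∈ e 0 -> exists x, D x /\
    (related D (e 1) i x /\ forall y, D y -> y ∈ x -> y ∈ e 2)) (l := kappa :: graph g :: b :: nil) _ _) _).
  - uniformity.
  - by do !split=> //; apply: domain_kappa.
  - move=> i hi /= hik; have hap := ap_M hg hi; exists (ap g i); split=> //.
    split; first exact/related_graph.
    by move=> y _; apply: hgb. }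
have inj : forall i, i ∈ N -> i ∈ j kappa -> forall i', i' ∈ N -> i' ∈ j kappa ->
    forall x, x ∈ N -> related (elts N) (j (graph g)) i x ->
    related (elts N) (j (graph g)) i' x -> i = i'.
{ refine (proj1 (transfer (Q := fun D e => forall i, D i -> i ∈ e 0 -> forall i', D i' -> i' ∈ e 0 ->
    forall x, D x -> related D (e 1) i x -> related D (e 1) i' x -> i = i') (l := kappa :: graph g :: nil) _ _) _).
  - uniformity.
  - by do !split=> //; apply: domain_kappa.
  - move=> i hi /= hik i' hi' hik' x hx /related_graph[]// _ e1 /related_graph[]// _ e2.
    by apply: gi => //; congruence. }
have [x [hxN [hrx hxb]]] := val kappa kappa_in_N kappa_in_j_kappa.
rewrite (j_fix hb) in hxb.
have hxk : x ⊆ kappa by apply: (N_sub hxN) => y hy hyx; apply: hbk; apply: hxb.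
have hxb2 : x ⊆ b by move=> y hy; apply: hxb => //; apply/kappa_sub_N/hxk.
have hxM := N_to_M hxN hxk; have hjx := j_bounded hb hxM hxN hxb2.
have [i [hi [hik hri]]] : exists i, i ∈ M /\ (i ∈ kappa /\ related (elts M) (graph g) i x).
{ refine (proj2 (transfer (Q := fun D e => exists i, D i /\ (i ∈ e 0 /\ related D (e 1) i (e 2)))
    (l := kappa :: graph g :: x :: nil) _ _) _).
  - uniformity.
  - by do !split=> //; apply: domain_kappa.
  - by exists kappa; split; [exact: kappa_in_N|split; [exact: kappa_in_j_kappa|rewrite /= hjx]]. }
have [_ e] := proj1 (related_graph hg hi hxM) hri.
have h1 : related (elts N) (j (graph g)) i x by apply/related_N => //; rewrite -e hjx.
have hij : i ∈ j kappa by rewrite -(j_fix hik); apply: (proj1 (j_mem hi domain_kappa)).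
have h2 := inj i (kappa_sub_N hik) hij kappa kappa_in_N kappa_in_j_kappa x hxN h1 hrx.
by subst i; case: (mem_irrefl hik).
Qed.

Lemma small_power_of b : b ∈ kappa -> small kappa (power b).
Proof.
move=> hb; case: (injects_dichotomy (power b) ok) => [[h [hh hi]]|[c [hc ec]]]; last first.
  by exists c; split=> //; apply/equinumerous_injects/equinumerous_sym.
exfalso.
have [|||g [hg [/= hg1 hg2]]] := elem_ex rt HM domain_inhabited (P := fun e =>
  (forall i, i ∈ e 1 -> ap (e 0) i ⊆ e 2) /\
  (forall i, i ∈ e 1 -> forall i', i' ∈ e 1 -> ap (e 0) i = ap (e 0) i' -> i = i'))
  (l := kappa :: b :: nil).
- definability.
- by do !split=> //; [apply: domain_kappa|apply: domain_below].
- exists (lam kappa h); split.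
    apply: H_lam => //; first exact/(elem_H HM)/domain_kappa.
    move=> y hy; apply: (H_sub rt (elem_H HM (domain_below hb))); exact/powerP/hh.
  split=> /= i hik; first by rewrite ap_lam //; apply/powerP/hh.
  by move=> i' hik'; rewrite !ap_lam //; apply: hi.
- by apply: (no_injection hb hg hg1) => i i' hi1 hi2; apply: hg2.
Qed.

Lemma small_power X : small kappa X -> small kappa (power X).
Proof.
move=> [b [hb [f [hf fi]]]]; apply: small_injects (small_power_of hb).
exists (image f); split.
  by move=> a /powerP ha; apply/powerP => y /in_image[x [hx ->]]; apply/hf/ha.
have key a a' : a ⊆ X -> a' ⊆ X -> image f a = image f a' -> a ⊆ a'.
  move=> ha ha' e x hx; have : f x ∈ image f a' by rewrite -e; apply: image_in.
  by move=> /in_image[y [hy /fi ->]] //; [apply: ha|apply: ha'].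
by move=> a a' /powerP ha /powerP ha' e; apply: sub_antisym; apply: key.
Qed.

Lemma kappa_theta : kappa ∈ theta.
Proof.
have [b [hb ib]] := H_small rt (elem_H HM domain_kappa).
by apply: in_cardinal ib => //; case: rt.
Qed.

Lemma power_M X : X ∈ M -> small kappa X -> power X ∈ M.
Proof.
move=> hX hs.
have [|||Y [hY /= hP]] := elem_ex rt HM domain_inhabited (P := fun e => forall y, H theta y ->
  (y ∈ e 0 <-> y ⊆ e 1)) (l := X :: nil).
- definability.
- by [].
- exists (power X); split; last by move=> y _; apply: powerP.
  apply/H_iff => //; split; last by move=> y /powerP; apply/H_sub/elem_H/hX.
  have [b [hb ib]] := small_power hs; exists b; split=> //.
  exact: (ordinal_trans (regular_ord rt) kappa_theta).
- have HX := elem_H HM hX; have HY := elem_H HM hY.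
  suff -> : power X = Y by [].
  apply: extensionality => y; rewrite powerP; split=> hy.
    by apply/hP => //; apply: H_sub hy.
  by apply/hP => //; apply: (H_trans rt) hy.
Qed.

Lemma small_sub_M X : X ∈ M -> small kappa X -> X ⊆ M.
Proof.
move=> hX /(small_equinumerous rk)[c [hc [f [hf [_ fs]]]]].
have [|||g [hg /= hP]] := elem_ex rt HM domain_inhabited (P := fun e => forall x, x ∈ e 1 ->
  exists i, i ∈ e 2 /\ x = ap (e 0) i) (l := X :: c :: nil).
- definability.
- by do !split=> //; apply: domain_below.
- exists (lam c f); split.
    apply: H_lam => //; first exact/(elem_H HM)/domain_below.
    by move=> y /hf; apply: (H_trans rt); apply: elem_H hX.
  by move=> x /= /fs[i [hi <-]]; exists i; rewrite ap_lam.
- move=> x /hP[i [hi ->]]; apply: ap_M => //; apply: domain_below.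
  exact: ordinal_trans ok hc hi.
Qed.

(** A function between subsets of [m] belongs to the third power set of [m]; this set
    is in [M] and has size less than [kappa], so its elements are in [M]. *)
Lemma ltfuns_sub_M : ltfuns kappa kappa ⊆ M.
Proof.
move=> s /in_ltfuns[b [f [hb [hf ->]]]].
have [c [hc hfc]] := regular_bound rk hb hf.
have [m [hm [hbm hcm]]] : exists m, m ∈ kappa /\ b ⊆ m /\ c ⊆ m.
{ have ob := ordinal_in ok hb; have oc := ordinal_in ok hc.
  have [h|[h|h]] := ordinal_total ob oc.
  - by exists c; split=> //; split=> //; apply: ordinal_sub.
  - by rewrite h; exists c; split=> //; split; apply: sub_refl.
  - by exists b; split=> //; split=> //; apply: ordinal_sub. }
have s1 := small_in hm; have s2 := small_power s1; have s3 := small_power s2.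
have m1 := power_M (domain_below hm) s1; have m2 := power_M m1 s2; have m3 := power_M m2 s3.
apply: (small_sub_M m3 (small_power s3)).
apply/powerP => p /in_lam[x [hx ->]]; apply/powerP => z /upairP hz; apply/powerP => w.
by case: hz => -> /upairP[]->; auto.
Qed.

(** Every function between ordinals below [kappa] is in [M], which has size [kappa]. *)
Lemma eq_weak_power_of_embedding : equinumerous M kappa -> eq_weak_power kappa.
Proof.
move=> eM; apply: cantor_bernstein.
  exact: injects_trans (injects_sub ltfuns_sub_M) (equinumerous_injects eM).
exists (fun i => lam (num 1) (fun _ => i)); split.
  move=> i hi; apply/in_ltfuns; exists (num 1), (fun _ => i); split=> //.
  exact: num_regular.
by move=> x y _ _ /lam_inj[_ /(_ (num 0))]; apply; apply/in_succ; right.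
Qed.

(** ** The derived ultrafilter *)

Definition derived : U := sep (fun X => X ⊆ kappa /\ kappa ∈ j X) M.

Lemma in_derived X : X ∈ derived <-> X ∈ M /\ X ⊆ kappa /\ kappa ∈ j X.
Proof. exact: in_sep. Qed.

(** A subset of [succ b], for [b] below [kappa], has an image contained in
    [j (succ b) = succ b], which does not contain [kappa]. *)
Lemma derived_unbounded X b : X ∈ derived -> b ∈ kappa -> exists c, c ∈ X /\ b ∈ c.
Proof.
move=> /in_derived[hX [hXk hk]] hb; apply: NNPP => n.
have hsb := regular_succ rk hb.
have hs : forall y, y ∈ N -> y ∈ j X -> y ∈ j (succ b).
{ refine (proj1 (transfer (Q := fun D e => forall y, D y -> y ∈ e 0 -> y ∈ e 1) (l := X :: succ b :: nil) _ _) _).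
  - uniformity.
  - by do !split=> //; apply: domain_below.
  - move=> y _ /= hy; apply/in_succ.
    have [h|[h|h]] := ordinal_total (ordinal_in ok (hXk _ hy)) (ordinal_in ok hb); [by left|by right|].
    by case: n; exists y. }
have := hs kappa kappa_in_N hk; rewrite (j_fix hsb); exact: mem_asym.
Qed.

Lemma derived_inter A B : A ∈ derived -> B ∈ derived -> inter A B ∈ derived.
Proof.
move=> /in_derived[hA [hAk hkA]] /in_derived[hB [hBk hkB]].
have hI := elem_inter rt HM domain_inhabited hA hB.
apply/in_derived; split=> //; split; first by move=> x /in_inter[/hAk].
have h : forall y, y ∈ N -> (y ∈ j (inter A B) <-> y ∈ j A /\ y ∈ j B).
{ refine (proj1 (transfer (Q := fun D e => forall y, D y -> (y ∈ e 0 <-> y ∈ e 1 /\ y ∈ e 2)) (l := inter A B :: A :: B :: nil) _ _) _).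
  - uniformity.
  - by do !split=> //.
  - by move=> y _ /=; apply: in_inter. }
by apply/(h _ kappa_in_N).
Qed.

Lemma derived_measure A : A ∈ M -> A ⊆ kappa -> A ∈ derived \/ diff kappa A ∈ derived.
Proof.
move=> hA hAk; have hD := elem_diff rt HM domain_inhabited domain_kappa hA.
case: (classic (kappa ∈ j A)) => hk; [left|right]; apply/in_derived; split=> //.
split; first by move=> x /in_diff[].
have h : forall y, y ∈ N -> (y ∈ j (diff kappa A) <-> y ∈ j kappa /\ ~ y ∈ j A).
{ refine (proj1 (transfer (Q := fun D e => forall y, D y -> (y ∈ e 0 <-> y ∈ e 1 /\ ~ y ∈ e 2)) (l := diff kappa A :: kappa :: A :: nil) _ _) _).
  - uniformity.
  - by do !split=> //; exact: domain_kappa.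
  - by move=> y _ /=; apply: in_diff. }
by apply/(h _ kappa_in_N); split=> //; exact: kappa_in_j_kappa.
Qed.

(** [kappa] belongs to [j] of the diagonal intersection if it belongs to the values
    of the image of [g] at the ordinals [b] below [kappa], which are the [j (g b)]. *)
Lemma derived_normal g : g ∈ M -> (forall b, b ∈ kappa -> ap g b ∈ derived) ->
  diagonal kappa (ap g) ∈ derived.
Proof.
move=> hg hb; have hD := elem_diagonal rt HM domain_inhabited domain_kappa hg.
apply/in_derived; split=> //; split; first exact: sep_sub.
have h : forall a, a ∈ N -> (a ∈ j (diagonal kappa (ap g)) <-> a ∈ j kappa /\
    forall b, b ∈ N -> b ∈ a -> forall x, x ∈ N -> related (elts N) (j (graph g)) b x -> a ∈ x).
{ refine (proj1 (transfer (Q := fun D e => forall a, D a -> (a ∈ e 0 <-> a ∈ e 1 /\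
    forall b, D b -> b ∈ a -> forall x, D x -> related D (e 2) b x -> a ∈ x))
    (l := diagonal kappa (ap g) :: kappa :: graph g :: nil) _ _) _).
  - uniformity.
  - by do !split=> //; [exact: domain_kappa|exact: graph_M].
  - move=> a ha /=; rewrite in_sep; split=> -[hak hall]; split=> //.
      by move=> b hbM hba x hx /related_graph[]// hbk ->; apply: hall.
    move=> b hba; have hbk := ordinal_trans ok hak hba.
    have hap := ap_M hg (domain_below hbk).
    by apply: (hall b (domain_below hbk) hba (ap g b)) => //; apply/related_graph => //; apply: domain_below. }
apply/(h _ kappa_in_N); split; first exact: kappa_in_j_kappa.
move=> b _ hbk x hx /related_N -> //.
by have /in_derived[_ []] := hb b hbk.
Qed.

(** The indices of the sets in the ultrafilter, in an enumeration of [X], form a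
    subset of [kappa] which is defined in [N] from [kappa] and the image of the
    enumeration; hence it is in [N], and therefore in [M]. *)
Lemma derived_amenable X g : X ∈ M -> g ∈ M ->
  (forall x, x ∈ X -> exists i, i ∈ kappa /\ x = ap g i) -> inter derived X ∈ M.
Proof.
move=> hX hg hXg.
have comp : forall k, k ∈ N -> forall k', k' ∈ N -> exists a, a ∈ N /\ forall i, i ∈ N ->
    (i ∈ a <-> i ∈ k /\ exists x, x ∈ N /\ (related (elts N) (j (graph g)) i x /\ k' ∈ x)).
{ refine (proj1 (transfer (Q := fun D e => forall k, D k -> forall k', D k' ->
    exists a, D a /\ forall i, D i -> (i ∈ a <-> i ∈ k /\
      exists x, D x /\ (related D (e 0) i x /\ k' ∈ x))) (l := graph g :: nil) _ _) _).
  - uniformity.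
  - by split=> //; apply: graph_M.
  - move=> k hk k' hk' /=; exists (sep (fun i => i ∈ kappa /\ k' ∈ ap g i) k); split.
      apply: (elem_term rt HM domain_inhabited (t := fun e => sep (fun i => i ∈ e 3 /\ e 0 ∈ ap (e 1) i) (e 2)) (l := k' :: g :: k :: kappa :: nil)).
        definability.
      by do !split=> //; exact: domain_kappa.
    move=> i hi; rewrite in_sep; split=> -[hik].
      move=> [hik2 hki]; split=> //; exists (ap g i); have hap := ap_M hg hi.
      by split=> //; split=> //; apply/related_graph.
    by move=> [x [hx [/related_graph[]// hik2 ->] hki]]. }
have [a [haN ha]] := comp kappa kappa_in_N kappa kappa_in_N.
have hak : a ⊆ kappa by apply: (N_sub haN) => y hy /(ha y hy)[].
have haM := N_to_M haN hak.
have hai i : i ∈ kappa -> i ∈ a <-> kappa ∈ j (ap g i).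
  move=> hi; rewrite ha; first exact: kappa_sub_N.
  split; first by move=> [_ [x [hx [/related_N -> //]]]].
  move=> h; split=> //; exists (j (ap g i)); have hap : j (ap g i) ∈ N by apply/j_in/ap_M/domain_below.
  by split=> //; split=> //; apply/related_N.
have -> : inter derived X = sep (fun x => x ⊆ kappa /\ exists i, i ∈ a /\ x = ap g i) X.
  apply: extensionality => x; split.
    move=> /in_inter[/in_derived[hx [hxk hkx]] hxX]; apply/in_sep; split=> //; split=> //.
    have [i [hi e]] := hXg x hxX; exists i; split=> //; apply/hai => //; by rewrite -e.
  move=> /in_sep[hxX [hxk [i [hi e]]]]; apply/in_inter; split=> //; apply/in_derived.
  have hik := hak _ hi; subst x; split; first exact/ap_M/domain_below.
  by split=> //; apply/hai.
apply: (elem_term rt HM domain_inhabited (t := fun e => sep (fun x => x ⊆ e 0 /\ exists i, i ∈ e 1 /\ x = ap (e 2) i) (e 3)) (l := kappa :: a :: g :: X :: nil)).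
  definability.
by do !split=> //; exact: domain_kappa.
Qed.

End Embedding.

(** * From Ramsey embeddings to the filter property *)

(** For each [u], the judge may play at every stage the part of [u] that lies in the
    challenger's model; [ap s (opair x u)] is the challenger's move at stage [x] of
    that run.  The clauses say that it depends only on the previous moves of the
    judge, that it has size at most [kappa], and that the challenger wins.  The
    conditions on [u] are stronger than those on a filter, so as to be expressible
    in [H(theta)] without mentioning finite lists. *)
Definition beats_normal_filters (U : ZFC_universe) (theta alpha kappa s : U) : Prop :=
  (forall x, x ∈ alpha ->
    forall u, H theta u -> (forall A, A ∈ u -> A ⊆ kappa) ->
    forall v, H theta v -> (forall A, A ∈ v -> A ⊆ kappa) ->
    (forall y, y ∈ x ->
      inter u (ap s (opair y u)) = inter v (ap s (opair y u))) ->
    ap s (opair x u) = ap s (opair x v)) /\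
  (forall x, x ∈ alpha ->
    forall u, H theta u -> (forall A, A ∈ u -> A ⊆ kappa) ->
    exists g, H theta g /\ forall z, z ∈ ap s (opair x u) ->
      exists i, i ∈ kappa /\ z = ap g i) /\
  (forall u, H theta u -> (forall A, A ∈ u -> A ⊆ kappa) ->
    (forall A, A ∈ u -> forall b, b ∈ kappa -> exists c, c ∈ A /\ b ∈ c) ->
    (forall A, A ∈ u -> forall B, B ∈ u -> inter A B ∈ u) ->
    (forall x, x ∈ alpha -> forall A, A ∈ ap s (opair x u) -> A ⊆ kappa ->
      A ∈ u \/ diff kappa A ∈ u) ->
    ~ (forall x, x ∈ alpha -> forall h, h ∈ ap s (opair x u) ->
      (forall b, b ∈ kappa -> ap h b ∈ u) -> diagonal kappa (ap h) ∈ u)).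

Lemma filter_of_closed (U : ZFC_universe) (kappa u : U) : regular kappa ->
  (forall A, A ∈ u -> A ⊆ kappa) ->
  (forall A, A ∈ u -> forall b, b ∈ kappa -> exists c, c ∈ A /\ b ∈ c) ->
  (forall A, A ∈ u -> forall B, B ∈ u -> inter A B ∈ u) -> filter kappa u.
Proof.
move=> rk uk unb clo; split; first by move=> A /uk/powerP.
have key (l : list U) A : A ∈ u -> (forall B, In B l -> B ∈ u) ->
    sep (fun x => x ∈ A /\ forall B, In B l -> x ∈ B) kappa ∈ u.
  elim: l A => [|B l IH] A hA hl.
    suff -> : sep (fun x => x ∈ A /\ forall B, In B nil -> x ∈ B) kappa = A by [].
    apply: extensionality => x; rewrite in_sep; split; first by move=> [_ []].
    by move=> hx; split; first exact: uk hx.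
  have := IH (inter A B) (clo A hA B (hl B (or_introl eq_refl))) (fun C h => hl C (or_intror h)).
  congr (_ ∈ u); apply: extensionality => x; split=> /in_sep[hx [h1 h2]]; apply/in_sep; split=> //.
    move/in_inter: h1 => [hA1 hB1]; split=> // C /= [<-//|]; exact: h2.
  split; first by apply/in_inter; split=> //; apply: h2; left.
  by move=> C hC; apply: h2; right.
move=> [|A l] hl.
  suff -> : sep (fun x => forall A, In A nil -> x ∈ A) kappa = kappa by apply: equinumerous_refl.
  by apply: sub_antisym => x; [apply: sep_sub|move=> hx; apply/in_sep].
have hu := key l A (hl A (or_introl eq_refl)) (fun C h => hl C (or_intror h)).
suff -> : sep (fun x => forall B, In B (A :: l) -> x ∈ B) kappa =
    sep (fun x => x ∈ A /\ forall B, In B l -> x ∈ B) kappa.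
  by apply: unbounded_equinumerous => //; [apply: uk|apply: unb].
apply: extensionality => x; split=> /in_sep[hx h]; apply/in_sep; split=> //.
  by split; [apply: h; left|move=> C hC; apply: h; right].
by case: h => h1 h2 B /= [<-//|]; apply: h2.
Qed.

Section CodedStrategy.
Context {U : ZFC_universe}.
Variables theta kappa alpha : U.
Hypotheses (rt : regular theta) (rk : regular kappa) (ra : regular alpha).
Hypotheses (ak : alpha ⊆ kappa) (kt : kappa ∈ theta).
Variable sigma : U -> (U -> U) -> U.
Hypothesis winning : winning_strategy theta kappa alpha sigma.
Implicit Types (u v x y z A B : U).

(** Only legal runs bound the size of the challenger's moves; trimming them bounds it
    for every [u], and changes nothing in a legal run. *)
Definition trim (X : U) : U :=
  match excluded_middle_informative
    (equinumerous X kappa /\ forall x, x ∈ X -> H theta x)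
  with left _ => X | right _ => empty end.

Lemma trim_id X : equinumerous X kappa -> (forall x, x ∈ X -> H theta x) -> trim X = X.
Proof. by rewrite /trim; case: excluded_middle_informative => // n h1 h2; case: n. Qed.

Lemma trim_le X : injects (trim X) kappa.
Proof.
rewrite /trim; case: excluded_middle_informative => [[h _]|_].
  exact: equinumerous_injects.
by exists (fun x => x); split=> [x hx|x y hx]; case: (emptyP hx).
Qed.

Lemma trim_H X : H theta (trim X).
Proof.
apply/(H_iff rt); split; first by exists kappa; split=> //; apply: trim_le.
by rewrite /trim; case: excluded_middle_informative => [[_ h]//|_ x /emptyP].
Qed.

(** The challenger's moves, when he follows [sigma] and the judge always plays the
    part of [u] that lies in the current model. *)
Definition moves u : U -> U :=
  wfrec (@mem_wf U) (fun x S => trim (sigma x (fun y => inter u (S y)))).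

Lemma moves_eq u x : x ∈ alpha ->
  moves u x = trim (sigma x (fun y => inter u (moves u y))).
Proof.
move=> hx; rewrite {1}/moves wfrec_eq -/(moves u); congr trim.
by apply: (proj1 winning) => // y hy; rewrite restrT.
Qed.

Lemma moves_ext u v x : x ∈ alpha ->
  (forall y, y ∈ x -> inter u (moves u y) = inter v (moves u y)) ->
  moves u x = moves v x.
Proof.
move: x; apply: mem_ind => x IH hx h.
rewrite !moves_eq //; congr trim; apply: (proj1 winning) => // y hy.
rewrite -(IH y hy) ?h //; first exact: ordinal_trans (regular_ord ra) hx hy.
move=> z hz; apply: h; apply: ordinal_trans hz => //.
exact: ordinal_in (regular_ord ra) hx.
Qed.

(** If [u] measured all the models of the run and were normal for them, then playing
    the parts of [u] would be legal and winning for the judge. *)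
Lemma moves_win u : (forall A, A ∈ u -> A ⊆ kappa) ->
  (forall A, A ∈ u -> forall b, b ∈ kappa -> exists c, c ∈ A /\ b ∈ c) ->
  (forall A, A ∈ u -> forall B, B ∈ u -> inter A B ∈ u) ->
  (forall x, x ∈ alpha -> forall A, A ∈ moves u x -> A ⊆ kappa ->
    A ∈ u \/ diff kappa A ∈ u) ->
  ~ (forall x, x ∈ alpha -> forall h, h ∈ moves u x ->
    (forall b, b ∈ kappa -> ap h b ∈ u) -> diagonal kappa (ap h) ∈ u).
Proof.
move=> uk unb clo mea nor.
have fil := filter_of_closed rk uk unb clo.
have fils v : v ⊆ u -> filter kappa v.
  move=> hv; case: fil => h1 h2; split; first exact: sub_trans h1.
  by move=> l hl; apply: h2 => A /hl/hv.
pose F y := inter u (moves u y).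
have [_ /(_ F) [win1 win2]] := winning.
pose M x := sigma x F.
have step x : x ∈ alpha -> legal_run theta kappa x M F ->
    challenger_legal theta kappa x M F (M x) /\ moves u x = M x.
  move=> hx run; have hc := win1 x hx run; split=> //.
  rewrite moves_eq // trim_id //; first by case: hc => -[[]].
  by case: hc => _ [h _]; apply: elem_H h.
have main x : x ∈ alpha -> challenger_legal theta kappa x M F (M x) /\
    judge_legal kappa x F (M x) (F x) /\ moves u x = M x.
  move: x; apply: mem_ind => x IH hx.
  have hin y : y ∈ x -> y ∈ alpha by apply: ordinal_trans (regular_ord ra) hx.
  have run : legal_run theta kappa x M F.
    by move=> y hy; have [h1 [h2 _]] := IH y hy (hin y hy).
  have [hc e] := step x hx run; split=> //; split=> //.
  have [[[_ [kM _]] _] [hel [hmono _]]] := hc.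
  have hk : kappa ∈ M x by apply/kM/in_succ; right.
  split; first by apply: fils => A /in_inter[].
  split.
    move=> A /in_inter[/powerP hA hAM]; rewrite /F e.
    have hd := elem_diff rt hel (ex_intro (fun y => y ∈ M x) kappa hk) hk hAM.
    by have [|h|h] := mea x hx A _ hA; [rewrite e|left; apply/in_inter|right; apply/in_inter].
  move=> y hy A; rewrite /F => /in_inter[hA hAM]; apply/in_inter; split=> //.
  by rewrite e; apply: (hmono y hy); have [_ [_ <-]] := IH y hy (hin y hy).
have run : legal_run theta kappa alpha M F by move=> x /main[h1 [h2 _]].
apply: (win2 run).
have Fu x A : A ∈ F x -> A ∈ u by move=> /in_inter[].
split; last split.
- by apply: fils => A /in_bigcup_seq[x [_]]; apply: Fu.
- move=> A /in_inter[hA /in_bigcup_seq [x [hx hAM]]].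
  have [_ [[_ [hm _]] _]] := main x hx.
  have [h|h] : A ∈ F x \/ diff kappa A ∈ F x by apply: hm; apply/in_inter.
  + by left; apply/in_bigcup_seq; exists x.
  + by right; apply/in_bigcup_seq; exists x.
- move=> X /in_bigcup_seq[x [hx hXM]] hX.
  have [[[[_ [kM _]] _] [hel _]] [_ e]] := main x hx.
  have hk : kappa ∈ M x by apply/kM/in_succ; right.
  have eD : diagonal kappa X = diagonal kappa (ap (lam kappa X)).
    apply: extensionality => a; split=> /in_sep[ha h]; apply/in_sep; split=> // b hb;
      have := h b hb; rewrite ap_lam //; exact: ordinal_trans (regular_ord rk) ha hb.
  apply/in_bigcup_seq; exists x; split=> //; apply/in_inter; rewrite e eD; split.
    apply: (nor x hx); first by rewrite e.
    move=> b hb; rewrite ap_lam //.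
    by have /in_bigcup_seq[y [_]] := hX b hb; apply: Fu.
  exact: (elem_diagonal rt hel (ex_intro (fun y => y ∈ M x) kappa hk)).
Qed.

Definition strategy_code : U :=
  bigcup_seq alpha (fun x => image (fun u => opair (opair x u) (moves u x)) (power (power kappa))).

Lemma strategy_code_ap x u : x ∈ alpha -> (forall A, A ∈ u -> A ⊆ kappa) ->
  ap strategy_code (opair x u) = moves u x.
Proof.
move=> hx hu; apply: ap_eq.
  apply/in_bigcup_seq; exists x; split=> //; apply/in_image; exists u; split=> //.
  by apply/powerP => A hA; apply/powerP/hu.
by move=> y /in_bigcup_seq[x' [_ /in_image[u' [_ /opair_inj[/opair_inj[<- <-] ->]]]]].
Qed.

Variable theta' : U.
Hypotheses (rt' : regular theta') (tt' : theta ∈ theta').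
Hypothesis Hpp : H theta' (power (power kappa)).

Lemma H_in_theta' x : x ∈ theta -> H theta' x.
Proof. by move=> h; apply: H_ordinal => //; apply: ordinal_trans tt' h; apply: regular_ord. Qed.

Lemma alpha_H : H theta' alpha.
Proof. by apply: (H_sub rt' (x := kappa)) => //; apply: H_in_theta'. Qed.

Lemma moves_H u x : x ∈ alpha -> H theta' (moves u x).
Proof. by move=> hx; rewrite moves_eq //; apply: (H_mono rt rt' tt'); apply: trim_H. Qed.

Lemma strategy_code_H : H theta' strategy_code.
Proof.
apply: H_bigcup => //; apply: H_image => //; first exact: alpha_H.
move=> x hx; apply: H_image => // u hu; apply: H_opair => //; last exact: moves_H.
by apply: H_opair => //; [apply: (H_trans rt' alpha_H)|apply: (H_trans rt' Hpp)].
Qed.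

Lemma strategy_code_beats : beats_normal_filters theta' alpha kappa strategy_code.
Proof.
split; last split.
- move=> x hx u _ hu v _ hv h; rewrite !strategy_code_ap //; apply: moves_ext => // y hy.
  have hya : y ∈ alpha by apply: ordinal_trans (regular_ord ra) hx hy.
  by have := h y hy; rewrite strategy_code_ap.
- move=> x hx u _ hu; rewrite strategy_code_ap //.
  have [f hf] : exists f : U -> U, forall z, z ∈ moves u x -> exists i, i ∈ kappa /\ f i = z.
    have hle : injects (moves u x) kappa by rewrite moves_eq //; apply: trim_le.
    case: (classic (exists z0, z0 ∈ moves u x)) => [[z0 hz0]|n].
      by have [f [_ hf]] := cover_of_injects hz0 hle; exists f.
    by exists (fun z => z) => z hz; case: n; exists z.
  exists (lam (sep (fun i => f i ∈ moves u x) kappa) f); split.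
    apply: H_lam => //.
      by apply: (H_sub rt' (x := kappa)); [apply: H_in_theta'|apply: sep_sub].
    by move=> y /in_sep[_]; apply: (H_trans rt'); apply: moves_H.
  move=> z hz; have [i [hi e]] := hf z hz; exists i; split=> //.
  by rewrite ap_lam //; apply/in_sep; rewrite e.
- move=> u _ hu unb clo mea nor; apply: (moves_win hu unb clo) => x hx.
    by rewrite -strategy_code_ap //; apply: mea.
  by rewrite -strategy_code_ap //; apply: nor.
Qed.

End CodedStrategy.

(** An embedding [j : M -> N] defeats every coded strategy in [M]: the play of the
    judge derived from [j] is, stage by stage, an element of [M]. *)
Section Play.
Context {U : ZFC_universe}.
Variables theta kappa alpha M N s : U.
Variable j : U -> U.
Hypotheses (rt : regular theta) (rk : regular kappa) (ra : regular alpha).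
Hypotheses (ak : alpha ⊆ kappa).
Hypotheses (HM : elementary_sub M (H theta)) (wM : weak_model kappa M).
Hypotheses (cM : closed_lt alpha M) (pp : powerset_preserving kappa M N j).
Hypotheses (sM : s ∈ M) (beats : beats_normal_filters theta alpha kappa s).

Let u : U := derived kappa M j.
Let kM : succ kappa ⊆ M := proj1 (proj2 wM).
Let inh : exists x, x ∈ M := domain_inhabited kM.

Lemma play_sub A : A ∈ u -> A ⊆ kappa.
Proof. by move=> /in_derived[_ []]. Qed.

Lemma play_H : H theta u.
Proof.
apply/(H_iff rt); split; last by move=> A /in_derived[hA _]; apply: elem_H hA.
exists kappa; split; first exact: (kappa_theta rt rk HM kM).
apply: injects_trans (equinumerous_injects (proj1 wM)).
by apply: injects_sub => A /in_derived[].
Qed.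

Lemma play_stage x : x ∈ alpha ->
  ap s (opair x u) ⊆ M /\ inter u (ap s (opair x u)) ∈ M.
Proof.
have [coh [sz _]] := beats.
move: x; apply: mem_ind => x IH hx.
have hin y : y ∈ x -> y ∈ alpha by apply: ordinal_trans (regular_ord ra) hx.
have xM : x ∈ M by apply/kM/in_succ; left; apply: ak.
pose F y := inter u (ap s (opair y u)).
have hF : lam x F ∈ M.
  apply: cM; apply/in_ltfuns; exists x, F; split=> //; split=> // y hy.
  by have [_] := IH y hy (hin y hy).
pose v := bigcup (image (ap (lam x F)) x).
have vM : v ∈ M.
  apply: (elem_term rt HM inh (t := fun e => bigcup (image (ap (e 0)) (e 1))) (l := lam x F :: x :: nil)) => //.
  definability.
have vE z : z ∈ v <-> exists y, y ∈ x /\ z ∈ F y.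
  rewrite (in_bigcup_seq x (ap (lam x F))).
  by split; move=> [y [hy hz]]; exists y; move: hz; rewrite ap_lam.
have hvu : v ⊆ u by move=> z /vE[y [_ /in_inter[]]].
(* [u] need not be in [M], but the part of it that was played before stage [x] is. *)
have e : ap s (opair x u) = ap s (opair x v).
  apply: coh => //; [exact: play_H|exact: play_sub|exact: elem_H vM|by move=> A /hvu/play_sub|].
  move=> y hy; apply: extensionality => z; rewrite !in_inter; split=> -[h1 h2]; split=> //.
    by apply/vE; exists y; split=> //; apply/in_inter.
  exact: hvu.
have SM : ap s (opair x u) ∈ M.
  by rewrite e; apply: (elem_ap rt HM inh) => //; apply: (elem_opair rt HM inh).
have [|||g [hg /= hgs]] := elem_ex rt HM inh (P := fun e => forall z, z ∈ e 1 ->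
    exists i, i ∈ e 2 /\ z = ap (e 0) i) (l := ap s (opair x u) :: kappa :: nil).
- definability.
- by do !split=> //; apply: domain_kappa.
- by have [g [hg hgs]] := sz x hx u play_H play_sub; exists g.
- split; last exact: (derived_amenable rt rk HM kM pp SM hg hgs).
  move=> z /hgs[i [hi ->]]; apply: (ap_M rt HM kM) => //; exact: (domain_below kM).
Qed.

Lemma play_contradiction : False.
Proof.
have [_ [_ bt]] := beats.
apply: (bt u play_H play_sub).
- by move=> A hA b; apply: (derived_unbounded rt rk HM kM pp hA).
- by move=> A hA B; apply: (derived_inter rt rk HM kM pp).
- move=> x hx A hA; apply: (derived_measure rt rk HM kM pp).
  by have [h _] := play_stage hx; apply: h.
- move=> x hx h hh; apply: (derived_normal rt rk HM kM pp).
  by have [hs _] := play_stage hx; apply: hs.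
Qed.

End Play.

(** The set of coded winning strategies is definable in [H theta'], so it has an
    element in [M] as soon as it is nonempty. *)
Theorem filter_property_of_Ramsey (U : ZFC_universe) (alpha kappa : U) :
  regular alpha -> regular kappa -> alpha ⊆ kappa -> Ramsey alpha kappa ->
  eq_weak_power kappa /\ filter_property alpha kappa.
Proof.
move=> ra rk ak ram; split.
  have o0 : ordinal (@empty U) by split=> y /emptyP.
  have [theta [_ [rt /(_ empty)]]] := ram empty o0.
  case; first by move=> x /emptyP.
  move=> M [_ [[eM [kM _]] [HM [_ [N [j pp]]]]]].
  exact: (eq_weak_power_of_embedding rt rk HM kM pp).
move=> theta rt kt [sigma win].
(* [theta'] is taken above [theta] and large enough for [H theta'] to contain the
   code of the strategy, a function on [alpha] and the sets of subsets of [kappa]. *)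
have [d1 [od1 hd1]] := H_exists (power (power kappa)).
have ot := regular_ord rt.
have od : ordinal (union d1 theta) by apply: ordinal_bigcup => y /upairP[]->.
have [theta' [hd [rt' /(_ empty)]]] := ram _ od.
have ot' := regular_ord rt'.
have h1 : d1 ∈ theta' by apply: (ordinal_sub_in od1 ot' _ hd) => x hx; apply/in_union; left.
have h2 : theta ∈ theta' by apply: (ordinal_sub_in ot ot' _ hd) => x hx; apply/in_union; right.
case; first by move=> x /emptyP.
move=> M [_ [wM [HM [cM [N [j pp]]]]]].
have kM : succ kappa ⊆ M by case: wM => _ [].
have aM : alpha ∈ M.
  apply/kM/in_succ; case: (ordinal_subP (regular_ord ra) (regular_ord rk) ak) => h; [by right|by left].
have Hpp := hd1 _ h1.
have [|||s [sM /= hs]] := elem_ex rt' HM (domain_inhabited kM)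
  (P := fun e => beats_normal_filters theta' (e 1) (e 2) (e 0)) (l := alpha :: kappa :: nil).
- unfold beats_normal_filters; definability.
- by do !split=> //; apply: domain_kappa.
- exists (strategy_code theta kappa alpha sigma); split.
    exact: (@strategy_code_H U theta kappa alpha).
  exact: (@strategy_code_beats U theta kappa alpha).
- exact: (play_contradiction rt' rk ra ak HM wM cM pp sM hs).
Qed.

Theorem theorem5p6 (U : ZFC_universe) (alpha kappa : U)
  (alpha_regular : regular alpha) (alpha_uncountable : uncountable_cardinal alpha)
  (kappa_regular : regular kappa) (kappa_uncountable : uncountable_cardinal kappa)
  (alpha_le_kappa : alpha ⊆ kappa) :
  Ramsey alpha kappa <-> eq_weak_power kappa /\ filter_property alpha kappa.
Proof.
split; first exact: filter_property_of_Ramsey.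
move=> [wk fp]; apply: Ramsey_of_filter_property => //.
by case: alpha_uncountable.
Qed.
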